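(* Let $\Omega$, $f$, $K$, $\rho$, $\phi$ satisfy the standing assumptions in the context, and let $X_\phi$, $u_\phi$, $u_f$, $J$, $\operatorname{spt}(f)$ be as defined in the context. A function $u\in X_\phi$ is a solution to the minimum problem $$(\mathrm{P})\qquad\min\left\{-\int_\Omega fu\,dx:\ u\in X_\phi\right\}$$ if and only if $u_f\le u\le u_\phi$. Moreover, the function $u_f$ coincides with $u_\phi$ in $\Omega$ (and hence $u_\phi$ is the unique solution to (P)) if and only if $J\cap\Omega\subseteq\operatorname{spt}(f)$.
   Context: Standing assumptions. $\Omega\subset\mathbb{R}^n$ ($n\ge1$) is a nonempty bounded connected open set. $f\in L^1(\Omega)$, $f\ge0$ a.e. in $\Omega$. $K\subset\mathbb{R}^n$ is a compact convex set of class $C^1$ with $0\in\operatorname{int}K$. Its gauge function is $\rho(\xi)=\inf\{t\ge0:\ \xi\in tK\}$, its polar set is $K^0=\{p\in\mathbb{R}^n:\ \langle p,x\rangle\le1\ \forall x\in K\}$, and $\rho^0$ denotes the gauge function of $K^0$. $\phi\colon\partial\Omega\to\mathbb{R}$ is continuous and satisfies $\phi(x)-\phi(y)\le L(\gamma)$ for all $x,y\in\partial\Omega$ and all $\gamma\in\Gamma_{y,x}$, where, for $x,y\in\overline\Omega$, $\Gamma_{y,x}$ is the set of absolutely continuous curves $\gamma\colon[0,1]\to\overline\Omega$ with $\gamma(0)=y$, $\gamma(1)=x$, and $L(\gamma)=\int_0^1\rho^0(\gamma'(t))\,dt$. Notation. $[\![x,y]\!]$ is the closed segment joining $x$ and $y$,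 and $]\!]x,y[\![=[\![x,y]\!]\setminus\{x,y\}$. $X_\phi=\{u\in C(\overline\Omega)\cap W^{1,\infty}(\Omega):\ u=\phi\text{ on }\partial\Omega,\ Du\in K\text{ a.e. in }\Omega\}$. The Lax–Hopf function is $u_\phi(x)=\inf\{\phi(y)+L(\gamma):\ y\in\partial\Omega,\ \gamma\in\Gamma_{y,x}\}$, $x\in\overline\Omega$; one has $u_\phi(x)=\min\{\phi(y)+\rho^0(x-y):\ y\in V_x\}$ with $V_x=\{y\in\partial\Omega:\ ]\!]y,x[\![\subset\Omega\}$. $\operatorname{spt}(f)$ is the complement in $\overline\Omega$ of the union of all relatively open subsets $A\subseteq\overline\Omega$ such that $f=0$ a.e. in $A$. The function $u_f\colon\overline\Omega\to\mathbb{R}$ is $$u_f(x)=\sup\{u_\phi(z)-L(\gamma):\ z\in\partial\Omega\cup\operatorname{spt}(f),\ \gamma\in\Gamma_{x,z}\}.$$ Transport ray endpoints. $\Pi(x)=\{y\in V_x:\ u_\phi(x)=\phi(y)+\rho^0(x-y)\}$; for $x\in\Omega$, $\Delta(x)=\{(x-y)/\rho^0(x-y):\ y\in\Pi(x)\}$. $D=\{x\in\Omega:\ \Delta(x)\text{ is not a singleton}\}$. For $x\in\Omega\setminus D$, $d(x)$ is the unique element of $\Delta(x)$, and $\tau(x)=\sup\{t\ge0:\ x+sd(x)\in\Omega\ \forall s\in[0,t),\ u_\phi(x+sd(x))=u_\phi(x)+s\ \forall s\in[0,t]\}$; for $x\in D$, $\tau(x)=0$. For $x\in\Omega$, $q(x)=x+\tau(x)d(x)$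 (with $q(x)=x$ if $x\in D$), and $J=\bigcup_{x\in\Omega}\{q(x)\}$. *)

(* Defs.v *)
From HB Require Import structures.
From mathcomp Require Import all_boot all_order all_algebra.
From mathcomp Require Import all_classical all_reals all_analysis.

Set Implicit Arguments.
Unset Strict Implicit.
Unset Printing Implicit Defensive.

Import Order.TTheory GRing.Theory Num.Theory.
Import numFieldNormedType.Exports.

Local Open Scope classical_set_scope.
Local Open Scope ring_scope.

(** R^n is ['rV[R]_n], with the Borel sigma-algebra. Sets that are null for the
    completed Lebesgue measure are covered by [negligible], and every Lebesgue
    measurable function has a Borel representative. *)

HB.instance Definition _ (R : realType) (n : nat) :=
  @isMeasurable.Build (sigma_display (@open 'rV[R]_n)) 'rV[R]_n
    <<s (@open 'rV[R]_n) >> (@sigma_algebra0 _ setT _)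
    (@sigma_algebraC _ _) (@sigma_algebra_bigcup _ setT _).

Definition row_cons (R : realType) (n : nat) (p : R * 'rV[R]_n) : 'rV[R]_n.+1 :=
  row_mx p.1%:M p.2.

(** Iterated product of the one-dimensional Lebesgue measure; see
    [lebesgue_rV_boxE] for its value on boxes. *)
Fixpoint lebesgue_rV (R : realType) (n : nat) : set 'rV[R]_n -> \bar R :=
  match n with
  | 0 => dirac (0 : 'rV[R]_0)
  | m.+1 => pushforward
      (@product_measure1 _ _ (measurableTypeR R) 'rV[R]_m R
         lebesgue_measure (@lebesgue_rV R m))
      (@row_cons R m)
  end.
Arguments lebesgue_rV {R n}.

Section sigma_finite_of.
Context d (T : measurableType d) (R : realType).
Variable m : {measure set T -> \bar R}.
Hypothesis mT : sigma_finite setT m.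

Definition sigma_finite_of & sigma_finite setT m : set T -> \bar R := m.

HB.instance Definition _ := Measure.on (sigma_finite_of mT).
HB.instance Definition _ := Measure_isSigmaFinite.Build _ _ _
  (sigma_finite_of mT) mT.

End sigma_finite_of.

Section lebesgue_rV_measure.
Context (R : realType).

Definition rV_box n (a b : 'I_n -> R) : set 'rV[R]_n :=
  [set v | forall i, a i < v ord0 i < b i].

Lemma row_consE0 n (p : R * 'rV[R]_n) : row_cons p ord0 ord0 = p.1.
Proof.
rewrite /row_cons mxE; case: splitP => [j _|k] /=; last by [].
by rewrite [j]ord1 mxE eqxx mulr1n.
Qed.

Lemma row_consES n (p : R * 'rV[R]_n) (i : 'I_n) :
  row_cons p ord0 (lift ord0 i) = p.2 ord0 i.
Proof.
rewrite /row_cons mxE; case: splitP => [j|k] /=.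
  by rewrite [j]ord1.
by rewrite /bump /= !add1n => -[]/ord_inj ->.
Qed.

Lemma open_rV_box n (a b : 'I_n -> R) : open (rV_box a b).
Proof.
rewrite openE => v /= vab.
apply: (@filter_forall 'rV[R]_n _ (fun i w => a i < w ord0 i < b i) (nbhs v)).
move=> i.
suff /(@coord_continuous R 1 n ord0 i v) : nbhs (v ord0 i) [set x | a i < x < b i].
  by [].
apply: open_nbhs_nbhs; split; last exact: vab.
have -> : [set x | a i < x < b i] = `]a i, b i[%classic.
  by apply/seteqP; split => x /=; rewrite in_itv.
exact: interval_open.
Qed.

Lemma measurable_rV_box n (a b : 'I_n -> R) : measurable (rV_box a b).
Proof. by apply: sub_sigma_algebra; exact: open_rV_box. Qed.

Lemma open_rV_bigcup n (A : set 'rV[R]_n) : open A ->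
  A = \bigcup_(q in [set q : {ffun 'I_n -> rat * rat} |
        rV_box (fun i => ratr (q i).1) (fun i => ratr (q i).2) `<=` A])
      rV_box (fun i => ratr (q i).1) (fun i => ratr (q i).2).
Proof.
move=> oA; apply/seteqP; split; last by move=> v [q /= qA]; exact: qA.
move=> v Av.
have /nbhs_ballP[e /= e0 eA] : nbhs v A by exact: open_nbhs_nbhs.
have H i : exists p : rat * rat,
    v ord0 i - e < ratr p.1 /\ ratr p.1 < v ord0 i /\
    v ord0 i < ratr p.2 /\ ratr p.2 < v ord0 i + e.
  have [|p1] := @rat_in_itvoo R (v ord0 i - e) (v ord0 i).
    by rewrite ltrBlDr ltrDl.
  rewrite in_itv /= => /andP[h1 h2].
  have [|p2] := @rat_in_itvoo R (v ord0 i) (v ord0 i + e).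
    by rewrite ltrDl.
  rewrite in_itv /= => /andP[h3 h4].
  by exists (p1, p2).
have [p Hp] := choice H.
exists [ffun i => p i] => /=.
  move=> w /= Bw; apply: eA; split => // i j; rewrite (ord1 i).
  have := Bw j; have := Hp j; rewrite ffunE => -[h1 [h2 [h3 h4]]] /andP[h5 h6].
  by rewrite /ball /= ltr_distlC (lt_trans h1 h5) (lt_trans h6 h4).
by move=> i; rewrite ffunE; have [_ [-> [-> _]]] := Hp i.
Qed.

Lemma preimage_row_cons_box n (a b : 'I_n.+1 -> R) :
  @row_cons R n @^-1` rV_box a b =
  `]a ord0, b ord0[%classic `*` rV_box (a \o lift ord0) (b \o lift ord0).
Proof.
apply/seteqP; split => -[x v] /=.
  move=> H; split; first by have := H ord0; rewrite row_consE0 in_itv.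
  by move=> i /=; have := H (lift ord0 i); rewrite row_consES.
move=> [h1 h2] i; case: (unliftP ord0 i) => [j|] ->.
  by rewrite row_consES; exact: h2.
by rewrite row_consE0; move: h1; rewrite in_itv.
Qed.

Lemma measurable_row_cons n :
  @measurable_fun _ _ (measurableTypeR R * 'rV[R]_n)%type 'rV[R]_n.+1
    setT (@row_cons R n).
Proof.
apply: (@measurability _ _ _ _ _ _ (@open 'rV[R]_n.+1)) => //.
move=> _ [A oA <-]; rewrite setTI (open_rV_bigcup oA) preimage_bigcup.
rewrite bigcup_mkcond; apply: countable_bigcupT_measurable => // q.
case: ifPn => _; last exact: measurable0.
rewrite preimage_row_cons_box.
by apply: measurableX; [exact: measurable_itv|exact: measurable_rV_box].
Qed.

Lemma lebesgue_rV_is_measure n :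
  exists m : {sigma_finite_measure set 'rV[R]_n -> \bar R},
    m = lebesgue_rV :> (set 'rV[R]_n -> \bar R) /\
    forall a b : 'I_n -> R, (forall i, a i <= b i) ->
      m (rV_box a b) = (\prod_(i < n) (b i - a i))%:E.
Proof.
elim: n => [|n [m [mE mB]]] /=.
  eexists; split; first by [].
  move=> a b _ /=; rewrite big_ord0 diracE mem_set//.
  by move=> [].
rewrite -mE.
pose P : {measure set (measurableTypeR R * 'rV[R]_n)%type -> \bar R} :=
  @product_measure1 _ _ (measurableTypeR R) 'rV[R]_n R lebesgue_measure m.
pose Q : {measure set 'rV[R]_n.+1 -> \bar R} :=
  @measure_function_pushforward__canonical__measure_function_Measure
    _ _ _ _ _ P _ (@measurable_row_cons n).
have QB (a b : 'I_n.+1 -> R) : (forall i, a i <= b i) ->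
    Q (rV_box a b) = (\prod_(i < n.+1) (b i - a i))%:E.
  move=> ab; rewrite /Q /= /pushforward preimage_row_cons_box.
  rewrite /P /= product_measure1E//; [|exact: measurable_rV_box].
  rewrite mB; last by move=> i; exact: ab.
  rewrite big_ord_recl EFinM; congr (_ * _)%E.
  etransitivity; first exact: lebesgue_measure_itv.
  rewrite /= lte_fin; case: ltP => // ba.
  by have /eqP -> : a ord0 == b ord0 by [rewrite eq_le ab ba]; rewrite subrr.
have sQ : sigma_finite setT Q.
  exists (fun k => rV_box (fun=> - k%:R) (fun=> k%:R)).
    apply/esym; rewrite -subTset => v _.
    have [k vk] : exists k, `|v| < k%:R.
      by exists (Num.truncn `|v|).+1; exact: truncnS_gt.
    exists k => //= i; rewrite -ltr_norml; apply: le_lt_trans vk.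
    rewrite [X in _ <= X]mx_normrE.
    exact: (le_bigmax _ (fun i => `|v i.1 i.2|) (ord0, i)).
  move=> k; split; first exact: measurable_rV_box.
  by rewrite QB ?ltry// => i; rewrite ge0_cp.
have QE : Q = pushforward (@product_measure1 _ _ (measurableTypeR R) 'rV[R]_n R
  lebesgue_measure m) (@row_cons R n) :> (set _ -> \bar R) by [].
clearbody Q.
exists (sigma_finite_of sQ : {sigma_finite_measure set _ -> \bar R}).
by split => //=; rewrite /sigma_finite_of QE.
Qed.

Let lebesgue_rV0 n : @lebesgue_rV R n set0 = 0%E.
Proof. by have [m [<- _]] := lebesgue_rV_is_measure n; exact: measure0. Qed.

Let lebesgue_rV_ge0 n A : (0 <= @lebesgue_rV R n A)%E.
Proof. by have [m [<- _]] := lebesgue_rV_is_measure n; exact: measure_ge0. Qed.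

Let lebesgue_rV_sigma_additive n : semi_sigma_additive (@lebesgue_rV R n).
Proof.
have [m [<- _]] := lebesgue_rV_is_measure n.
exact: measure_semi_sigma_additive.
Qed.

HB.instance Definition _ n := isMeasure.Build _ _ _ (@lebesgue_rV R n)
  (lebesgue_rV0 n) (@lebesgue_rV_ge0 n) (@lebesgue_rV_sigma_additive n).

Let lebesgue_rV_sigma_finite n : sigma_finite setT (@lebesgue_rV R n).
Proof.
have [m [<- _]] := lebesgue_rV_is_measure n; exact: sigma_finiteT.
Qed.

HB.instance Definition _ n := Measure_isSigmaFinite.Build _ _ _
  (@lebesgue_rV R n) (lebesgue_rV_sigma_finite n).

Lemma lebesgue_rV_boxE n (a b : 'I_n -> R) : (forall i, a i <= b i) ->
  lebesgue_rV (rV_box a b) = (\prod_(i < n) (b i - a i))%:E.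
Proof. by have [m [<- mB]] := lebesgue_rV_is_measure n; exact: mB. Qed.

End lebesgue_rV_measure.

Section gauge.
Context (R : realType) (n : nat).
Implicit Types (x y xi p : 'rV[R]_n) (K U A : set 'rV[R]_n).

Definition dotmul x y : R := \sum_(i < n) x ord0 i * y ord0 i.

Definition frontier A : set 'rV[R]_n := closure A `\` interior A.

(** The infimum is over a nonempty set as soon as [0] is interior to [K]. *)
Definition gauge K xi : R :=
  inf [set t | 0 <= t /\ exists2 k, K k & xi = t *: k].

Definition polar K : set 'rV[R]_n :=
  [set p | forall x, K x -> dotmul p x <= 1].

Definition partial (i : 'I_n) (f : 'rV[R]_n -> R) (x : 'rV[R]_n) : R :=
  'D_(delta_mx ord0 i) f x.

(** [Ck_on k U f]: [f] is of class C^k on the open set [U]. *)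
Fixpoint Ck_on (k : nat) U (f : 'rV[R]_n -> R) : Prop :=
  (forall x, U x -> {for x, continuous f}) /\
  match k with
  | 0 => True
  | l.+1 => forall i : 'I_n,
      (forall x, U x -> derivable f x (delta_mx ord0 i)) /\
      Ck_on l U (partial i f)
  end.

(** A closed set is of class C^1 when, near each of its boundary points, it is
    the sublevel set of a C^1 function without critical points (so that its
    boundary is a C^1 hypersurface with the set lying on one side). *)
Definition class_C1 K : Prop :=
  forall x, frontier K x ->
    exists (U : set 'rV[R]_n) (psi : 'rV[R]_n -> R),
      [/\ open U /\ U x, Ck_on 1 U psi,
          forall y, U y -> exists i, partial i psi y != 0 &
          K `&` U = [set y | psi y <= 0] `&` U].

Definition closed_segment x y : set 'rV[R]_n :=
  [set (1 - t) *: x + t *: y | t in `[0, 1]%classic].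

Definition open_segment x y : set 'rV[R]_n :=
  closed_segment x y `\` [set x; y].

End gauge.

(** Functions on [Omega] (or on its closure) are represented by total functions
    whose values elsewhere are never used. *)

Section sobolev.
Context (R : realType) (n : nat).
Variable Omega : set 'rV[R]_n.
Implicit Types (u h eta : 'rV[R]_n -> R) (g : 'rV[R]_n -> 'rV[R]_n).

Definition test_function eta : Prop :=
  [/\ forall k, Ck_on k setT eta,
      compact (closure [set x | eta x != 0]) &
      closure [set x | eta x != 0] `<=` Omega].

Definition Linfty h : Prop :=
  measurable_fun Omega h /\
  exists M : R, \forall x \ae lebesgue_rV, Omega x -> `|h x| <= M.

Definition weak_gradient u g : Prop :=
  forall eta, test_function eta -> forall i : 'I_n,
    \int[lebesgue_rV]_(x in Omega) (u x * partial i eta x) =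
    - \int[lebesgue_rV]_(x in Omega) (g x ord0 i * eta x).

(** [u] belongs to W^{1,oo}(Omega) and [g] represents its gradient [Du]. *)
Definition W1infty u g : Prop :=
  [/\ Linfty u, forall i : 'I_n, Linfty (fun x => g x ord0 i) &
      weak_gradient u g].

End sobolev.

Section curves.
Context (R : realType) (n : nat).
Implicit Types (gamma : R -> 'rV[R]_n) (x y : 'rV[R]_n).

Definition absolutely_continuous01 gamma : Prop :=
  forall eps : R, 0 < eps -> exists2 delta : R, 0 < delta &
    forall (m : nat) (a b : 'I_m -> R),
      (forall i, [/\ 0 <= a i, a i <= b i & b i <= 1]) ->
      trivIset setT (fun i => `]a i, b i[%classic) ->
      \sum_(i < m) (b i - a i) < delta ->
      \sum_(i < m) `|gamma (b i) - gamma (a i)| < eps.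

(** [curves Omega y x] is Gamma_{y,x}: the curves run from [y] to [x]; only
    the values of [gamma] on [0, 1] matter. *)
Definition curves (Omega : set 'rV[R]_n) y x : set (R -> 'rV[R]_n) :=
  [set gamma | [/\ absolutely_continuous01 gamma,
                   forall t, 0 <= t <= 1 -> closure Omega (gamma t),
                   gamma 0 = y & gamma 1 = x]].

(** For an absolutely continuous curve the derivative exists, and is integrable,
    almost everywhere on [0, 1]; [derive1] has a default value elsewhere. *)
Definition curve_length (K : set 'rV[R]_n) gamma : R :=
  \int[lebesgue_measure]_(t in `[0, 1]) gauge (polar K) (derive1 gamma t).

End curves.

Section problem.
Context (R : realType) (n : nat).
Variables (Omega : set 'rV[R]_n) (f : 'rV[R]_n -> R) (K : set 'rV[R]_n).
Variable phi : 'rV[R]_n -> R.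
Implicit Types (x y z : 'rV[R]_n) (u v : 'rV[R]_n -> R).

Local Notation rho0 := (gauge (polar K)).
Local Notation L := (curve_length K).

Definition X_phi : set ('rV[R]_n -> R) :=
  [set u | [/\ {within closure Omega, continuous u},
               forall y, frontier Omega y -> u y = phi y &
               exists g, W1infty Omega u g /\
                 \forall x \ae lebesgue_rV, Omega x -> K (g x)]].

Definition objective u : R := - \int[lebesgue_rV]_(x in Omega) (f x * u x).

Definition solution_P u : Prop :=
  X_phi u /\ forall v, X_phi v -> objective u <= objective v.

(** The real [inf] and [sup] below are over nonempty sets that are bounded on the
    relevant side, for [x] in the closure of a bounded nonempty open [Omega]. *)
Definition u_phi x : R :=
  inf [set r | exists y gamma,
    [/\ frontier Omega y, curves Omega y x gamma & r = phi y + L gamma]].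

(** [f] is a function on [Omega], so "[f = 0] a.e. in [A]" only concerns the
    points of [A] in [Omega]. *)
Definition spt : set 'rV[R]_n :=
  closure Omega `\` \bigcup_(A in [set A |
    (exists2 O, open O & A = O `&` closure Omega) /\
    \forall x \ae lebesgue_rV, (A `&` Omega) x -> f x = 0]) A.

Definition u_f x : R :=
  sup [set r | exists z gamma,
    [/\ (frontier Omega `|` spt) z, curves Omega x z gamma &
        r = u_phi z - L gamma]].

Definition visible x : set 'rV[R]_n :=
  [set y | frontier Omega y /\ open_segment y x `<=` Omega].

Definition Pi x : set 'rV[R]_n :=
  [set y | visible x y /\ u_phi x = phi y + rho0 (x - y)].

Definition Delta x : set 'rV[R]_n :=
  [set (rho0 (x - y))^-1 *: (x - y) | y in Pi x].

Definition D : set 'rV[R]_n :=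
  [set x | Omega x /\ ~ exists d, Delta x = [set d]].

(** [xget 0 (Delta x)] is the unique element of [Delta x] when [x] is in [Omega]
    but not in [D]; on [D] it is multiplied by [tau x = 0] in [ray_end]. *)
Definition ray_dir x : 'rV[R]_n := xget 0 (Delta x).

Definition tau x : R :=
  if `[< D x >] then 0 else
  sup [set t | [/\ 0 <= t,
    forall s, 0 <= s < t -> Omega (x + s *: ray_dir x) &
    forall s, 0 <= s <= t -> u_phi (x + s *: ray_dir x) = u_phi x + s]].

Definition ray_end x : 'rV[R]_n := x + tau x *: ray_dir x.

Definition J : set 'rV[R]_n := [set ray_end x | x in Omega].

End problem.

(* Main.v *)
Require Import Defs.
From HB Require Import structures.
From mathcomp Require Import all_boot all_order all_algebra.
From mathcomp Require Import all_classical all_reals all_analysis.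
From mathcomp Require Import measurable_realfun.
From mathcomp Require Import ring lra.

Set Implicit Arguments.
Unset Strict Implicit.
Unset Printing Implicit Defensive.

Import Order.TTheory GRing.Theory Num.Theory.
Import numFieldNormedType.Exports.

Local Open Scope classical_set_scope.
Local Open Scope ring_scope.

(** The gauge [rho0] of the polar of [K] is the support function of [K], so that
    [Du] in [K] says that [u] grows at most at the rate [rho0] in every
    direction. Let [u] be a function of [X_phi].

    Along a curve [gamma] of the closure of [Omega] the increment of [u] is at
    most the length of [gamma] ([admissible_curve]). Locally this is the
    mollified form of [<Du, v> <= rho0 v] ([weak_gradient_increment_near]). A
    curve that leaves [Omega] is cut at its first and last contacts with the
    frontier, between which the compatibility of [phi] takes over
    ([admissible_monotone]). This rests on the calculus of absolutely continuous
    curves: a chord is never longer, for [rho0], than its arc ([length_profile]),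
    which comes down to the fundamental theorem of calculus for absolutely
    continuous functions of one variable ([chain_AC_density]).

    Hence [u <= u_phi]. Moreover [u_phi] itself is admissible
    ([u_phi_admissible]): it is locally Lipschitz for [rho0], and a function of
    this kind has a weak gradient with values in [K]
    ([lipschitz_weak_gradient]). For the latter, almost everywhere
    differentiability along lines gives directional derivatives, translation
    invariance of Lebesgue measure turns them into weak derivatives, and the
    inequalities [<Du, v> <= rho0 v] for rational [v] put [Du] in [K] by
    separation.

    As [f] is nonnegative, [u_phi] is a minimiser, and an admissible [u] is
    another one exactly when [f (u_phi - u)] vanishes almost everywhere, that
    is when [u = u_phi] on [spt f] ([solution_iff_contact]). The bound along
    curves propagates this contact condition into [u_f <= u], and constant
    curves give it back ([barriers_characterise]).

    For the last equivalence, suppose first that every ray end inside [Omega]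
    lies in [spt f]. From a point [x], the transport ray is a curve from [x] to
    a point of the frontier or of [spt f] along which [u_phi] grows exactly by
    the length, so [u_f x >= u_phi x] ([contact_of_ray_ends]). Conversely, if
    [u_f = u_phi] and a ray end [q] of [Omega] is not in [spt f], then
    almost optimal curves in the definition of [u_f q] leave a small ball around
    [q], and compactness of its sphere yields a segment starting at [q] along
    which [u_phi] grows at unit speed ([exists_ray_after]). As [K] is of class
    [C^1], [rho0] is strictly convex up to scaling, so this segment prolongs
    straight every ray arriving at [q] ([rays_are_straight]); this contradicts
    the maximality of the ray ([ray_ends_of_contact]). The same sphere argument
    run backwards shows that the infimum defining [u_phi] is attained at a
    visible point of the frontier ([Pi_nonempty]). *)

(** * Absolutely continuous functions of one variable *)

Section interval_chains.
Context {R : realType}.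
Implicit Types (a b : R) (f : R -> R) (s t : seq (R * R)).

(** A chain lists intervals from left to right, each stored as the pair of its
    right end and its left end. Refining a chain is then an operation on lists,
    which disjoint families indexed by [ 'I_m ] would make awkward. *)
Definition interval_chain s :=
  all (fun p => [&& 0 <= p.2, p.2 <= p.1 & p.1 <= 1]) s &&
  pairwise (fun p q => p.1 <= q.2) s.

Definition chain_length s : R := \sum_(p <- s) (p.1 - p.2).

Definition chain_variation f s : R := \sum_(p <- s) `|f p.1 - f p.2|.

Definition chain_AC f := forall eps : R, 0 < eps ->
  exists2 delta : R, 0 < delta & forall s, interval_chain s ->
    chain_length s < delta -> chain_variation f s <= eps.

Lemma chain_length_zip a (s : seq R) :
  chain_length (zip s (a :: s)) = last a s - a.
Proof.
rewrite /chain_length; elim: s a => [|x s IH] a /=.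
  by rewrite big_nil subrr.
by rewrite big_cons IH /=; ring.
Qed.

Lemma zip_chain_all a (s : seq R) : path <%R a s ->
  all (fun p => [&& a <= p.2, p.2 <= p.1 & p.1 <= last a s]) (zip s (a :: s)).
Proof.
elim: s a => [//|x s IH] a /= /andP[ax xs].
have xl : x <= last x s.
  have /itv_partition_le : itv_partition x (last x s) s by split => //.
  exact.
rewrite lexx (ltW ax) xl /=; apply: sub_all (IH x xs) => p /and3P[h1 h2 h3].
by rewrite h2 h3 (le_trans (ltW ax) h1).
Qed.

Lemma zip_chain_pairwise a (s : seq R) : path <%R a s ->
  pairwise (fun p q : R * R => p.1 <= q.2) (zip s (a :: s)).
Proof.
elim: s a => [//|x s IH] a /= /andP[ax xs].
rewrite IH // andbT; apply: sub_all (zip_chain_all xs) => p.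
by move=> /and3P[].
Qed.

Lemma interval_chain_refine s t (p : R * R) (u : seq R) :
  interval_chain (s ++ p :: t) -> itv_partition p.2 p.1 u ->
  interval_chain (s ++ zip u (p.2 :: u) ++ t).
Proof.
rewrite /interval_chain !all_cat !pairwise_cat /= allrel_consr allrel_catr.
move=> /andP[/andP[-> /andP[/and3P[p0 _ p1] ->]]].
move=> /andP[/andP[sp st] /andP[-> /andP[pt ->]]] [up /eqP ul].
have := zip_chain_all up; rewrite ul => H.
rewrite zip_chain_pairwise //= !andbT st andbT.
apply/and3P; split.
- apply: sub_all H => q /and3P[h1 h2 h3].
  by rewrite (le_trans p0 h1) h2 (le_trans h3 p1).
- apply/allrelP => x q xs qu; have /and3P[h1 _ _] := allP H q qu.
  by apply: le_trans h1; move/allP: sp => /(_ _ xs).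
- apply/allrelP => q y qu yt; have /and3P[_ _ h3] := allP H q qu.
  by apply: (le_trans h3); move/allP: pt => /(_ _ yt).
Qed.

Lemma chain_length_cat s t :
  chain_length (s ++ t) = chain_length s + chain_length t.
Proof. by rewrite /chain_length big_cat. Qed.

Lemma chain_variation_cat f s t :
  chain_variation f (s ++ t) = chain_variation f s + chain_variation f t.
Proof. by rewrite /chain_variation big_cat. Qed.

(** Each total variation is a supremum of variations over partitions, and
    replacing an interval of a chain by a partition of it yields a chain of the
    same length. *)
Lemma chain_total_variation f eps delta s t :
  (forall u, interval_chain u -> chain_length u < delta ->
    chain_variation f u <= eps) ->
  interval_chain (s ++ t) -> chain_length (s ++ t) < delta ->
  ((chain_variation f s)%:E + \sum_(p <- t) total_variation p.2 p.1 f
     <= eps%:E)%E.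
Proof.
move=> H; elim: t s => [|p t IH] s st sd.
  by rewrite big_nil adde0 lee_fin; apply: H; rewrite cats0 in st sd.
rewrite big_cons.
have p12 : p.2 <= p.1.
  by move: st; rewrite /interval_chain all_cat /= => /andP[/and3P[_ /and3P[]]].
have tv0 : (0 <= \sum_(p <- t) total_variation p.2 p.1 f)%E.
  rewrite big_seq; apply: sume_ge0 => q qt; apply: total_variation_ge0.
  move: st; rewrite /interval_chain all_cat /= => /andP[/and3P[_ _ /allP]].
  by move=> /(_ q qt) /and3P[].
have key u : itv_partition p.2 p.1 u ->
    ((variation p.2 p.1 f u)%:E <=
      eps%:E - (\sum_(p <- t) total_variation p.2 p.1 f + (chain_variation f s)%:E))%E.
  move=> pu; have := IH (s ++ zip u (p.2 :: u)).
  rewrite -catA => /(_ (interval_chain_refine st pu)).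
  have -> : chain_length (s ++ zip u (p.2 :: u) ++ t) = chain_length (s ++ p :: t).
    rewrite !chain_length_cat chain_length_zip; case: pu => _ /eqP ->.
    by rewrite [chain_length (p :: t)]/chain_length big_cons.
  move=> /(_ sd); rewrite chain_variation_cat EFinD (variation_zip _ pu) -/(chain_variation f _).
  case: (\sum_(_ <- t) _)%E tv0 => [r _| |//].
    by rewrite -!EFinD !lee_fin => ?; lra.
  by move=> _; rewrite /= addeC.
have le1 : (total_variation p.2 p.1 f <=
  eps%:E - (\sum_(p <- t) total_variation p.2 p.1 f + (chain_variation f s)%:E))%E.
  by apply: ge_ereal_sup => _ [_ [u pu <-] <-]; exact: key.
have := total_variation_ge0 f p12; move: le1 tv0.
case: (\sum_(_ <- t) _)%E => [r| |] //; case: (total_variation _ _ _) => [q| |] //.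
by rewrite -!EFinD !lee_fin => ? _ _; lra.
Qed.

(** On an interval shorter than the modulus for [eps = 1] the variation is at
    most one. *)
Lemma chain_AC_subdivision f : chain_AC f ->
  exists N : nat, forall k, (k <= N.+1)%N ->
    (total_variation 0 (k%:R / N.+1%:R) f <= k%:R%:E)%E.
Proof.
move=> /(_ 1 ltr01)[delta d0 H].
have [N Nd] : exists N : nat, N.+1%:R^-1 < delta.
  by exists (Num.truncn delta^-1); rewrite invf_plt ?posrE // truncnS_gt.
exists N; elim=> [|k IH] kN.
  by rewrite mul0r total_variationxx.
have N0 : 0 < N.+1%:R :> R by [].
have k0 : 0 <= k%:R / N.+1%:R :> R by rewrite divr_ge0.
have kk : k%:R / N.+1%:R <= k.+1%:R / N.+1%:R :> R.
  by rewrite ler_pM2r ?invr_gt0 // ler_nat.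
rewrite (total_variationD _ k0 kk) -[X in (_ <= X%:E)%E]natr1 EFinD leeD //.
  by apply: IH; exact: ltnW.
have := @chain_total_variation f 1 delta [::] [:: (k.+1%:R / N.+1%:R, k%:R / N.+1%:R)] H.
rewrite /= big_seq1 /chain_variation big_nil add0e; apply.
  rewrite /interval_chain /= k0 kk /= !andbT ler_pdivrMr // mul1r ler_nat //.
rewrite /chain_length big_seq1 /= -mulrBl -natrB // subSn // subnn mul1r //.
Qed.

Lemma chain_AC_BV f : chain_AC f -> bounded_variation 0 1 f.
Proof.
move=> /chain_AC_subdivision[N /(_ _ (leqnn _))].
rewrite divff ?pnatr_eq0 // => h; apply/bounded_variationP => //.
rewrite ge0_fin_numE ?total_variation_ge0 //.
by apply: le_lt_trans h _; rewrite ltry.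
Qed.

Lemma chain_AC_BV_sub f a b : chain_AC f -> 0 <= a -> a <= b -> b <= 1 ->
  total_variation a b f \is a fin_num.
Proof.
move=> fAC a0 ab b1; apply/bounded_variationP => //.
apply: (bounded_variationl ab b1); apply: bounded_variationr (chain_AC_BV fAC) => //.
exact: le_trans b1.
Qed.

Lemma chain_AC_total_variation f : chain_AC f ->
  chain_AC (fun x => fine (total_variation 0 x f)).
Proof.
move=> fAC eps e0; have [delta d0 H] := fAC _ e0; exists delta => // s cs sd.
have := @chain_total_variation f eps delta [::] s H cs sd.
rewrite /chain_variation big_nil add0e -lee_fin; apply: le_trans.
rewrite -sumEFin big_seq [leRHS]big_seq.
apply: lee_sum => p ps.
have /andP[/allP/(_ p ps)/and3P[p0 p12 p1] _] := cs.
have p1' := le_trans p12 p1.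
have f1 := chain_AC_BV_sub fAC (lexx 0) p0 p1'.
have f2 := chain_AC_BV_sub fAC p0 p12 p1.
rewrite (total_variationD _ p0 p12) fineD // addrAC subrr add0r ger0_norm.
  by rewrite fineK.
by rewrite fine_ge0 // total_variation_ge0.
Qed.

Lemma chain_ACB f g : chain_AC f -> chain_AC g -> chain_AC (f \- g).
Proof.
move=> fAC gAC eps e0.
have e2 : 0 < eps / 2 by rewrite divr_gt0.
have [d1 d10 H1] := fAC _ e2; have [d2 d20 H2] := gAC _ e2.
exists (Num.min d1 d2); first by rewrite lt_min d10.
move=> s cs; rewrite lt_min => /andP[s1 s2].
apply: (@le_trans _ _ (chain_variation f s + chain_variation g s)).
  rewrite /chain_variation -big_split /=; apply: ler_sum => p _.
  rewrite [X in `|X|](_ : _ = (f p.1 - f p.2) - (g p.1 - g p.2)) ?ler_normB //.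
  by ring.
by have := H1 _ cs s1; have := H2 _ cs s2; lra.
Qed.

Lemma chain_AC_near f eps : chain_AC f -> 0 < eps ->
  exists2 delta, 0 < delta & forall a b, 0 <= a -> a <= b -> b <= 1 ->
    b - a < delta -> `|f b - f a| <= eps.
Proof.
move=> fAC e0; have [d d0 H] := fAC _ e0; exists d => // a b a0 ab b1 dab.
have := H [:: (b, a)]; rewrite /chain_length /chain_variation !big_seq1 /=; apply => //.
by rewrite /interval_chain /= a0 ab b1.
Qed.

End interval_chains.

Section monotone_density.
Context {R : realType}.
Variable F : R -> R.
Hypothesis F_AC : chain_AC F.
Hypothesis F_nd : forall a b, 0 <= a -> a <= b -> b <= 1 -> F a <= F b.

Definition clamp01 (t : R) := Num.max 0 (Num.min t 1).

Lemma clamp01_ge0 t : 0 <= clamp01 t.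
Proof. by rewrite /clamp01 le_max lexx. Qed.

Lemma clamp01_le1 t : clamp01 t <= 1.
Proof. by rewrite /clamp01 ge_max ler01 ge_min lexx orbT. Qed.

Lemma clamp01_id t : 0 <= t -> t <= 1 -> clamp01 t = t.
Proof. by move=> t0 t1; rewrite /clamp01 min_l // max_r. Qed.

Lemma clamp01_nd a b : a <= b -> clamp01 a <= clamp01 b.
Proof.
move=> ab; rewrite /clamp01 ge_max le_max lexx /= le_max; apply/orP; right.
by rewrite le_min !ge_min ab lexx !orbT.
Qed.

Lemma clamp01_lip a b : a <= b -> clamp01 b - clamp01 a <= b - a.
Proof.
move=> ab; rewrite /clamp01; case: (ltP b 1) => b1; case: (ltP a 1) => a1.
- by case: (ltP 0 b) => b0; case: (ltP 0 a) => a0; lra.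
- by lra.
- by rewrite (max_r ler01); case: (ltP 0 a) => a0; lra.
- by rewrite subrr subr_ge0.
Qed.

(** [F] is continued by constants so that its Stieltjes measure is defined on
    the whole line. *)
Definition extended (t : R) := F (clamp01 t).

Lemma extended_nd : {homo extended : x y / x <= y}.
Proof.
by move=> x y xy; apply: F_nd; rewrite ?clamp01_ge0 ?clamp01_le1 ?clamp01_nd.
Qed.

Lemma extended_rc : right_continuous extended.
Proof.
move=> x; apply/cvgrPdist_le => e e0.
have [d d0 H] := chain_AC_near F_AC e0.
near=> y.
have xy : x <= y by apply/ltW; near: y; exact: nbhs_right_gt.
rewrite distrC; apply: H; rewrite ?clamp01_ge0 ?clamp01_le1 ?clamp01_nd //.
apply: le_lt_trans (clamp01_lip xy) _; rewrite ltrBlDl.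
by near: y; apply: nbhs_right_lt; rewrite ltrDl.
Unshelve. all: by end_near. Qed.

Let cum : cumulative R R :=
  HB.pack_for (cumulative R R) extended
    (isCumulative.Build R _ R extended extended_nd extended_rc).

Let mu0 := lebesgue_stieltjes_measure cum.

Let mu0E a b : a <= b -> mu0 `]a, b]%classic = (extended b - extended a)%:E.
Proof.
move=> ab; rewrite /mu0 /lebesgue_stieltjes_measure /measure_extension.
by rewrite measurable_mu_extE/= ?wlength_itv_bnd//; exact: is_ocitv.
Qed.

Let m01 : measurable (`]0, 1]%classic : set (measurableTypeR R)).
Proof. exact: measurable_itv. Qed.

Let mu0_fin : (mu0 `]0%R, 1%R]%classic < +oo)%E.
Proof. by rewrite mu0E // ltry. Qed.

Let nu : {finite_measure set (measurableTypeR R) -> \bar R} :=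
  mfrestr m01 mu0_fin.

Let cell m j : set R :=
  `](j%:R / (2 ^ m)%:R), (j.+1%:R / (2 ^ m)%:R)]%classic.

Let cell_in (U : set R) m j := if `[< cell m j `<=` U >] then cell m j else set0.

Let cell_le m j : j%:R / (2 ^ m)%:R <= j.+1%:R / (2 ^ m)%:R :> R.
Proof. by rewrite ler_pM2r ?invr_gt0 // ler_nat. Qed.

Let measurable_cell_in U m j : measurable (cell_in U m j : set (measurableTypeR R)).
Proof. by rewrite /cell_in; case: ifP => // _; exact: measurable_itv. Qed.

Let trivIset_cell_in U m : trivIset setT (cell_in U m).
Proof.
apply: (@sub_trivIset _ _ _ setT) => //.
apply/trivIsetP => i j _ _ ij; rewrite /cell_in.
case: asboolP => _; last by rewrite set0I.
case: asboolP => _; last by rewrite setI0.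
rewrite -subset0 /cell => x [] /=; rewrite !in_itv /= => /andP[h1 h2] /andP[h3 h4].
have := lt_le_trans h1 h4; have := lt_le_trans h3 h2.
rewrite !ltr_pM2r ?invr_gt0 // !ltr_nat !ltnS => h5 h6.
by move: ij; rewrite eqn_leq h5 h6.
Qed.

Let dyadic U m := \big[setU/set0]_(j < 2 ^ m) cell_in U m j.

Let measurable_dyadic U m : measurable (dyadic U m : set (measurableTypeR R)).
Proof. by apply: bigsetU_measurable => i _; exact: measurable_cell_in. Qed.

Let dyadicP U m x : dyadic U m x <->
  exists j, [/\ (j < 2 ^ m)%N, cell m j `<=` U & cell m j x].
Proof.
rewrite /dyadic -bigcup_mkord; split.
  move=> [j /= jm]; rewrite /cell_in; case: asboolP => // h1 h2.
  by exists j.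
move=> [j [jm h1 h2]]; exists j => //; rewrite /cell_in.
by case: asboolP.
Qed.

Let dyadic_nd U : nondecreasing_seq (dyadic U).
Proof.
apply/nondecreasing_seqP => m; apply/subsetPset => x /dyadicP[j [jm jU jx]].
have E k : k.+1%:R / (2 ^ m)%:R = (k.+1).*2%:R / (2 ^ m.+1)%:R :> R.
  by rewrite expnS -muln2 !natrM; field; rewrite pnatr_eq0 expn_eq0.
have E0 k : k%:R / (2 ^ m)%:R = (k).*2%:R / (2 ^ m.+1)%:R :> R.
  by rewrite expnS -muln2 !natrM; field; rewrite pnatr_eq0 expn_eq0.
have s1 : cell m.+1 j.*2 `<=` cell m j.
  move=> y; rewrite /cell /= !in_itv /= E0 E => /andP[-> /=] /le_trans; apply.
  by rewrite ler_pM2r ?invr_gt0 // ler_nat doubleS.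
have s2 : cell m.+1 j.*2.+1 `<=` cell m j.
  move=> y; rewrite /cell /= !in_itv /= E0 E => /andP[+ ->]; rewrite andbT.
  by apply: le_lt_trans; rewrite ler_pM2r ?invr_gt0 // ler_nat.
have [h|h] := leP x (j.*2.+1%:R / (2 ^ m.+1)%:R).
  apply/dyadicP; exists j.*2; split.
  - by rewrite expnS mul2n ltn_double.
  - exact: subset_trans s1 jU.
  - by move: jx; rewrite /cell /= !in_itv /= E0 h andbT => /andP[].
apply/dyadicP; exists j.*2.+1; split.
- by rewrite expnS mul2n ltn_Sdouble.
- exact: subset_trans s2 jU.
- by move: jx; rewrite /cell /= !in_itv /= E h => /andP[].
Qed.

(** An open set is the increasing union of the dyadic cells that it contains;
    measures of open sets thus become limits of sums along chains. *)
Let dyadic_cup U : open U -> \bigcup_m dyadic U m = U `&` `]0, 1]%classic.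
Proof.
move=> oU; apply/seteqP; split => x.
  move=> [m _ /dyadicP[j [jm jU jx]]]; split; first exact: jU.
  move: jx; rewrite /cell /= !in_itv /= => /andP[h1 h2].
  rewrite (le_lt_trans _ h1) ?divr_ge0 //= (le_trans h2) //.
  by rewrite ler_pdivrMr // mul1r ler_nat.
move=> [Ux]; rewrite /= in_itv /= => /andP[x0 x1].
have /nbhs_ballP[e /= e0 eU] : nbhs x U by exact: open_nbhs_nbhs.
have [m me] : exists m, (2 ^ m)%:R^-1 < e.
  exists (Num.truncn e^-1).+1; rewrite invf_plt ?posrE //.
  by apply: lt_trans (truncnS_gt _) _; rewrite ltr_nat ltn_expl.
pose y := x * (2 ^ m)%:R.
have y0 : 0 < y by rewrite mulr_gt0.
have [j /andP[jy yj]] : exists j, j%:R < y <= j.+1%:R.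
  have h0 : exists k, y <= k%:R.
    by exists (Num.truncn y).+1; exact/ltW/truncnS_gt.
  case: (ex_minnP h0) => -[|k] kP kmin; first by move: kP; rewrite leNgt y0.
  exists k; rewrite kP andbT ltNge; apply/negP => /kmin.
  by rewrite ltnn.
have jx : j%:R / (2 ^ m)%:R < x by rewrite ltr_pdivrMr.
have xj : x <= j.+1%:R / (2 ^ m)%:R by rewrite ler_pdivlMr.
exists m => //; apply/dyadicP; exists j; split.
- have : y <= (2 ^ m)%:R by rewrite /y ler_piMl.
  by move=> /(lt_le_trans jy); rewrite ltr_nat.
- move=> z; rewrite /cell /= in_itv /= => /andP[z1 z2]; apply: eU.
  have jj : j.+1%:R / (2 ^ m)%:R = j%:R / (2 ^ m)%:R + (2 ^ m)%:R^-1 :> R.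
    by rewrite -natr1 mulrDl mul1r.
  by rewrite /ball /= ltr_norml; apply/andP; split; lra.
- by rewrite /cell /= in_itv /= jx xj.
Qed.

Let cell_chain (U : set R) m : seq (R * R) :=
  [seq (j.+1%:R / (2 ^ m)%:R, j%:R / (2 ^ m)%:R) |
  j <- iota 0 (2 ^ m) & `[< cell m j `<=` U >]].

Let cell_chainP U m : interval_chain (cell_chain U m).
Proof.
apply/andP; split.
  apply/allP => p /mapP[j]; rewrite mem_filter mem_iota add0n => /and3P[_ _ jm] -> /=.
  by rewrite cell_le divr_ge0 //= ler_pdivrMr // mul1r ler_nat.
rewrite pairwise_map; apply: pairwise_filter.
apply: (@sub_pairwise _ ltn); last first.
  by rewrite -sorted_pairwise ?iota_ltn_sorted //; exact: ltn_trans.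
by move=> i j ij /=; rewrite ler_pM2r ?invr_gt0 // ler_nat.
Qed.

Let dyadic_measure (m0 : {measure set (measurableTypeR R) -> \bar R}) (G : R -> R)
    U m : (forall a b, 0 <= a -> a <= b -> b <= 1 ->
      m0 `]a, b]%classic = (G b - G a)%:E) ->
  m0 (dyadic U m) = (\sum_(p <- cell_chain U m) (G p.1 - G p.2))%:E.
Proof.
move=> m0E; rewrite /dyadic.
rewrite (@measure_bigsetU _ _ _ m0 _ _ (@trivIset_cell_in U m)) => [|i]; last first.
  exact: measurable_cell_in.
rewrite /cell_chain big_map big_filter -sumEFin [RHS]big_mkcond /=.
have -> : iota 0 (2 ^ m) = index_iota 0 (2 ^ m) by rewrite /index_iota subn0.
rewrite big_mkord; apply: eq_bigr => j _.
rewrite /cell_in; case: asboolP => // _.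
rewrite m0E ?divr_ge0 // ler_pdivrMr // mul1r ler_nat; exact: ltn_ord.
Qed.

(** Outer regularity encloses a null set in an open set of small Lebesgue
    measure. The dyadic parts of the latter are chains of small length, on which
    [F] has small variation. *)
Let nu_dominated : nu `<< (lebesgue_measure : {measure set (measurableTypeR R) -> \bar R}).
Proof.
apply/null_content_dominatesP => A mA A0.
apply/eqP; rewrite eq_le measure_ge0 andbT; apply/lee_addgt0Pr => e e0.
rewrite add0e; have [d d0 H] := F_AC e0.
have [U [oU AU UA]] : exists U : set R, [/\ open U, A `<=` U &
    (lebesgue_measure (U `\` A) < d%:E)%E].
  by apply: lebesgue_regularity_outer => //; rewrite [ltLHS]A0 ltry.
have mU : measurable (U : set (measurableTypeR R)) by exact: measurable_realfun.open_measurable.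
have lU : (lebesgue_measure U < d%:E)%E.
  rewrite -(setDUK AU) measureU //; last 2 first.
  - exact: measurableD.
  - by rewrite setDIK.
  by rewrite [X in (X + _)%E](A0) add0e.
have mcup : measurable (\bigcup_m dyadic U m : set (measurableTypeR R)).
  by apply: bigcup_measurable => k _; exact: measurable_dyadic.
apply: (@le_trans _ _ (mu0 (\bigcup_m dyadic U m))).
  rewrite dyadic_cup // /nu /= /mfrestr /mrestr.
  by apply: le_measure; rewrite ?inE; [exact: measurableI|exact: measurableI|exact: setSI].
have cv := @nondecreasing_cvg_mu _ _ _ mu0 (dyadic U)
  (fun m => measurable_dyadic U m) mcup (@dyadic_nd U).
rewrite -[leLHS](cvg_lim _ cv) //; apply: lime_le; first by apply/cvg_ex; eexists; exact: cv.
near=> m => /=.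
have E : mu0 (dyadic U m) = (\sum_(p <- cell_chain U m) (F p.1 - F p.2))%:E.
  apply: (@dyadic_measure mu0) => a b a0 ab b1.
  rewrite [LHS](mu0E ab) /extended !clamp01_id //; first exact: le_trans b1.
  exact: le_trans ab.
rewrite [leLHS]E lee_fin.
have lenlt : chain_length (cell_chain U m) < d.
  rewrite /chain_length -lte_fin -(@dyadic_measure lebesgue_measure idfun) => [|a b _ ab _].
    refine (le_lt_trans _ lU); apply: le_measure.
    - by rewrite inE; exact: (@measurable_dyadic U m).
    - by rewrite inE.
    - by move=> x /dyadicP[j [_ jU jx]]; exact: jU.
  have /= -> := lebesgue_measure_itv (`]a, b] : interval R).
  rewrite lte_fin; case: ltgtP ab => // -> _; by rewrite subrr.
apply: le_trans (H _ (@cell_chainP U m) lenlt).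
by apply: ler_sum => p _; exact: ler_norm.
Unshelve. all: by end_near. Qed.

(** The density is the Radon-Nikodym derivative of the Stieltjes measure, and the
    Lebesgue differentiation theorem makes it the derivative of [F]. *)
Lemma monotone_chain_AC_density : exists g : R -> R,
  [/\ lebesgue_measure.-integrable setT (EFin \o g),
      forall x, 0 <= g x,
      forall a b, 0 <= a -> a <= b -> b <= 1 ->
       (\int[lebesgue_measure]_(x in `]a, b]) (g x)%:E = (F b - F a)%:E)%E &
      {ae lebesgue_measure, forall x : R, 0 < x < 1 ->
        is_derive x 1 F (g x)}].
Proof.
have [f [f0 ff fint fE]] := @radon_nikodym_sigma_finite _ _ _ lebesgue_measure nu nu_dominated.
have fgE : EFin \o (fine \o f) = f by apply/funext => x /=; rewrite fineK.
have gint : lebesgue_measure.-integrable setT (EFin \o (fine \o f)) by rewrite fgE.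
have gE a b : 0 <= a -> a <= b -> b <= 1 ->
    (\int[lebesgue_measure]_(x in `]a, b]) (fine (f x))%:E = (F b - F a)%:E)%E.
  move=> a0 ab b1; under eq_integral do rewrite fineK //.
  rewrite -fE; last exact: measurable_itv.
  rewrite /nu /= /mfrestr /mrestr setIidl; last first.
    move=> x; rewrite /= !in_itv /= => /andP[h1 h2].
    by rewrite (le_lt_trans a0 h1) (le_trans h2 b1).
  rewrite [LHS](mu0E ab) /extended !clamp01_id //; first exact: le_trans b1.
  exact: le_trans ab.
exists (fine \o f); split => //.
  by move=> x /=; rewrite fine_ge0.
have h1 : forall y, lebesgue_measure.-integrable `]-oo, y] (EFin \o (fine \o f)).
  by move=> y; apply: integrableS gint => //; exact: measurable_itv.
have h2 : locally_integrable setT (fine \o f).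
  by apply: open_integrable_locally => //; exact: openT.
have := FTC1Ny h1 h2.
apply: filterS; first exact: (ae_filter_ringOfSetsType lebesgue_measure).
move=> x; set G := fun x => _; move=> [dG GE] /andP[x0 x1].
have GF : \forall y \near x, G y = F y - F 0 + G 0.
  near=> y.
  have y0 : 0 < y by near: y; exact: lt_nbhsr.
  have y1 : y < 1 by near: y; exact: lt_nbhsl.
  have gy : lebesgue_measure.-integrable `]-oo, y] (EFin \o (fine \o f)) by exact: h1.
  rewrite -[LHS](subrK (G 0)); congr (_ + _).
  rewrite [LHS](@Rintegral_itvB _ _ -oo%O (BRight y) 0 gy) ?bnd_simp ?(ltW y0) //.
  by rewrite /Rintegral gE // ltW.
have GF' : {near x, G =1 (fun y => F y - F 0 + G 0)} by exact: GF.
have FG : \forall y \near x, F y = G y + (F 0 - G 0).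
  by apply: filterS GF => y ->; ring.
have dd : is_derive x 1 G (fine (f x)).
  by apply: DeriveDef => //; rewrite -derive1E GE.
have dF : is_derive x 1 F (fine (f x)).
  apply: (@near_eq_is_derive _ _ _ (fun y => G y + (F 0 - G 0))).
    by apply: filterS FG => y ->.
  rewrite -[fine (f x)]addr0; exact: is_deriveD.
exact: dF.
Unshelve. all: by end_near. Qed.

End monotone_density.

Section chain_AC_density.
Context {R : realType}.
Local Notation mu := (@lebesgue_measure R).

(** With [T] the total variation of [f], both [T] and [T - f] are nondecreasing
    and absolutely continuous. *)
Lemma chain_AC_density (f : R -> R) : chain_AC f -> exists g : R -> R,
  [/\ mu.-integrable setT (EFin \o g),
      forall a b, 0 <= a -> a <= b -> b <= 1 ->
        \int[mu]_(x in `]a, b]) g x = f b - f a &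
      {ae mu, forall x : R, 0 < x < 1 -> is_derive x 1 f (g x)}].
Proof.
move=> fAC; pose T x := fine (total_variation 0 x f).
have TAC : chain_AC T by exact: chain_AC_total_variation.
have Tb a b : 0 <= a -> a <= b -> b <= 1 ->
    T b = T a + fine (total_variation a b f).
  move=> a0 ab b1; rewrite /T (total_variationD _ a0 ab) fineD //.
    exact: chain_AC_BV_sub fAC _ _ (le_trans ab b1).
  exact: chain_AC_BV_sub fAC _ _ _.
have Tnd a b : 0 <= a -> a <= b -> b <= 1 -> T a <= T b.
  by move=> a0 ab b1; rewrite (Tb a b) // lerDl fine_ge0 // total_variation_ge0.
have Nnd a b : 0 <= a -> a <= b -> b <= 1 -> (T \- f) a <= (T \- f) b.
  move=> a0 ab b1 /=; rewrite (Tb a b) //.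
  have := total_variation_ge f ab.
  rewrite -[in X in X -> _](fineK (chain_AC_BV_sub fAC a0 ab b1)) lee_fin.
  by have := ler_norm (f b - f a); lra.
have [gT [iT _ ET dT]] := monotone_chain_AC_density TAC Tnd.
have [gN [iN _ EN dN]] := monotone_chain_AC_density (chain_ACB TAC fAC) Nnd.
exists (gT \- gN); split.
- by apply: (integrableB _ iT iN).
- move=> a b a0 ab b1.
  rewrite RintegralB //; last 2 first.
  - by apply: integrableS iT => //; exact: measurable_itv.
  - by apply: integrableS iN => //; exact: measurable_itv.
  by rewrite /Rintegral ET // EN //=; ring.
apply: filterS2 dT dN; first exact: (ae_filter_ringOfSetsType mu).
move=> x hT hN x01.
have -> : f = T \- (T \- f) by apply/funext => y /=; ring.
by have := hT x01; have := hN x01 => ? ?; exact: is_deriveB.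
Qed.

End chain_AC_density.

Section curve_coordinates.
Context {R : realType} {n : nat}.
Implicit Types gamma : R -> 'rV[R]_n.

Lemma norm_coord (v : 'rV[R]_n) i : `|v ord0 i| <= `|v|.
Proof.
rewrite [leRHS]mx_normrE; exact: (le_bigmax _ (fun i => `|v i.1 i.2|) (ord0, i)).
Qed.

Lemma AC_coord gamma i :
  absolutely_continuous01 gamma -> chain_AC (fun t => gamma t ord0 i).
Proof.
move=> gAC e e0; have [d d0 H] := gAC e e0; exists d => // s /andP[sl sp] sd.
pose p0 : R * R := (0, 0).
have := H (size s) (fun k => (nth p0 s k).2) (fun k => (nth p0 s k).1).
have -> : \sum_(k < size s) ((nth p0 s k).1 - (nth p0 s k).2) = chain_length s.
  by rewrite /chain_length (big_nth p0) big_mkord.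
move=> /(_ _ _ sd) h; apply: le_trans (ltW (h _ _)).
- rewrite /chain_variation (big_nth p0) big_mkord; apply: ler_sum => k _.
  by have := norm_coord (gamma (nth p0 s k).1 - gamma (nth p0 s k).2) i; rewrite !mxE.
- by move=> k; have /and3P[] := allP sl _ (mem_nth p0 (ltn_ord k)).
- have key (j k : 'I_(size s)) : (j < k)%N ->
      `](nth p0 s j).2, (nth p0 s j).1[ `&` `](nth p0 s k).2, (nth p0 s k).1[ = set0.
    move=> jk; rewrite -subset0 => x [] /=; rewrite !in_itv /= => /andP[_ h1] /andP[h2 _].
    have /pairwiseP := sp => /(_ p0 j k) /=; rewrite !inE => /(_ (ltn_ord j) (ltn_ord k) jk).
    by move=> h3; have := lt_trans h1 (le_lt_trans h3 h2); rewrite ltxx.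
  apply/trivIsetP => j k _ _ jk; case: (ltngtP j k) => h1.
  + exact: key.
  + by rewrite setIC; exact: key.
  + by move/eqP: jk; case; exact: val_inj.
Qed.

End curve_coordinates.

(** * Lebesgue measure on Euclidean space *)

Section measurability_rV.
Context {R : realType} {n : nat}.

Lemma measurable_fun_rV d (T : measurableType d) (F : T -> 'rV[R]_n) :
  (forall i, measurable_fun setT (fun p => F p ord0 i)) -> measurable_fun setT F.
Proof.
move=> mF; apply: (@measurability _ _ _ _ _ _ (@open 'rV[R]_n)) => //.
move=> _ [A oA <-]; rewrite setTI (open_rV_bigcup oA) preimage_bigcup.
rewrite bigcup_mkcond; apply: countable_bigcupT_measurable => // q.
case: ifPn => _; last exact: measurable0.
rewrite (_ : _ @^-1` _ = \bigcap_(i in [set: 'I_n])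
    ((fun p => F p ord0 i) @^-1` `]ratr (q i).1, ratr (q i).2[%classic)).
  apply: fin_bigcap_measurable => // i _.
  by rewrite -[X in measurable X]setTI; apply: mF => //; exact: measurable_itv.
apply/seteqP; split => x /= H; first by move=> i _ /=; rewrite in_itv; exact: H.
by move=> i; have := H i I; rewrite /= in_itv.
Qed.

Lemma open_measurable_rV (U : set 'rV[R]_n) : open U -> measurable U.
Proof. by move=> oU; exact: sub_sigma_algebra. Qed.

Lemma open_continuous_measurable_rV (U : set 'rV[R]_n) (f : 'rV[R]_n -> R) :
  open U -> (forall x, U x -> {for x, continuous f}) -> measurable_fun U f.
Proof.
move=> oU cf mU; apply: (measurability _ (RGenOpens.measurableE R)) => //.
move=> _ [_ [a [b ->] <-]]; apply: open_measurable_rV.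
have // : open (U `&` f @^-1` `]a, b[ : set 'rV[R]_n).
rewrite openE => x [Ux fx].
have V1 : nbhs x U by exact: open_nbhs_nbhs.
have oI : open (`]a, b[%classic : set R) by exact: interval_open.
have V2 : nbhs x (f @^-1` `]a, b[%classic).
  by apply: (cf _ Ux); exact: open_nbhs_nbhs.
exact: filterI.
Qed.

Lemma continuous_measurable_rV (f : 'rV[R]_n -> R) :
  continuous f -> measurable_fun setT f.
Proof.
move=> cf; apply: (@open_continuous_measurable_rV [set: 'rV[R]_n]).
  exact: (@openT 'rV[R]_n).
by move=> x _; exact: cf.
Qed.

Lemma measurable_coord (i : 'I_n) :
  measurable_fun setT (fun x : 'rV[R]_n => x ord0 i).
Proof. by apply: continuous_measurable_rV; exact: coord_continuous. Qed.

Lemma measurable_shift (a : 'rV[R]_n) : measurable_fun setT (fun x : 'rV[R]_n => x + a).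
Proof.
apply: measurable_fun_rV => i.
have -> : (fun p : 'rV[R]_n => (p + a) ord0 i) = (fun p => p ord0 i) \+ cst (a ord0 i).
  by apply/funext => p; rewrite !mxE.
by apply: measurable_funD => //; exact: measurable_coord.
Qed.

Lemma measurable_line (v : 'rV[R]_n) :
  measurable_fun setT (fun p : measurableTypeR R * 'rV[R]_n => p.2 + p.1 *: v).
Proof.
apply: measurable_fun_rV => i.
have -> : (fun p : measurableTypeR R * 'rV[R]_n => (p.2 + p.1 *: v) ord0 i) =
    (fun p : measurableTypeR R * 'rV[R]_n => p.2 ord0 i) \+
    (fun p : measurableTypeR R * 'rV[R]_n => p.1 * v ord0 i).
  by apply/funext => p; rewrite !mxE.
apply: measurable_funD.
  apply: (@measurableT_comp _ _ _ _ _ _ (fun x : 'rV[R]_n => x ord0 i) _ snd).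
    exact: measurable_coord.
  exact: measurable_snd.
by apply: measurable_funM => //; exact: measurable_fst.
Qed.

End measurability_rV.

Section box_uniqueness.
Context {R : realType} {n : nat}.

Definition boxes : set (set 'rV[R]_n) :=
  [set A | exists a b, A = rV_box a b].

Lemma boxes_setI : setI_closed boxes.
Proof.
move=> _ _ [a [b ->]] [a' [b' ->]].
exists (fun i => Num.max (a i) (a' i)), (fun i => Num.min (b i) (b' i)).
apply/seteqP; split => x /=.
  move=> [H1 H2] i; rewrite gt_max lt_min; have := H1 i; have := H2 i.
  by move=> /andP[h1 h2] /andP[h3 h4]; rewrite h1 h2 h3 h4.
by move=> H; split => i; have := H i; rewrite gt_max lt_min => /andP[/andP[h1 h2] /andP[h3 h4]];
  rewrite ?h1 ?h2 ?h3 ?h4.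
Qed.

Lemma measurable_boxes : measurable = <<s boxes >>.
Proof.
apply/seteqP; split.
  apply: smallest_sub; first exact: smallest_sigma_algebra.
  move=> A oA; rewrite (open_rV_bigcup oA) bigcup_mkcond.
  apply: (@countable_bigcupT_measurable _ (g_sigma_algebraType boxes)) => // q.
  case: ifPn => _; last exact: measurable0.
  by apply: sub_sigma_algebra; eexists; eexists.
apply: smallest_sub; first exact: sigma_algebra_measurable.
by move=> _ [a [b ->]]; exact: measurable_rV_box.
Qed.

Lemma cube_cover :
  \bigcup_k (rV_box (fun=> - k%:R) (fun=> k%:R) : set 'rV[R]_n) = setT.
Proof.
rewrite -subTset => v _.
have [k vk] : exists k, `|v| < k%:R.
  by exists (Num.truncn `|v|).+1; exact: truncnS_gt.
exists k => //= i; rewrite -ltr_norml; apply: le_lt_trans vk.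
rewrite [X in _ <= X]mx_normrE.
exact: (le_bigmax _ (fun i => `|v i.1 i.2|) (ord0, i)).
Qed.

(** Boxes are closed under intersection, generate the Borel sets, and contain the
    cubes that exhaust the space. *)
Lemma box_measure_unique (m1 m2 : {measure set 'rV[R]_n -> \bar R}) :
  (forall a b, m1 (rV_box a b) = m2 (rV_box a b)) ->
  (forall a b, m1 (rV_box a b) < +oo)%E ->
  forall A, measurable A -> m1 A = m2 A.
Proof.
move=> m12 m1oo A mA.
apply: (@measure_unique _ _ _ boxes (fun k => rV_box (fun=> - k%:R) (fun=> k%:R))) => //.
- exact: measurable_boxes.
- exact: boxes_setI.
- by move=> k; eexists; eexists.
- exact: cube_cover.
- by move=> _ [a [b ->]].
Qed.

Lemma rV_box0 (a b : 'I_n -> R) i : ~~ (a i <= b i) -> rV_box a b = set0.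
Proof.
move=> ab; rewrite -subset0 => x /(_ i) /andP[h1 h2]; case/negP: ab.
exact: ltW (lt_trans h1 h2).
Qed.

Lemma lebesgue_rV_box_lty (a b : 'I_n -> R) : (lebesgue_rV (rV_box a b) < +oo)%E.
Proof.
have [ab|/existsNP[i /negP ab]] := pselect (forall i, a i <= b i).
  by rewrite lebesgue_rV_boxE // ltry.
by rewrite (rV_box0 ab) measure0 ltry.
Qed.

Lemma lebesgue_rV_shift (a : 'rV[R]_n) A : measurable A ->
  lebesgue_rV ((fun x => x + a) @^-1` A) = lebesgue_rV A.
Proof.
pose m2 : {measure set 'rV[R]_n -> \bar R} :=
  @measure_function_pushforward__canonical__measure_function_Measure
    _ _ _ _ _ (@lebesgue_rV R n) _ (measurable_shift a).
move=> mA; apply/esym.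
apply: (@box_measure_unique (@lebesgue_rV R n) m2) => // [b c|b c]; last first.
  exact: lebesgue_rV_box_lty.
rewrite /m2 /= /pushforward.
have -> : (fun x => x + a) @^-1` rV_box b c =
    rV_box (fun i => b i - a ord0 i) (fun i => c i - a ord0 i).
  by apply/seteqP; split => x /= H i; have := H i; rewrite !mxE ltrBlDr ltrBrDr.
have [bc|/existsNP[i /negP bc]] := pselect (forall i, b i <= c i).
  rewrite !lebesgue_rV_boxE //; last by move=> i; rewrite lerB.
  by congr (_%:E); apply: eq_bigr => i _; ring.
rewrite (rV_box0 bc) (@rV_box0 _ _ i) // lerD2r.
exact: bc.
Qed.

Lemma integral_shift (a : 'rV[R]_n) (f : 'rV[R]_n -> \bar R) :
  measurable_fun setT f ->
  (\int[lebesgue_rV]_(x in [set: 'rV[R]_n]) f (x + a)%R = \int[lebesgue_rV]_x f x)%E.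
Proof.
move=> mf; rewrite integralE [RHS]integralE.
have key (g : 'rV[R]_n -> \bar R) : measurable_fun setT g -> (forall x, 0 <= g x)%E ->
    (\int[lebesgue_rV]_(x in [set: 'rV[R]_n]) g (x + a)%R = \int[lebesgue_rV]_x g x)%E.
  move=> mg g0.
  have := @ge0_integral_pushforward _ _ _ _ _ _ (measurable_shift a) lebesgue_rV setT g
    measurableT mg (fun x _ => g0 x).
  rewrite preimage_setT => <-.
  apply: eq_measure_integral; first exact: measurable_shift.
  by move=> mphi A mA _; exact: lebesgue_rV_shift.
rewrite -[X in (_ = X - _)%E]key //; last exact: measurable_funepos.
rewrite -[X in (_ = _ - X)%E]key //; last exact: measurable_funeneg.
by congr (_ - _)%E; apply: eq_integral => x _; rewrite ?funeposE ?funenegE.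
Qed.

(** Integrate over the translates of [N] by [t *: v], 0 < t < 1, in both
    orders. *)
Lemma null_on_lines (N : set 'rV[R]_n) (v : 'rV[R]_n) : measurable N ->
  (forall x, lebesgue_measure [set t : R | 0 < t < 1 /\ N (x + t *: v)] = 0%E) ->
  lebesgue_rV N = 0%E.
Proof.
move=> mN H.
pose A : set (measurableTypeR R * 'rV[R]_n) :=
  (`]0, 1[%classic `*` setT) `&` (fun p => p.2 + p.1 *: v) @^-1` N.
have mA : measurable A.
  apply: measurableI.
    by apply: measurableX => //; exact: measurable_itv.
  by rewrite -[X in measurable X]setTI; exact: measurable_line.
have := @indic_fubini_tonelli _ _ _ _ _ lebesgue_measure (@lebesgue_rV R n) A mA.
rewrite indic_fubini_tonelli_FE // indic_fubini_tonelli_GE //.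
rewrite [RHS]integral0_eq => [|x _]; last first.
  rewrite /= -[RHS](H x); congr lebesgue_measure; apply/seteqP; split => t /=.
    by move=> /ysectionP; rewrite /A /= in_itv /= => -[[]].
  by move=> [t01 Nt]; apply/ysectionP; rewrite /A /= in_itv /=.
pose I01 : set (measurableTypeR R) := `]0%R, 1%R[%classic.
have mI : measurable I01 by exact: measurable_itv.
move=> E; rewrite -E (eq_integral (fun t => lebesgue_rV N * (\1_I01 t)%:E)%E).
  rewrite ge0_integralZl //; last first.
    by apply/measurable_EFinP; exact: measurable_indic.
  rewrite integral_indic ?setIT // /I01.
  have /= -> := lebesgue_measure_itv (`]0%R, 1%R[ : interval R).
  by rewrite lte_fin ltr01 -EFinB subr0 mule1.
move=> t _; rewrite indicE /=; have [t01|t01] := boolP (t \in I01).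
  rewrite mule1 -(lebesgue_rV_shift (t *: v) mN).
  congr (lebesgue_rV _); apply/seteqP; split => x /=.
    by move=> /xsectionP; rewrite /A /= => -[].
  by move=> Nx; apply/xsectionP; rewrite /A /=; split => //; split => //; rewrite inE in t01.
rewrite mule0; have <- : lebesgue_rV (set0 : set 'rV[R]_n) = 0%E by exact: measure0.
congr (lebesgue_rV _); rewrite -subset0 => x /xsectionP; rewrite /A /= => -[[h _] _].
by case/negP: t01; rewrite inE.
Qed.

End box_uniqueness.

(** * Smooth bump functions *)

Section smooth_bump_1d.
Context {R : realType}.
Implicit Types (P Q : {poly R}).

(** [flat 1] is the standard smooth function vanishing exactly on the negative
    half-line; polynomials in [1 / t] are what differentiation produces. *)
Definition flat P (t : R) : R :=
  if 0 < t then P.[t^-1] * expR (- t^-1) else 0.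

Definition flat_derive P : {poly R} := 'X^2 * (P - P^`()).

Lemma flat_le0 P t : t <= 0 -> flat P t = 0.
Proof. by rewrite /flat ltNge => ->. Qed.

Lemma flat_gt0E P t : 0 < t -> flat P t = P.[t^-1] * expR (- t^-1).
Proof. by rewrite /flat => ->. Qed.

Lemma pow_expN_le (s : R) i : 0 <= s -> s ^+ i * expR (- s) <= i`!%:R.
Proof.
move=> s0; rewrite expRN ler_pdivrMr ?expR_gt0 //.
case: i => [|i]; first by rewrite fact0 expr0 mul1r; have := expR_ge1Dx s; lra.
have := expR_ge1Dxn i s0; rewrite -ler_pdivrMl ?ltr0n ?fact_gt0 //.
by rewrite mulrC; lra.
Qed.

Lemma flat_bounded P : exists2 C : R, 0 < C & forall t, `|flat P t| <= C.
Proof.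
exists (\sum_(i < size P) `|P`_i| * i`!%:R + 1).
  by rewrite ltr_wpDl // sumr_ge0 // => i _; rewrite mulr_ge0.
move=> t; rewrite /flat; case: ifPn => t0; last first.
  rewrite normr0 addr_ge0 // sumr_ge0 // => i _; rewrite mulr_ge0 //.
rewrite horner_coef mulr_suml; apply: (le_trans (ler_norm_sum _ _ _)).
rewrite ler_wpDr // ler_sum // => i _.
rewrite -mulrA normrM ler_wpM2l // ger0_norm; last first.
  by rewrite mulr_ge0 ?expR_ge0 // exprn_ge0 // invr_ge0 ltW.
by apply: pow_expN_le; rewrite invr_ge0 ltW.
Qed.

Lemma is_derive_flat P (t : R) : is_derive t (1:R) (flat P) (flat (flat_derive P) t).
Proof.
have [t0|t0|->] := ltgtP t 0.
- rewrite flat_le0 ?(ltW t0) //.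
  apply: (@near_eq_is_derive _ _ _ (cst (0 : R))).
  by near=> y; rewrite flat_le0 //; apply: ltW; near: y; exact: lt_nbhsl.
- apply: (@near_eq_is_derive _ _ _ (fun y : R => P.[y^-1] * expR (- y^-1))).
    by near=> y; rewrite flat_gt0E //; near: y; exact: lt_nbhsr.
  have t1 : t != 0 by rewrite gt_eqF.
  have dI : is_derive t (1:R) (fun y : R => y^-1) (- t ^- 2).
    by have := @is_deriveV _ id t 1 1 t1 _; rewrite scaler1; apply; exact: is_derive_id.
  have d1 : is_derive t (1:R) (fun y : R => P.[y^-1]) ((P^`()).[t^-1] * (- t ^- 2)).
    by apply: (@is_derive1_comp _ (horner P) (fun y : R => y^-1)).
  have d2 : is_derive t (1:R) (fun y : R => expR (- y^-1)) (t ^- 2 * expR (- t^-1)).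
    rewrite mulrC -[t ^- 2]opprK.
    apply: (@is_derive1_comp _ expR (fun y : R => - y^-1)).
  have -> : flat (flat_derive P) t = P.[t^-1] *: (t ^- 2 * expR (- t^-1)) +
      expR (- t^-1) *: ((P^`()).[t^-1] * (- t ^- 2)).
    rewrite flat_gt0E // /flat_derive !hornerE /= /GRing.scale /= exprVn; ring.
  exact: (@is_deriveM _ _ (fun y : R => P.[y^-1]) (fun y : R => expR (- y^-1)) t 1 _ _ d1 d2).
- rewrite flat_le0 //.
  have [C C0 HC] := flat_bounded ('X^2 * P).
  have bnd h : `|flat P h| <= C * h ^+ 2.
    have [h0|h0] := leP h 0.
      by rewrite flat_le0 // normr0 mulr_ge0 ?sqr_ge0 // ltW.
    have := HC h; rewrite !flat_gt0E // hornerM hornerXn exprVn -mulrA.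
    rewrite normrM ger0_norm ?invr_ge0 ?sqr_ge0 // ler_pdivrMl ?exprn_gt0 //.
    by move=> /le_trans; apply; rewrite mulrC.
  have cv : (h^-1 *: (flat P (h *: 1 + 0) - flat P 0) : R) @[h --> 0^'] --> (0 : R).
    apply/cvgrPdist_le => e e0; near=> h.
    rewrite sub0r normrN (flat_le0 _ (lexx 0)) subr0 addr0 /GRing.scale /= mulr1.
    have h0 : h != 0 by near: h; exact: nbhs_dnbhs_neq.
    rewrite normrM normfV ler_pdivrMl ?normr_gt0 //.
    apply: (le_trans (bnd h)).
    rewrite -real_normK ?num_real // expr2 mulrA mulrC ler_wpM2l // -ler_pdivlMl //.
    near: h; apply: dnbhs0_le; rewrite mulr_gt0 // invr_gt0 //.
  apply: DeriveDef; first by apply/cvg_ex; eexists; exact: cv.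
  by apply/cvg_lim => //; exact: cv.
Unshelve. all: by end_near. Qed.

End smooth_bump_1d.

Section derivative_on_lines.
Context {R : realType} {n : nat}.

Lemma is_derive_line (f : 'rV[R]_n -> R) (x v : 'rV[R]_n) (d : R) :
  is_derive (0 : R) (1 : R) (fun h : R => f (x + h *: v)) d <->
  is_derive x v f d.
Proof.
have E : (fun h : R => h^-1 *: (((fun h : R => f (x + h *: v)) \o shift 0) (h *: (1:R)) -
    f (x + (0:R) *: v))) = (fun h => h^-1 *: ((f \o shift x) (h *: v) - f x)).
  by apply/funext => h /=; rewrite scale0r !addr0 [h *: 1]mulr1 [x + _]addrC.
split=> -[h1 h2]; split; rewrite /derivable /derive.
- by move: h1; rewrite /derivable E.
- by move: h2; rewrite /derive E.
- by move: h1; rewrite /derivable -E.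
- by move: h2; rewrite /derive -E.
Qed.

Lemma is_derive_line_at (f : 'rV[R]_n -> R) (x v : 'rV[R]_n) (t d : R) :
  is_derive (x + t *: v) v f d ->
  is_derive t (1 : R) (fun h : R => f (x + h *: v)) d.
Proof.
move=> /is_derive_line [h1 h2].
have E : (fun h : R => h^-1 *: (((fun h : R => f (x + t *: v + h *: v)) \o shift 0) (h *: (1:R)) -
    f (x + t *: v + (0:R) *: v))) =
   (fun h : R => h^-1 *: (((fun h : R => f (x + h *: v)) \o shift t) (h *: (1:R)) - f (x + t *: v))).
  apply/funext => h /=; rewrite scale0r !addr0; congr (_ *: (f _ - _)).
  by rewrite -addrA -scalerDl [t + _]addrC.
split; rewrite /derivable /derive.
- by move: h1; rewrite /derivable E.
- by move: h2; rewrite /derive E.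
Qed.

End derivative_on_lines.

Section smooth_bump.
Context {R : realType} {n : nat}.
Variables (m : R) (a b : 'I_n -> R).
Implicit Types (l : seq ({poly R} * {poly R})).

(** Sums of products of flat functions form a class that is stable under
    derivation, which makes smoothness a plain induction. *)
Definition bump1 l (c d t : R) : R :=
  \sum_(p <- l) flat p.1 (m * (t - c)) * flat p.2 (m * (d - t)).

Definition bump1_derive l :=
  flatten [seq [:: (m *: flat_derive p.1, p.2); (p.1, - m *: flat_derive p.2)] | p <- l].

Lemma flatZ (c : R) P t : flat (c *: P) t = c * flat P t.
Proof. by rewrite /flat; case: ifP => _; rewrite ?mulr0 // hornerZ mulrA. Qed.

Lemma is_derive_bump1 l c d t :
  is_derive t (1 : R) (bump1 l c d) (bump1 (bump1_derive l) c d t).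
Proof.
elim: l => [|p l IH].
  have -> : bump1 [::] c d = cst 0 by apply/funext => s; rewrite /bump1 big_nil.
  exact: is_derive_cst.
have -> : bump1 (p :: l) c d =
    (fun t => flat p.1 (m * (t - c)) * flat p.2 (m * (d - t))) + bump1 l c d.
  by apply/funext => s; rewrite /bump1 big_cons.
have -> : bump1 (bump1_derive (p :: l)) c d t =
   (flat p.1 (m * (t - c)) *: (- m * flat (flat_derive p.2) (m * (d - t))) +
    flat p.2 (m * (d - t)) *: (m * flat (flat_derive p.1) (m * (t - c)))) +
   bump1 (bump1_derive l) c d t.
  rewrite /bump1 /bump1_derive /= !big_cons /= !flatZ /GRing.scale /=; ring.
apply: is_deriveD.
have d1 : is_derive t (1:R) (fun t : R => flat p.1 (m * (t - c)))
    (m * flat (flat_derive p.1) (m * (t - c))).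
  have h : is_derive t (1:R) (fun t : R => m * (t - c)) m.
    have -> : (fun t : R => m * (t - c)) = m *: (id + cst (- c)) by apply/funext.
    by apply: is_derive_eq; rewrite subr0 [m *: 1]mulr1.
  rewrite mulrC; apply: (@is_derive1_comp _ (flat p.1) _ t _ _ (is_derive_flat _ _) h).
have d2 : is_derive t (1:R) (fun t : R => flat p.2 (m * (d - t)))
    (- m * flat (flat_derive p.2) (m * (d - t))).
  have h : is_derive t (1:R) (fun t : R => m * (d - t)) (- m).
    have -> : (fun t : R => m * (d - t)) = m *: (cst d - id) by apply/funext.
    by apply: is_derive_eq; rewrite sub0r [m *: _]mulrN1.
  rewrite mulrC; apply: (@is_derive1_comp _ (flat p.2) _ t _ _ (is_derive_flat _ _) h).
exact: (@is_deriveM _ _ _ _ t 1 _ _ d1 d2).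
Qed.

Definition gbump (L : 'I_n -> seq ({poly R} * {poly R})) (x : 'rV[R]_n) : R :=
  \prod_i bump1 (L i) (a i) (b i) (x ord0 i).

Lemma is_derive_gbump L x j : is_derive x (delta_mx ord0 j) (gbump L)
  (gbump (fun i => if i == j then bump1_derive (L i) else L i) x).
Proof.
apply/is_derive_line.
pose C := \prod_(i | i != j) bump1 (L i) (a i) (b i) (x ord0 i).
have -> : (fun h : R => gbump L (x + h *: delta_mx ord0 j)) =
    C *: (fun h : R => bump1 (L j) (a j) (b j) (h + x ord0 j)).
  apply/funext => h; rewrite /gbump (bigD1 j) //= mulrC !mxE !eqxx mulr1 addrC.
  congr (_ * _); apply: eq_bigr => i ij; rewrite !mxE /= (negbTE ij) mulr0 addr0 //.
have -> : gbump (fun i => if i == j then bump1_derive (L i) else L i) x =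
    C *: bump1 (bump1_derive (L j)) (a j) (b j) (0 + x ord0 j).
  rewrite /gbump (bigD1 j) //= eqxx add0r mulrC; congr (_ * _).
  by apply: eq_bigr => i ij; rewrite (negbTE ij).
apply: is_deriveZ.
have h : is_derive (0:R) (1:R) (fun h : R => h + x ord0 j) 1.
  have -> : (fun h : R => h + x ord0 j) = id + cst (x ord0 j) by apply/funext.
  by apply: is_derive_eq; rewrite addr0.
rewrite -[X in is_derive _ _ _ X]mulr1.
exact: (@is_derive1_comp _ (bump1 (L j) (a j) (b j)) _ 0 _ _ (is_derive_bump1 _ _ _ _) h).
Qed.

Lemma continuous_bump1 l c d : continuous (bump1 l c d).
Proof.
move=> t; apply/differentiable_continuous/derivable1_diffP.
by have [] := is_derive_bump1 l c d t.
Qed.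

Lemma continuous_gbump L : continuous (gbump L).
Proof.
move=> x; rewrite /gbump.
have key (r : seq 'I_n) :
    {for x, continuous (fun x : 'rV[R]_n => \prod_(i <- r) bump1 (L i) (a i) (b i) (x ord0 i))}.
  elim: r => [|i r IH].
    have -> : (fun x : 'rV[R]_n => \prod_(i <- [::]) bump1 (L i) (a i) (b i) (x ord0 i)) = cst 1.
      by apply/funext => y; rewrite big_nil.
    exact: cst_continuous.
  have -> : (fun x : 'rV[R]_n => \prod_(i <- i :: r) bump1 (L i) (a i) (b i) (x ord0 i)) =
     (fun x => bump1 (L i) (a i) (b i) (x ord0 i) *
               \prod_(i <- r) bump1 (L i) (a i) (b i) (x ord0 i)).
    by apply/funext => y; rewrite big_cons.
  apply: continuousM IH.
  apply: (@continuous_comp _ _ _ (fun y : 'rV[R]_n => y ord0 i)).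
    exact: coord_continuous.
  exact: continuous_bump1.
exact: key.
Qed.

Lemma Ck_gbump k L : Ck_on k setT (gbump L).
Proof.
elim: k L => [|k IH] L.
  by split=> // x _; exact: continuous_gbump.
split=> [x _|i]; first exact: continuous_gbump.
split=> [x _|]; first by have [] := is_derive_gbump L x i.
have -> : partial i (gbump L) = gbump (fun j => if j == i then bump1_derive (L j) else L j).
  by apply/funext => x; have [_] := is_derive_gbump L x i.
exact: IH.
Qed.

Definition bump : 'rV[R]_n -> R := gbump (fun=> [:: (1, 1)]).

Lemma bumpE x : bump x =
  \prod_i (flat 1 (m * (x ord0 i - a i)) * flat 1 (m * (b i - x ord0 i))).
Proof. by apply: eq_bigr => i _; rewrite /bump1 big_seq1. Qed.

Lemma flat1_ge0 (t : R) : 0 <= flat 1 t.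
Proof. by rewrite /flat; case: ifP => // _; rewrite -polyC1 hornerC mul1r expR_ge0. Qed.

Lemma flat1_gt0 (t : R) : 0 < t -> 0 < flat 1 t.
Proof. by move=> t0; rewrite flat_gt0E // -polyC1 hornerC mul1r expR_gt0. Qed.

Lemma flat1_le1 (t : R) : flat 1 t <= 1.
Proof.
rewrite /flat; case: ifP => // t0; rewrite -polyC1 hornerC mul1r expR_le1 oppr_le0.
by rewrite invr_ge0 ltW.
Qed.

Lemma bump_ge0 x : 0 <= bump x.
Proof. by rewrite bumpE prodr_ge0 // => i _; rewrite mulr_ge0 ?flat1_ge0. Qed.

Lemma bump_le1 x : bump x <= 1.
Proof.
rewrite bumpE; apply: prodr_ile1 => i _; rewrite mulr_ge0 ?flat1_ge0 //=.
by rewrite mulr_ile1 ?flat1_ge0 ?flat1_le1.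
Qed.

Hypothesis m0 : 0 < m.

Lemma bump_out x : ~ rV_box a b x -> bump x = 0.
Proof.
move=> /existsNP[i /negP xi]; rewrite bumpE (bigD1 i) //=.
move: xi; rewrite negb_and -!leNgt => /orP[h|h].
  by rewrite (@flat_le0 _ _ (m * (x ord0 i - a i))) ?mul0r // pmulr_rle0 // subr_le0.
by rewrite (@flat_le0 _ _ (m * (b i - x ord0 i))) ?mulr0 ?mul0r // pmulr_rle0 // subr_le0.
Qed.

Lemma bump_gt0 x : rV_box a b x -> 0 < bump x.
Proof.
move=> xab; rewrite bumpE; apply: prodr_gt0 => i _; have /andP[h1 h2] := xab i.
by rewrite mulr_gt0 // flat1_gt0 // mulr_gt0 // subr_gt0.
Qed.

Definition cbox : set 'rV[R]_n := [set x | forall i, a i <= x ord0 i <= b i].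

Lemma compact_cbox : compact cbox.
Proof.
have := @rV_compact R n (fun i => `[a i, b i]%classic) (fun i => @segment_compact _ _ _).
congr (compact _); apply/seteqP; split => x /= H i; have := H i; by rewrite in_itv.
Qed.

Lemma rV_box_cbox : rV_box a b `<=` cbox.
Proof. by move=> x xab i; have /andP[/ltW-> /ltW->] := xab i. Qed.

Lemma closed_cbox : closed cbox.
Proof. by apply: compact_closed; [exact: norm_hausdorff|exact: compact_cbox]. Qed.

Lemma bump_supp : closure [set x | bump x != 0] `<=` cbox.
Proof.
rewrite (_ : cbox = closure cbox); last by apply/closure_id; exact: closed_cbox.
apply: closure_subset => x /= /eqP x0; apply: rV_box_cbox.
by apply: contrapT => /bump_out.
Qed.

Lemma test_function_bump (Omega : set 'rV[R]_n) :
  cbox `<=` Omega -> test_function Omega bump.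
Proof.
move=> cO; split; first by move=> k; exact: Ck_gbump.
  apply: subclosed_compact compact_cbox _; first exact: closed_closure.
  exact: bump_supp.
by apply: subset_trans cO; exact: bump_supp.
Qed.

End smooth_bump.

Section bump_limit.
Context {R : realType} {n : nat}.

Lemma cvg_flat1 (t : R) : 0 < t -> flat 1 (k.+1%:R * t) @[k --> \oo] --> (1 : R).
Proof.
move=> t0.
have -> : (fun k => flat 1 (k.+1%:R * t)) = (fun k => expR (- (t^-1 * k.+1%:R^-1))).
  by apply/funext => k; rewrite flat_gt0E ?mulr_gt0 // -polyC1 hornerC mul1r invfM mulrC.
have E : (1:R) = expR (- (t^-1 * 0)) by rewrite mulr0 oppr0 expR0.
rewrite [X in _ --> X]E; apply: continuous_cvg; first exact: continuous_expR.
apply: cvgN; apply: cvgM; first exact: cvg_cst.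
exact: cvg_harmonic.
Qed.

Lemma cvg_bump (a b : 'I_n -> R) x :
  bump k.+1%:R a b x @[k --> \oo] --> (\1_(rV_box a b) x : R).
Proof.
rewrite indicE; have [xab|xab] := boolP (x \in rV_box a b); last first.
  have -> : (fun k => bump k.+1%:R a b x) = cst 0.
    apply/funext => k; apply: bump_out => //; move=> h; case/negP: xab.
    by rewrite inE.
  exact: cvg_cst.
rewrite inE in xab; under eq_fun do rewrite bumpE.
pose G (r : seq 'I_n) (k : nat) : R := \prod_(i <- r)
  (flat 1 (k.+1%:R * (x ord0 i - a i)) * flat 1 (k.+1%:R * (b i - x ord0 i))).
have key r : G r @ \oo --> (1 : R).
  elim: r => [|i r IH].
    have -> : G [::] = cst 1 by apply/funext => k; rewrite /G big_nil.
    exact: cvg_cst.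
  have /andP[h1 h2] := xab i; rewrite -subr_gt0 in h1; rewrite -subr_gt0 in h2.
  have -> : G (i :: r) = (fun k => flat 1 (k.+1%:R * (x ord0 i - a i)) *
      flat 1 (k.+1%:R * (b i - x ord0 i)) * G r k).
    by apply/funext => k; rewrite /G big_cons.
  have := cvgM (cvgM (cvg_flat1 h1) (cvg_flat1 h2)) IH; rewrite !mulr1; exact.
exact: key.
Unshelve. all: by end_near. Qed.

End bump_limit.

(** * Directional derivatives of functions of class C^1 *)

Section C1_directional.
Context {R : realType} {n : nat}.

(** The mean value theorem on the segment between 0 and [T], whatever the sign of
    [T]. *)
Lemma mvt_from0 (F F' : R -> R) (T : R) :
  (forall t, `|t| <= `|T| -> is_derive t (1 : R) F (F' t)) ->
  exists2 c, `|c| <= `|T| & F T - F 0 = F' c * T.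
Proof.
move=> dF.
have cF (A : set R) : (forall t, A t -> `|t| <= `|T|) -> {within A, continuous F}.
  move=> HA; apply: continuous_in_subspaceT => t; rewrite inE => /HA /dF[].
  by move=> /derivable1_diffP /differentiable_continuous.
case: (leP 0 T) => T0.
  have [t| |c] := @MVT_segment R F F' 0 T T0.
  - rewrite in_itv /= => /andP[h1 h2]; apply: dF; rewrite !ger0_norm ?(ltW h1) ?(ltW h2) //.
  - by apply: (cF `[0, T]%classic) => t; rewrite /= in_itv /= => /andP[h1 h2]; rewrite !ger0_norm.
  rewrite in_itv /= => /andP[h1 h2]; rewrite subr0 => E.
  by exists c => //; rewrite !ger0_norm.
have [t| |c] := @MVT_segment R F F' T 0 (ltW T0).
- rewrite in_itv /= => /andP[h1 h2]; apply: dF; rewrite !ler0_norm ?lerN2 ?(ltW h1) ?(ltW h2) ?(ltW T0) //.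
- apply: (cF `[T, 0]%classic) => t; rewrite /= in_itv /= => /andP[h1 h2].
  by rewrite !ler0_norm ?lerN2 // ltW.
rewrite in_itv /= => /andP[h1 h2] E; exists c.
  by rewrite !ler0_norm ?lerN2 // ltW.
by rewrite -opprB E; ring.
Qed.

(** Moving along one coordinate at a time reduces the difference quotient to
    the partial derivatives at nearby points. *)
Lemma C1_difference_quotient (U : set 'rV[R]_n) (psi : 'rV[R]_n -> R)
    (x : 'rV[R]_n) (c : 'I_n -> R) (s : seq 'I_n) :
  open U -> Ck_on 1 U psi -> U x ->
  h^-1 * (psi (x + h *: \sum_(i <- s) c i *: delta_mx ord0 i) - psi x)
    @[h --> (0 : R)^'] --> \sum_(i <- s) c i * partial i psi x.
Proof.
move=> oU [cpsi dpsi] Ux; elim: s => [|i s IH].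
  under eq_fun do rewrite big_nil scaler0 addr0 subrr mulr0.
  by rewrite big_nil; exact: cvg_cst.
rewrite !big_cons.
pose w := \sum_(j <- s) c j *: (delta_mx ord0 j : 'rV[R]_n).
pose e : 'rV[R]_n := delta_mx ord0 i.
rewrite (_ : (fun h => _) =
   (fun h : R => h^-1 * (psi (x + h *: w + (h * c i) *: e) - psi (x + h *: w))) \+
   (fun h : R => h^-1 * (psi (x + h *: w) - psi x))); last first.
  apply/funext => h /=; rewrite -mulrDr addrA subrK scalerDr scalerA.
  by rewrite -/e -/w [_ + h *: w]addrC addrA.
apply: cvgD; last exact: IH.
have [dpi [cpi _]] := dpsi i.
apply/cvgrPdist_le => eps eps0.
have eps1 : 0 < eps / (`|c i| + 1) by rewrite divr_gt0 // ltr_wpDl.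
have : \forall y \near x, U y /\ `|partial i psi x - partial i psi y| < eps / (`|c i| + 1).
  near=> y; split; near: y; first exact: open_nbhs_nbhs.
  by have /cvgrPdist_lt := cpi _ Ux; apply.
move=> /nbhs_ballP[d /= d0 Hd].
pose B := `|w| + `|c i| * `|e| + 1.
have B0 : 0 < B by rewrite ltr_wpDl // addr_ge0 // mulr_ge0.
near=> h.
have h0 : h != 0 by near: h; exact: nbhs_dnbhs_neq.
have hB : `|h| * B < d.
  rewrite -ltr_pdivlMr //; near: h; apply: dnbhs0_lt; exact: divr_gt0.
have inb t : `|t| <= `|h * c i| -> ball x d (x + h *: w + t *: e).
  move=> th; rewrite -ball_normE /ball_ /= -addrA opprD addrA subrr sub0r normrN.
  apply: le_lt_trans hB; apply: (le_trans (ler_normD _ _)).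
  rewrite !normrZ /B !mulrDr mulr1 -addrA lerD // mulrA -normrM.
  by rewrite ler_wpDr // ler_wpM2r.
have dG t : `|t| <= `|h * c i| ->
    is_derive t (1 : R) (fun t : R => psi (x + h *: w + t *: e))
      (partial i psi (x + h *: w + t *: e)).
  move=> th; apply: is_derive_line_at; have [Ut _] := Hd _ (inb _ th).
  by split => //; exact: dpi.
have [t th E] := mvt_from0 dG.
rewrite scale0r addr0 in E; rewrite E.
have -> : c i * partial i psi x - h^-1 * (partial i psi (x + h *: w + t *: e) * (h * c i)) =
   c i * (partial i psi x - partial i psi (x + h *: w + t *: e)) by field.
have [_ /ltW Ht] := Hd _ (inb _ th).
rewrite normrM; apply: (le_trans (ler_wpM2l (normr_ge0 _) Ht)).
rewrite mulrCA ger_pMr // ler_pdivrMr ?ltr_wpDl // mul1r lerDl //.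
Unshelve. all: by end_near. Qed.

Lemma C1_is_derive (U : set 'rV[R]_n) (psi : 'rV[R]_n -> R) (x v : 'rV[R]_n) :
  open U -> Ck_on 1 U psi -> U x ->
  is_derive x v psi (\sum_i v ord0 i * partial i psi x).
Proof.
move=> oU Cpsi Ux.
have := @C1_difference_quotient U psi x (fun i => v ord0 i) (index_enum 'I_n) oU Cpsi Ux.
rewrite -row_sum_delta => cv.
have cv' : h^-1 *: ((psi \o shift x) (h *: v) - psi x) @[h --> (0 : R)^'] -->
    \sum_i v ord0 i * partial i psi x.
  rewrite (_ : (fun h : R => h^-1 *: ((psi \o shift x) (h *: v) - psi x)) =
    (fun h : R => h^-1 * (psi (x + h *: v) - psi x))) //.
  by apply/funext => h; rewrite /= [_ + x]addrC.
apply: DeriveDef; first by apply/cvg_ex; eexists; exact: cv'.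
by apply/cvg_lim => //; exact: cv'.
Qed.

End C1_directional.

(** * The gauge of the polar set *)

Section dotmul_theory.
Context {R : realType} {n : nat}.
Implicit Types (x y z p : 'rV[R]_n).

Lemma dotmulC x y : dotmul x y = dotmul y x.
Proof. by apply: eq_bigr => i _; rewrite mulrC. Qed.

Lemma dotmulDl x y z : dotmul (x + y) z = dotmul x z + dotmul y z.
Proof. by rewrite -big_split; apply: eq_bigr => i _ /=; rewrite mxE mulrDl. Qed.

Lemma dotmulDr x y z : dotmul x (y + z) = dotmul x y + dotmul x z.
Proof. by rewrite !(dotmulC x) dotmulDl. Qed.

Lemma dotmulZl (c : R) x y : dotmul (c *: x) y = c * dotmul x y.
Proof. by rewrite /dotmul mulr_sumr; apply: eq_bigr => i _; rewrite mxE mulrA. Qed.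

Lemma dotmulZr (c : R) x y : dotmul x (c *: y) = c * dotmul x y.
Proof. by rewrite !(dotmulC x) dotmulZl. Qed.

Lemma dotmulNl x y : dotmul (- x) y = - dotmul x y.
Proof. by rewrite -scaleN1r dotmulZl mulN1r. Qed.

Lemma dotmulNr x y : dotmul x (- y) = - dotmul x y.
Proof. by rewrite !(dotmulC x) dotmulNl. Qed.

Lemma dotmulBl x y z : dotmul (x - y) z = dotmul x z - dotmul y z.
Proof. by rewrite dotmulDl dotmulNl. Qed.

Lemma dotmulBr x y z : dotmul x (y - z) = dotmul x y - dotmul x z.
Proof. by rewrite dotmulDr dotmulNr. Qed.

Lemma dotmul0l x : dotmul 0 x = 0.
Proof. by rewrite -(scale0r x) dotmulZl mul0r. Qed.

Lemma dotmul0r x : dotmul x 0 = 0.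
Proof. by rewrite dotmulC dotmul0l. Qed.

Lemma dotmul_sqrD x y (t : R) : dotmul (x + t *: y) (x + t *: y) =
  dotmul x x + 2 * t * dotmul x y + t ^+ 2 * dotmul y y.
Proof.
by rewrite dotmulDl !dotmulDr !dotmulZl !dotmulZr (dotmulC y x); ring.
Qed.

Lemma dotmul_ge0 x : 0 <= dotmul x x.
Proof. by apply: sumr_ge0 => i _; rewrite -expr2 sqr_ge0. Qed.

Lemma dotmul_eq0 x : dotmul x x = 0 -> x = 0.
Proof.
move=> x0; apply/rowP => i; rewrite mxE; apply/eqP; rewrite -sqrf_eq0 expr2.
have := @psumr_eq0P R 'I_n xpredT (fun i => x ord0 i * x ord0 i).
by move=> /(_ _ x0) -> // j _; rewrite -expr2 sqr_ge0.
Qed.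

Lemma dotmul_gt0 x : x != 0 -> 0 < dotmul x x.
Proof.
move=> x0; rewrite lt_neqAle dotmul_ge0 andbT eq_sym.
by apply: contra_neq x0; exact: dotmul_eq0.
Qed.

Lemma norm_rV_le (x : 'rV[R]_n) (c : R) : 0 <= c ->
  (forall i, `|x ord0 i| <= c) -> `|x| <= c.
Proof.
move=> c0 xc; rewrite [leLHS]mx_normrE; apply: bigmax_le => // -[i j] _ /=.
by rewrite (ord1 i).
Qed.

Lemma dotmul_le x y : `|dotmul x y| <= n%:R * (`|x| * `|y|).
Proof.
apply: (le_trans (ler_norm_sum _ _ _)).
rewrite mulr_natl -[X in _ <= _ *+ X](card_ord n) -sumr_const; apply: ler_sum => i _.
by rewrite normrM ler_pM // norm_coord.
Qed.

Lemma near_norm_le x (e : R) : 0 < e -> \forall y \near x, `|x - y| <= e.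
Proof.
move=> e0; apply/nbhs_ballP; exists e => //= y.
by rewrite -ball_normE => /ltW.
Qed.

Lemma continuous_dotmul p : continuous (dotmul p).
Proof.
move=> x; apply/(@cvgrPdist_le _ _ _ _ (nbhs_filter x)) => e e0; near=> y.
rewrite -dotmulBr; apply: (le_trans (dotmul_le _ _)).
have c0 : 0 < n%:R * `|p| + 1 by rewrite ltr_wpDl // mulr_ge0.
apply: (@le_trans _ _ ((n%:R * `|p| + 1) * `|x - y|)).
  by rewrite mulrA ler_wpM2r // lerDl.
rewrite -ler_pdivlMl //; near: y.
by apply: near_norm_le; rewrite mulr_gt0 // invr_gt0.
Unshelve. all: by end_near. Qed.

Lemma continuous_sqdist p : continuous (fun x => dotmul (x - p) (x - p)).
Proof.
move=> x; rewrite /dotmul.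
have key (r : seq 'I_n) : {for x, continuous (fun x : 'rV[R]_n =>
    \sum_(i <- r) (x - p) ord0 i * (x - p) ord0 i)}.
  elim: r => [|i r IH].
    have -> : (fun x : 'rV[R]_n => \sum_(i <- [::]) (x - p) ord0 i * (x - p) ord0 i) = cst 0.
      by apply/funext => y; rewrite big_nil.
    exact: cst_continuous.
  have -> : (fun x : 'rV[R]_n => \sum_(i <- i :: r) (x - p) ord0 i * (x - p) ord0 i) =
     (fun x => (x - p) ord0 i * (x - p) ord0 i +
       \sum_(i <- r) (x - p) ord0 i * (x - p) ord0 i).
    by apply/funext => y; rewrite big_cons.
  apply: continuousD IH.
  have c1 : {for x, continuous (fun x : 'rV[R]_n => (x - p) ord0 i)}.
    apply: (@continuous_comp _ _ _ (fun y : 'rV[R]_n => y - p) (fun y : 'rV[R]_n => y ord0 i)).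
      by apply: continuousB; [exact: cvg_id|exact: cst_continuous].
    exact: coord_continuous.
  exact: (continuousM c1 c1).
exact: key.
Qed.

End dotmul_theory.

Section support_function.
Context {R : realType} {n : nat}.
Variable K : set 'rV[R]_n.
Hypothesis K_compact : compact K.
Hypothesis K_convex : convex_set (K : set (convex_lmodType 'rV[R]_n)).
Hypothesis K_int0 : interior K 0.

Local Notation rho0 := (gauge (polar K)).
Implicit Types (x y z p k : 'rV[R]_n).

Lemma K0 : K 0.
Proof. exact: nbhs_singleton. Qed.

Lemma convexK x y (t : R) : 0 <= t -> t <= 1 -> K x -> K y ->
  K (t *: x + (1 - t) *: y).
Proof.
move=> t0 t1 Kx Ky.
by have := @K_convex x y (Itv01 t0 t1); rewrite !inE => /(_ Kx Ky).
Qed.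

Lemma K_ball : exists2 r : R, 0 < r & forall x, `|x| < r -> K x.
Proof.
have /nbhs_ballP[r /= r0 rK] := K_int0; exists r => // x xr; apply: rK.
by rewrite -ball_normE /ball_ /= sub0r normrN.
Qed.

Lemma K_scaled x : exists2 t : R, 0 < t & K (t *: x).
Proof.
have [r r0 rK] := K_ball; have x1 : 0 < `|x| + 1 by rewrite ltr_wpDl.
have e0 : 0 < r / (`|x| + 1) by rewrite divr_gt0.
exists (r / (`|x| + 1)) => //; apply: rK.
by rewrite normrZ gtr0_norm // mulrAC ltr_pdivrMr // ltr_pM2l // ltrDl.
Qed.

Lemma support_attained z : exists2 p, K p & forall k, K k -> dotmul k z <= dotmul p z.
Proof.
have cz : continuous (fun k => dotmul k z).
  rewrite (_ : (fun k => _) = dotmul z); first exact: continuous_dotmul.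
  by apply/funext => x; exact: dotmulC.
have [p] := @compact_EVT_max _ R (fun k => dotmul k z) K (ex_intro _ 0 K0) K_compact
  (continuous_subspaceT cz).
rewrite inE => Kp pmax; exists p => // k Kk.
by apply: pmax; rewrite inE.
Qed.

(** The vector [z] lies in [t] times the polar set when [<k, z> <= t] for all [k]
    of [K], so the gauge of the polar set is the support function of [K]. *)
Lemma rho0_max z : exists p, [/\ K p, rho0 z = dotmul p z &
  forall k, K k -> dotmul k z <= rho0 z].
Proof.
have [p Kp pmax] := support_attained z.
have p0 : 0 <= dotmul p z by have := pmax _ K0; rewrite dotmul0l.
suff E : rho0 z = dotmul p z by exists p; rewrite E.
rewrite /gauge; set S := [set t | _].
have lbS : lbound S (dotmul p z).
  move=> t [t0 [k Kk ->]]; rewrite dotmulZr dotmulC.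
  by have := Kk _ Kp => kp; rewrite -[leRHS]mulr1 ler_wpM2l.
have Sp : S (dotmul p z).
  split => //; have [z0|zN0] := eqVneq z 0.
    exists 0; first by move=> x _; rewrite dotmul0l.
    by rewrite z0 scaler0.
  have pz0 : 0 < dotmul p z.
    have [t t0 /pmax] := K_scaled z.
    by apply: lt_le_trans; rewrite dotmulZl mulr_gt0 // dotmul_gt0.
  exists ((dotmul p z)^-1 *: z); last by rewrite scalerA divff ?gt_eqF // scale1r.
  move=> x Kx; rewrite dotmulZl (dotmulC z) ler_pdivrMl // mulr1; exact: pmax.
apply/eqP; rewrite eq_le; apply/andP; split.
  by apply: ge_inf => //; exists (dotmul p z).
by apply: lb_le_inf => //; exists (dotmul p z).
Qed.

Lemma dotmul_le_rho0 k z : K k -> dotmul k z <= rho0 z.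
Proof. by have [p [_ _]] := rho0_max z; apply. Qed.

Lemma rho0_ge0 z : 0 <= rho0 z.
Proof. by have := dotmul_le_rho0 z K0; rewrite dotmul0l. Qed.

Lemma rho0_0 : rho0 0 = 0.
Proof. by have [p [_ -> _]] := rho0_max 0; rewrite dotmul0r. Qed.

Lemma rho0D x y : rho0 (x + y) <= rho0 x + rho0 y.
Proof.
by have [p [Kp -> _]] := rho0_max (x + y); rewrite dotmulDr lerD ?dotmul_le_rho0.
Qed.

Lemma rho0Z (t : R) x : 0 <= t -> rho0 (t *: x) = t * rho0 x.
Proof.
move=> t0; apply/eqP; rewrite eq_le; apply/andP; split.
  have [p [Kp -> _]] := rho0_max (t *: x).
  by rewrite dotmulZr ler_wpM2l // dotmul_le_rho0.
have [p [Kp -> _]] := rho0_max x.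
by rewrite -dotmulZr dotmul_le_rho0.
Qed.

Lemma rho0_gt0 x : x != 0 -> 0 < rho0 x.
Proof.
move=> x0; have [t t0 /(dotmul_le_rho0 x)] := K_scaled x.
by apply: lt_le_trans; rewrite dotmulZl mulr_gt0 // dotmul_gt0.
Qed.

Lemma rho0_le_norm : exists2 C : R, 0 < C & forall x, rho0 x <= C * `|x|.
Proof.
have [M [_ HM]] := compact_bounded K_compact.
pose B := `|M| + 1.
have MB : M < B by rewrite /B ltr_pwDr // ler_norm.
exists (n%:R * B + 1).
  by rewrite ltr_wpDl // mulr_ge0 // addr_ge0.
move=> x; have [p [Kp -> _]] := rho0_max x.
apply: (le_trans (ler_norm _)); apply: (le_trans (dotmul_le _ _)).
rewrite mulrA ler_wpM2r // (@le_trans _ _ (n%:R * B)) ?lerDl //.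
by rewrite ler_wpM2l //; exact: (HM _ MB).
Qed.

Lemma rho0_lip : exists2 C : R, 0 < C & forall x y, `|rho0 x - rho0 y| <= C * `|x - y|.
Proof.
have [C C0 HC] := rho0_le_norm; exists C => // x y.
have h1 : rho0 x <= rho0 y + C * `|x - y|.
  rewrite -{1}(subrK y x) addrC; apply: (le_trans (rho0D _ _)).
  by rewrite lerD2l.
have h2 : rho0 y <= rho0 x + C * `|x - y|.
  rewrite -{1}(subrK x y) addrC distrC; apply: (le_trans (rho0D _ _)).
  by rewrite lerD2l.
by rewrite ler_norml; apply/andP; split; lra.
Qed.

Lemma continuous_rho0 : continuous rho0.
Proof.
have [C C0 HC] := rho0_lip; move=> x; apply/(@cvgrPdist_le _ _ _ _ (nbhs_filter x)) => e e0; near=> y.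
apply: (le_trans (HC _ _)); rewrite -ler_pdivlMl //; near: y.
by apply: near_norm_le; rewrite mulr_gt0 // invr_gt0.
Unshelve. all: by end_near. Qed.

(** If [p] is the point of [K] closest to [g], then [g - p] is an outer normal
    to [K] at [p]. *)
Lemma support_separation g : (forall v, dotmul g v <= rho0 v) -> K g.
Proof.
move=> Hg.
have [p] := @compact_EVT_min _ R (fun k => dotmul (k - g) (k - g)) K
  (ex_intro _ 0 K0) K_compact (continuous_subspaceT (@continuous_sqdist R n g)).
rewrite inE => Kp pmin.
have nrm k : K k -> 0 <= dotmul (p - g) (k - p).
  move=> Kk; apply/ler_addgt0Pr => e e0.
  pose B := dotmul (k - p) (k - p) + 1.
  have B0 : 0 < B by rewrite ltr_wpDl // dotmul_ge0.
  pose t := Num.min 1 (e / B).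
  have t0 : 0 < t by rewrite lt_min ltr01 divr_gt0.
  have t1 : t <= 1 by rewrite ge_min lexx.
  have tB : t * B <= e by rewrite -ler_pdivlMr // ge_min lexx orbT.
  have := pmin _ (mem_set (convexK (ltW t0) t1 Kk Kp)).
  have -> : t *: k + (1 - t) *: p - g = (p - g) + t *: (k - p).
    by rewrite scalerBl scalerBr scale1r; apply/rowP => i; rewrite !mxE; ring.
  rewrite dotmul_sqrD => h.
  have : 0 <= t * (2 * dotmul (p - g) (k - p) + t * dotmul (k - p) (k - p)) by lra.
  rewrite pmulr_rge0 //.
  have : t * dotmul (k - p) (k - p) <= e by apply: le_trans tB; rewrite ler_wpM2l ?(ltW t0) // lerDl.
  lra.
have hv : rho0 (g - p) <= dotmul p (g - p).
  have [k [Kk -> _]] := rho0_max (g - p).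
  have := nrm _ Kk; rewrite -opprB dotmulNl dotmulBr !(dotmulC (g - p)); lra.
have g0 : g - p = 0.
  apply: dotmul_eq0; apply/eqP; rewrite eq_le dotmul_ge0 andbT dotmulBl.
  have := Hg (g - p); lra.
by move/eqP: g0; rewrite subr_eq0 => /eqP ->.
Qed.

Hypothesis K_C1 : class_C1 K.

(** At a boundary point, [K] contains small steps in every direction that
    decreases the defining function, so every outer normal is a positive
    multiple of its gradient. *)
Lemma normal_unique p a0 : K p -> a0 != 0 -> rho0 a0 = dotmul p a0 ->
  exists w, forall a, a != 0 -> rho0 a = dotmul p a -> exists2 l : R, 0 < l & a = l *: w.
Proof.
move=> Kp a00 pa0.
have pF : frontier K p.
  split; first exact: subset_closure.
  move=> /nbhs_ballP[r /= r0 rK].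
  have x1 : 0 < `|a0| + 1 by rewrite ltr_wpDl.
  have e0 : 0 < r / (`|a0| + 1) by rewrite divr_gt0.
  have /(dotmul_le_rho0 a0) : K (p + (r / (`|a0| + 1)) *: a0).
    apply: rK; rewrite -ball_normE /ball_ /= opprD addrA subrr sub0r normrN.
    rewrite normrZ gtr0_norm // mulrAC ltr_pdivrMr // ltr_pM2l //.
    by rewrite ltrDl.
  by rewrite pa0 dotmulDl dotmulZl gerDl leNgt mulr_gt0 // dotmul_gt0.
have [U [psi [[oU Up] Cpsi psiN0 KU]]] := K_C1 pF.
pose w : 'rV[R]_n := \row_i partial i psi p.
have w0 : w != 0.
  have [i pi0] := psiN0 _ Up; apply: contra_neq pi0 => w0.
  by have := congr1 (fun v : 'rV[R]_n => v ord0 i) w0; rewrite !mxE.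
have psip : psi p <= 0.
  have : (K `&` U) p by [].
  by rewrite KU => -[].
have inK v : dotmul w v < 0 -> exists2 t : R, 0 < t & K (p + t *: v).
  move=> wv; have := @C1_is_derive _ _ U psi p v oU Cpsi Up.
  have -> : \sum_i v ord0 i * partial i psi p = dotmul w v.
    by apply: eq_bigr => i _; rewrite mulrC mxE.
  move=> /is_derive_line [/cvg_ex[l cl] dl].
  have el : l = dotmul w v by rewrite -dl /derive; apply/esym/cvg_lim.
  rewrite el in cl.
  have Uv : \forall h \near (0 : R)^', U (p + h *: v).
    have : nbhs p U by exact: open_nbhs_nbhs.
    move=> /nbhs_ballP[r /= r0 rU].
    have x1 : 0 < `|v| + 1 by rewrite ltr_wpDl.
    near=> h; apply: rU; rewrite -ball_normE /ball_ /= opprD addrA subrr sub0r normrN.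
    rewrite normrZ (@le_lt_trans _ _ (`|h| * (`|v| + 1))) // ?ler_wpM2l ?lerDl //.
    rewrite -ltr_pdivlMr //; near: h; apply: dnbhs0_lt; exact: divr_gt0.
  have FI : \forall h \near (0 : R)^', U (p + h *: v) /\
     h^-1 *: (((fun h : R => psi (p + h *: v)) \o shift 0) (h *: (1:R)) - psi (p + (0 : R) *: v)) < 0.
    near=> h; split; near: h; first exact: Uv.
    exact: cvgr_lt cl _ wv.
  have [d /= d0 Hd] := (@nbhs_ballP _ R (0 : R) _).1 FI.
  have d2 : 0 < d / 2 by rewrite divr_gt0.
  have [] := Hd (d / 2); rewrite /ball /= ?gt_eqF //.
    by rewrite sub0r normrN gtr0_norm // ltr_pdivrMr // ltr_pMr // ltr1n.
  move=> Ut tl; exists (d / 2) => //.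
  have : (K `&` U) (p + (d / 2) *: v); last by case.
  rewrite KU; split => //=.
  move: tl; rewrite /= scale0r !addr0 [_ *: (1:R)]mulr1 pmulr_rlt0 ?invr_gt0 // subr_lt0.
  by move=> /ltW /le_trans; apply.
exists w => a aN0 pa.
have neg v : dotmul w v < 0 -> dotmul v a <= 0.
  move=> /inK[t t0 /(dotmul_le_rho0 a)].
  by rewrite pa dotmulDl dotmulZl gerDl pmulr_rle0.
have ww : 0 < dotmul w w by exact: dotmul_gt0.
have npos v : dotmul w v <= 0 -> dotmul v a <= 0.
  move=> wv; apply/ler_addgt0Pr => e e0; rewrite add0r.
  pose B := `|dotmul w a| + 1.
  have B0 : 0 < B by rewrite ltr_wpDl.
  have eB : 0 < e / B by rewrite divr_gt0.
  have : dotmul (v - (e / B) *: w) a <= 0.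
    apply: neg; rewrite dotmulBr dotmulZr subr_lt0; apply: (le_lt_trans wv).
    by rewrite mulr_gt0.
  rewrite dotmulBl dotmulZl subr_le0 => /le_trans; apply.
  rewrite mulrAC ler_pdivrMr // ler_wpM2l ?(ltW e0) //.
  by apply: (le_trans (ler_norm _)); rewrite /B lerDl.
pose l := dotmul a w / dotmul w w.
have aE : a = l *: w.
  apply/eqP; rewrite -subr_eq0; apply/eqP; apply: dotmul_eq0.
  have o : dotmul w (a - l *: w) = 0.
    by rewrite dotmulBr dotmulZr /l (dotmulC w a) divfK ?gt_eqF // subrr.
  apply/eqP; rewrite eq_le dotmul_ge0 andbT.
  by rewrite dotmulBr dotmulZr (dotmulC _ w) o mulr0 subr0; apply: npos; rewrite o.
exists l => //; rewrite lt_neqAle; apply/andP; split.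
  by apply: contra_neq aN0 => l0; rewrite aE -l0 scale0r.
rewrite divr_ge0 ?(ltW ww) // dotmulC.
have := neg (- w); rewrite dotmulNr oppr_lt0 dotmulNl oppr_le0; exact.
Unshelve. all: by end_near. Qed.

(** A vector [p] of [K] that supports [a + b] supports both [a] and [b]. They are
    thus two normals of [K] at [p], and the boundary of class [C^1] has only one. *)
Lemma rho0_strict a b : a != 0 -> b != 0 -> rho0 (a + b) = rho0 a + rho0 b ->
  (rho0 a)^-1 *: a = (rho0 b)^-1 *: b.
Proof.
move=> a0 b0 E; have [p [Kp pab _]] := rho0_max (a + b).
have pa : rho0 a = dotmul p a.
  apply/eqP; rewrite eq_le dotmul_le_rho0 // andbT.
  have := dotmul_le_rho0 b Kp; rewrite dotmulDr in pab; lra.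
have pb : rho0 b = dotmul p b.
  apply/eqP; rewrite eq_le dotmul_le_rho0 // andbT.
  have := dotmul_le_rho0 a Kp; rewrite dotmulDr in pab; lra.
have [w Hw] := normal_unique Kp a0 pa.
have [l l0 aE] := Hw a a0 pa; have [m m0 bE] := Hw b b0 pb.
rewrite aE bE !rho0Z ?(ltW l0) ?(ltW m0) // !invfM !scalerA.
by rewrite mulrAC mulVf ?gt_eqF // mul1r mulrAC mulVf ?gt_eqF // mul1r.
Qed.

End support_function.

(** * Absolutely continuous curves and their length *)

Section nonmeasurable_integrand.
Context d (T : measurableType d) (R : realType).
Variable mu : {measure set T -> \bar R}.
Import HBNNSimple.

(** The integral is a supremum over simple functions, so altering a nonnegative
    integrand on a null set is harmless even if measurability is lost. *)
Lemma ge0_integral_ae_eq (D N : set T) (F H : T -> \bar R) :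
  measurable D -> measurable N -> mu N = 0%E -> measurable_fun D H ->
  (forall x, D x -> 0 <= F x)%E -> (forall x, D x -> 0 <= H x)%E ->
  (forall x, D x -> ~ N x -> F x = H x) ->
  (\int[mu]_(x in D) F x = \int[mu]_(x in D) H x)%E.
Proof.
move=> mD mN N0 mH F0 H0 FH; apply/eqP; rewrite eq_le; apply/andP; split.
  rewrite ge0_integralE //; apply: ge_ereal_sup => _ [h /= hF <-].
  rewrite -integralT_nnsfun [leRHS]integral_mkcond; apply: ae_ge0_le_integral => //.
  - by move=> x _; rewrite lee_fin.
  - by apply/measurable_EFinP; exact: measurable_funP.
  - by move=> x _; rewrite patchE; case: ifPn => // xD; apply: H0; rewrite inE in xD.
  - exact/(measurable_restrictT _ mD).1.
  exists N; split => // x /= nx; apply: contrapT => Nx; apply: nx => _.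
  apply: (le_trans (hF x)); rewrite !patchE; case: ifPn => // xD.
  by rewrite FH //; rewrite inE in xD.
rewrite (ge0_negligible_integral mN) // integral_mkcond ge0_integralTE; last first.
  by move=> x; rewrite patchE; case: ifPn => // xD; apply: H0; rewrite inE in xD; case: xD.
apply: ge_ereal_sup => _ [h /= hH <-]; rewrite ge0_integralE //.
apply: ereal_sup_ubound; exists h => //= x.
apply: (le_trans (hH x)); rewrite !patchE; case: ifPn => xDN; last first.
  by case: ifPn => // xD; apply: F0; rewrite inE in xD.
rewrite inE in xDN; case: xDN => xD xN.
by rewrite mem_set // FH.
Qed.

End nonmeasurable_integrand.

Section doubling.
Context {R : realType}.
Local Notation mu := (@lebesgue_measure R).

Let dbl (x : measurableTypeR R) : measurableTypeR R := 2 * (x : R).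

Let mdbl : measurable_fun setT dbl.
Proof. by apply: measurable_funM => //; exact: measurable_cst. Qed.

Let m2 : {measure set (measurableTypeR R) -> \bar R} :=
  mscale (2%:R%:nng : {nonneg R})
    (@measure_function_pushforward__canonical__measure_function_Measure
      _ _ _ _ _ mu _ mdbl).

Let m2E A : measurable A -> mu A = m2 A.
Proof.
apply: lebesgue_measure_unique => X [[a b] _ <-] /=.
rewrite /m2 /= /mscale /= /pushforward.
have -> : dbl @^-1` `]a, b]%classic = `]a / 2, b / 2]%classic.
  by apply/seteqP; split => x /=; rewrite !in_itv /= /dbl ltr_pdivrMr // ler_pdivlMr // mulrC.
rewrite /mscale /=.
have /= -> := lebesgue_measure_itv (`]a, b] : interval R).
have /= -> := lebesgue_measure_itv (`](a / 2), (b / 2)] : interval R).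
rewrite !lte_fin ltr_pM2r ?invr_gt0 //; case: ifP => _; last by rewrite mule0.
by rewrite -!EFinD -EFinM; congr EFin; field.
Qed.

Lemma null_half (N : set R) : measurable (N : set (measurableTypeR R)) ->
  mu N = 0%E -> mu [set x | N (2 * x)] = 0%E.
Proof.
move=> mN; rewrite m2E // /m2 /= /mscale /= => /eqP.
by rewrite mule_eq0 /= eqe pnatr_eq0 /= => /eqP.
Qed.

Lemma measurable_half (N : set R) : measurable (N : set (measurableTypeR R)) ->
  measurable ([set x | N (2 * x)] : set (measurableTypeR R)).
Proof. by move=> mN; rewrite -[X in measurable X]setTI; exact: mdbl. Qed.

Lemma integral_half (h : R -> \bar R) : measurable_fun setT h ->
  (forall x, 0 <= h x)%E ->
  (\int[mu]_(x in `[0%R, 1%R]) h x = 2%:E * \int[mu]_(x in `[0%R, 2^-1%R]) h (2 * x)%R)%E.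
Proof.
move=> mh h0.
have mI : measurable (`[0%R, 1%R]%classic : set (measurableTypeR R)) by exact: measurable_itv.
transitivity (\int[m2]_(x in `[0%R, 1%R]) h x)%E.
  by apply: eq_measure_integral => A mA _; exact: m2E.
rewrite /m2 ge0_integral_mscale //; last exact: measurable_funTS.
congr (_ * _)%E.
rewrite ge0_integral_pushforward //; last exact: measurable_funTS.
congr integral; apply/seteqP; split => x /=; rewrite !in_itv /= /dbl => /andP[h1 h2].
  by rewrite -ler_pdivlMl // mulr1 in h2; rewrite h2 andbT; lra.
by apply/andP; split; lra.
Qed.

End doubling.

Section Rintegral_lincomb.
Context d (T : measurableType d) (R : realType).
Variable mu : {measure set T -> \bar R}.

Lemma Rintegral_lincomb n (D : set T) (c : 'I_n -> R) (f : 'I_n -> T -> R) :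
  measurable D -> (forall i, mu.-integrable D (EFin \o f i)) ->
  mu.-integrable D (fun x => (\sum_i c i * f i x)%:E) /\
  \int[mu]_(x in D) (\sum_i c i * f i x) = \sum_i c i * \int[mu]_(x in D) f i x.
Proof.
move=> mD fi; elim: (index_enum _) => [|i s [IH1 IH2]].
  split; first by under eq_fun do rewrite big_nil; exact: integrable0.
  under eq_Rintegral do rewrite big_nil.
  by rewrite big_nil /Rintegral integral0.
have cf : mu.-integrable D (EFin \o (fun x => c i * f i x)).
  by have := integrableZl mD (c i) (fi i); apply: eq_integrable.
split.
  under eq_fun do rewrite big_cons EFinD.
  exact: (integrableD mD cf IH1).
under eq_Rintegral do rewrite big_cons.
by rewrite (RintegralD mD cf IH1) RintegralZl // IH2 big_cons.
Qed.

End Rintegral_lincomb.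

Section AC_curves.
Context {R : realType} {n : nat}.
Implicit Types (gamma : R -> 'rV[R]_n).

Lemma AC_lipschitz gamma (M : R) :
  (forall a b, 0 <= a -> a <= b -> b <= 1 -> `|gamma b - gamma a| <= M * (b - a)) ->
  absolutely_continuous01 gamma.
Proof.
move=> H e e0; pose B := `|M| + 1.
have B0 : 0 < B by rewrite ltr_wpDl.
exists (e / B); first exact: divr_gt0.
move=> m a b ab _ sd; apply: (@le_lt_trans _ _ (\sum_(i < m) B * (b i - a i))).
  apply: ler_sum => i _; have [a0 abi b1] := ab i.
  apply: (le_trans (H _ _ a0 abi b1)); rewrite ler_wpM2r ?subr_ge0 //.
  by rewrite (le_trans (ler_norm _)) // lerDl.
by rewrite -mulr_sumr mulrC -ltr_pdivlMr.
Qed.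

Lemma ACD gamma1 gamma2 : absolutely_continuous01 gamma1 ->
  absolutely_continuous01 gamma2 -> absolutely_continuous01 (gamma1 \+ gamma2).
Proof.
move=> H1 H2 e e0; have e2 : 0 < e / 2 by rewrite divr_gt0.
have [d1 d10 h1] := H1 _ e2; have [d2 d20 h2] := H2 _ e2.
exists (Num.min d1 d2); first by rewrite lt_min d10.
move=> m a b ab tab; rewrite lt_min => /andP[s1 s2].
apply: (@le_lt_trans _ _ (\sum_(i < m) (`|gamma1 (b i) - gamma1 (a i)| +
   `|gamma2 (b i) - gamma2 (a i)|))).
  apply: ler_sum => i _ /=; apply: le_trans (ler_normD _ _).
  by rewrite opprD addrACA.
rewrite big_split /= [ltRHS]splitr.
by apply: ltrD; [exact: h1|exact: h2].
Qed.

(** The map [e] selects preimages under the change of time [c]; it shows that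
    [c] keeps disjoint intervals disjoint. *)
Lemma AC_comp gamma (c e : R -> R) (M : R) :
  absolutely_continuous01 gamma -> 0 < M ->
  (forall a b, 0 <= a -> a <= b -> b <= 1 ->
    [/\ 0 <= c a, c a <= c b, c b <= 1 & c b - c a <= M * (b - a)]) ->
  (forall a b y, 0 <= a -> a <= b -> b <= 1 -> c a < y < c b -> a < e y < b) ->
  absolutely_continuous01 (gamma \o c).
Proof.
move=> H M0 Hc He eps eps0; have [d d0 h] := H _ eps0.
exists (d / M); first exact: divr_gt0.
move=> m a b ab tab sd; apply: h.
- by move=> i; have [a0 abi b1] := ab i; have [] := Hc _ _ a0 abi b1.
- apply/trivIsetP => i j _ _ ij; rewrite -subset0 => y [] /=.
  rewrite !in_itv /= => yi yj.
  have [a0 abi b1] := ab i; have [a0' abi' b1'] := ab j.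
  move/trivIsetP : tab => /(_ i j I I ij); rewrite -subset0 => /(_ (e y)); apply.
  split; rewrite /= in_itv /=; first exact: (He (a i) (b i) y).
  exact: (He (a j) (b j) y).
- apply: (@le_lt_trans _ _ (M * \sum_(i < m) (b i - a i))).
    rewrite mulr_sumr; apply: ler_sum => i _.
    by have [a0 abi b1] := ab i; have [] := Hc _ _ a0 abi b1.
  by rewrite mulrC -ltr_pdivlMr.
Qed.

Definition clamp (s t r : R) := Num.max s (Num.min r t).

Lemma clamp_id (s t r : R) : s <= r -> r <= t -> clamp s t r = r.
Proof. by move=> sr rt; rewrite /clamp (min_l rt) max_r. Qed.

Lemma clamp_lo (s t r : R) : r <= s -> s <= t -> clamp s t r = s.
Proof. by move=> rs st; rewrite /clamp min_l ?(le_trans rs) // max_l. Qed.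

Lemma clamp_hi (s t r : R) : s <= t -> t <= r -> clamp s t r = t.
Proof. by move=> st tr; rewrite /clamp min_r // max_r. Qed.

Lemma clampP (s t a b : R) : 0 <= s -> s <= t -> t <= 1 -> a <= b ->
  [/\ s <= clamp s t a, clamp s t a <= clamp s t b, clamp s t b <= t,
      clamp s t b - clamp s t a <= 1 * (b - a) &
      forall y, clamp s t a < y < clamp s t b -> a < y < b].
Proof.
move=> s0 st t1 ab; rewrite mul1r.
case: (leP a s) => as_.
  rewrite (clamp_lo as_ st); case: (leP b s) => bs.
    rewrite (clamp_lo bs st); split; [lra|lra|lra|lra|].
    by move=> y /andP[h1 h2]; apply/andP; split; lra.
  case: (leP b t) => bt.
    rewrite (clamp_id (ltW bs) bt); split; [lra|lra|lra|lra|].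
    by move=> y /andP[h1 h2]; apply/andP; split; lra.
  rewrite (clamp_hi st (ltW bt)); split; [lra|lra|lra|lra|].
  by move=> y /andP[h1 h2]; apply/andP; split; lra.
case: (leP a t) => at_.
  rewrite (clamp_id (ltW as_) at_); case: (leP b t) => bt.
    rewrite (clamp_id (le_trans (ltW as_) ab) bt); split; [lra|lra|lra|lra|].
    by move=> y /andP[h1 h2]; apply/andP; split; lra.
  rewrite (clamp_hi st (ltW bt)); split; [lra|lra|lra|lra|].
  by move=> y /andP[h1 h2]; apply/andP; split; lra.
rewrite (clamp_hi st (ltW at_)) (clamp_hi st (le_trans (ltW at_) ab)).
split; [lra|lra|lra|lra|].
by move=> y /andP[h1 h2]; apply/andP; split; lra.
Qed.

(** Freezing [gamma] outside [[s, t]] keeps the time interval [[0, 1]], while its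
    length becomes that of the arc between the times [s] and [t]. *)
Definition stopped (s t : R) gamma := gamma \o clamp s t.

Lemma AC_stopped s t gamma : 0 <= s -> s <= t -> t <= 1 ->
  absolutely_continuous01 gamma -> absolutely_continuous01 (stopped s t gamma).
Proof.
move=> s0 st t1 gAC; apply: (@AC_comp gamma (clamp s t) id 1) => //.
- move=> a b a0 ab b1; have [h1 h2 h3 h4 _] := clampP s0 st t1 ab.
  by split => //; [exact: le_trans h1|exact: le_trans t1].
- by move=> a b y _ ab _; have [_ _ _ _] := clampP s0 st t1 ab; apply.
Qed.

(** The concatenation of [gamma] with a segment. *)
Definition extend gamma (v : 'rV[R]_n) (r : R) : 'rV[R]_n :=
  gamma (Num.min (2 * r) 1) + Num.max (2 * r - 1) 0 *: v.

Lemma AC_extend gamma v :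
  absolutely_continuous01 gamma -> absolutely_continuous01 (extend gamma v).
Proof.
move=> gAC.
have -> : extend gamma v = (gamma \o (fun r => Num.min (2 * r) 1)) \+
   (fun r => Num.max (2 * r - 1) 0 *: v) by apply/funext.
apply: ACD.
  apply: (@AC_comp gamma _ (fun y => y / 2) 2) => //.
    move=> a b a0 ab b1.
    case: (leP (2 * a) 1) => h1; case: (leP (2 * b) 1) => h2;
    split; lra.
  move=> a b y a0 ab b1.
  case: (leP (2 * a) 1) => h1; case: (leP (2 * b) 1) => h2 /andP[h3 h4];
  apply/andP; split; lra.
apply: (@AC_lipschitz _ (2 * `|v|)) => a b a0 ab b1.
rewrite -scalerBl normrZ [2 * _ * _]mulrAC ler_wpM2r //.
case: (leP (2 * a - 1) 0) => h1; case: (leP (2 * b - 1) 0) => h2;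
  rewrite ler_norml; apply/andP; split; lra.
Qed.

Lemma AC_near gamma (e : R) : absolutely_continuous01 gamma -> 0 < e ->
  exists2 d, 0 < d & forall a b, 0 <= a -> a <= b -> b <= 1 ->
    b - a < d -> `|gamma b - gamma a| < e.
Proof.
move=> gAC e0; have [d d0 H] := gAC _ e0; exists d => // a b a0 ab b1 bad.
have := H 1%N (fun=> a) (fun=> b); rewrite !big_ord1; apply => //.
by apply/trivIsetP => i j _ _; rewrite !ord1.
Qed.

End AC_curves.

Section curve_length_theory.
Context {R : realType} {n : nat}.
Local Notation mu := (@lebesgue_measure R).
Variable K : set 'rV[R]_n.
Hypothesis K_compact : compact K.
Hypothesis K_int0 : interior K 0.
Local Notation rho0 := (gauge (polar K)).
Implicit Types gamma : R -> 'rV[R]_n.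

Lemma measurable_rho0 : measurable_fun setT rho0.
Proof. by apply: continuous_measurable_rV; exact: continuous_rho0. Qed.

(** Only the almost everywhere values of the derivative count in the length. *)
Lemma curve_length_ae gamma (H : R -> R) (N : set R) :
  measurable (N : set (measurableTypeR R)) -> mu N = 0%E ->
  measurable_fun (setT : set (measurableTypeR R)) H -> (forall x, 0 <= H x) ->
  (forall t, 0 < t < 1 -> ~ N t -> rho0 (derive1 gamma t) = H t) ->
  curve_length K gamma = \int[mu]_(t in `[0, 1]) H t.
Proof.
move=> mN N0 mH H0 E; rewrite /curve_length /Rintegral; congr fine.
have mI : measurable (`[0, 1]%classic : set (measurableTypeR R)) by exact: measurable_itv.
apply: (@ge0_integral_ae_eq _ _ _ mu _ (N `|` [set 0] `|` [set 1])) => //.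
- by apply: measurableU; [apply: measurableU => //|]; exact: measurable_set1.
- have z0 : mu [set 0] = 0%E by exact: lebesgue_measure_set1.
  have z1 : mu [set 1] = 0%E by exact: lebesgue_measure_set1.
  have m0 : measurable ([set 0] : set (measurableTypeR R)) by exact: measurable_set1.
  have m1 : measurable ([set 1] : set (measurableTypeR R)) by exact: measurable_set1.
  apply: null_set_setU => //; first exact: measurableU.
  exact: null_set_setU.
- by apply/measurable_EFinP; exact: measurable_funTS.
- by move=> x _; rewrite lee_fin rho0_ge0.
- by move=> x _; rewrite lee_fin.
- move=> t; rewrite /= in_itv /= => /andP[t0 t1] nt; rewrite E //.
    by rewrite !lt_neqAle t0 t1 !andbT; apply/andP; split; apply/eqP => h; apply: nt;
      [left; right|right].
  by move=> Nt; apply: nt; left; left.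
Qed.

End curve_length_theory.

Lemma is_derive_half_speed (R : realType) (a b r : R) :
  is_derive r (1 : R) (cst a + b *: (2 *: id - cst 1)) (2 * b).
Proof.
have h2 : is_derive r (1 : R) (2 *: (@id R) - cst 1) (2 *: 1 - 0) by exact: is_deriveB.
have h3 := is_deriveD (is_derive_cst a r (1 : R)) (is_deriveZ b h2).
by apply: is_derive_eq h3 _; rewrite add0r subr0 [2 *: _]mulr1 /GRing.scale /=; ring.
Qed.

Section length_profile.
Context {R : realType} {n : nat}.
Local Notation mu := (@lebesgue_measure R).
Variable K : set 'rV[R]_n.
Hypothesis K_compact : compact K.
Hypothesis K_int0 : interior K 0.
Local Notation rho0 := (gauge (polar K)).
Implicit Types gamma : R -> 'rV[R]_n.

Lemma is_derive_rV (g : R -> 'rV[R]_n) (t : R) (l : 'rV[R]_n) :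
  is_derive t (1 : R) g l <->
  forall i, is_derive t (1 : R) (fun t => g t ord0 i) (l ord0 i).
Proof.
split=> [[dg <-] i|d].
  have /derivable_mxP dgi := dg; apply: DeriveDef; first exact: dgi.
  by rewrite derive_mx // mxE.
have dg : derivable g t 1.
  by apply/derivable_mxP => i j; rewrite (ord1 i); have [] := d j.
apply: DeriveDef => //; rewrite derive_mx //; apply/matrixP => i j.
by rewrite !mxE (ord1 i); have [] := d j.
Qed.

Lemma AC_density gamma : absolutely_continuous01 gamma ->
  exists (G : R -> 'rV[R]_n) (N : set R),
  [/\ measurable (N : set (measurableTypeR R)) /\ mu N = 0%E,
      forall i, mu.-integrable setT (fun t => (G t ord0 i)%:E),
      forall i a b, 0 <= a -> a <= b -> b <= 1 ->
        \int[mu]_(x in `]a, b]) G x ord0 i = gamma b ord0 i - gamma a ord0 i &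
      forall t : R, 0 < t < 1 -> ~ N t -> is_derive t (1 : R) gamma (G t)].
Proof.
move=> gAC.
have /choice[g Hg] : forall i, exists g : R -> R,
    [/\ mu.-integrable setT (EFin \o g),
      forall a b, 0 <= a -> a <= b -> b <= 1 ->
        \int[mu]_(x in `]a, b]) g x = gamma b ord0 i - gamma a ord0 i &
      {ae mu, forall x : R, 0 < x < 1 -> is_derive x 1 (fun t => gamma t ord0 i) (g x)}].
  by move=> i; exact: chain_AC_density (AC_coord i gAC).
have /= Fae := ae_filter_ringOfSetsType mu.
have : {ae mu, forall x : R, forall i, 0 < x < 1 ->
    is_derive x 1 (fun t => gamma t ord0 i) (g i x)}.
  by apply: filter_forall => i; have [] := Hg i.
move=> [N [mN N0 HN]].
exists (fun t => \row_i g i t), N; split => //.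
- move=> i; have [ig _ _] := Hg i; apply: eq_integrable ig => // t _ /=.
  by rewrite mxE.
- move=> i a b a0 ab b1; have [_ Ig _] := Hg i; rewrite -Ig //.
  by apply: eq_Rintegral => t _; rewrite mxE.
- move=> t t01 Nt.
  apply/is_derive_rV => i; rewrite mxE.
  by have : (forall i, 0 < t < 1 -> is_derive t 1 (fun t => gamma t ord0 i) (g i t));
    [apply: contrapT => /HN|apply].
Qed.

Lemma rho0_le_sum : exists2 C : R, 0 < C &
  forall x : 'rV[R]_n, rho0 x <= C * \sum_i `|x ord0 i|.
Proof.
have [C C0 HC] := rho0_le_norm K_compact K_int0; exists C => // x.
apply: (le_trans (HC x)); rewrite ler_wpM2l ?(ltW C0) //.
apply: norm_rV_le; first exact: sumr_ge0.
by move=> i; rewrite (bigD1 i) //= lerDl sumr_ge0.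
Qed.

Let mI a b c d : measurable ([set` Interval (BSide a b) (BSide c d)] : set (measurableTypeR R)).
Proof. exact: measurable_itv. Qed.

(** [V t] is the length of the arc up to the time [t]. The chord inequality holds
    because [rho0 z] is the pairing of [z] with some [p] of [K], and
    [<p, gamma'> <= rho0 gamma']. *)
Theorem length_profile gamma : absolutely_continuous01 gamma ->
  exists V : R -> R,
  [/\ {within `[0, 1], continuous V},
      forall s t, 0 <= s -> s <= t -> t <= 1 ->
        curve_length K (stopped s t gamma) = V t - V s,
      forall s t, 0 <= s -> s <= t -> t <= 1 ->
        rho0 (gamma t - gamma s) <= V t - V s,
      curve_length K gamma = V 1 - V 0 &
      forall v, curve_length K (extend gamma v) = V 1 - V 0 + rho0 v].
Proof.
move=> gAC; have [G [N [[mN N0] iG IG dG]]] := AC_density gAC.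
pose h t := rho0 (G t).
have h0 t : 0 <= h t by exact: rho0_ge0.
have mG : measurable_fun (setT : set (measurableTypeR R)) G.
  apply: measurable_fun_rV => i; apply/measurable_EFinP.
  by have /integrableP[] := iG i.
have mh : measurable_fun (setT : set (measurableTypeR R)) h.
  by apply: (@measurableT_comp _ _ _ _ _ _ rho0 _ G) => //; exact: measurable_rho0.
have ih : mu.-integrable setT (EFin \o h).
  have [C C0 HC] := rho0_le_sum.
  apply: (@le_integrable _ _ _ mu _ _ _ (fun t => C%:E * \sum_i `|(G t ord0 i)%:E|)%E) => //.
  - exact/measurable_EFinP.
  - move=> t _; rewrite gee0_abs ?lee_fin //.
    have -> : (\sum_i `|(G t ord0 i)%:E| = (\sum_i `|G t ord0 i|)%:E)%E.
      by rewrite -sumEFin.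
    rewrite -EFinM gee0_abs ?lee_fin ?HC //.
    by rewrite mulr_ge0 ?(ltW C0) // sumr_ge0.
  - apply: integrableZl => //; apply: integrable_sum => // i _.
    exact: integrable_abse.
have ihS (D : set (measurableTypeR R)) : measurable D -> mu.-integrable D (EFin \o h).
  by move=> mD; apply: integrableS ih.
pose V t := \int[mu]_(x in `[0, t]) h x.
have VB s t : 0 <= s -> s <= t -> V t - V s = \int[mu]_(x in `]s, t]) h x.
  move=> s0 st; rewrite /V (@Rintegral_itvB _ h (BLeft 0) (BRight t) s) ?bnd_simp //.
  exact: ihS.
have dG1 t : 0 < t < 1 -> ~ N t -> derive1 gamma t = G t.
  by move=> t01 Nt; rewrite derive1E; have [_] := dG t t01 Nt.
have stopE s t : 0 <= s -> s <= t -> t <= 1 ->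
    curve_length K (stopped s t gamma) = V t - V s.
  move=> s0 st t1; rewrite VB //.
  pose H : R -> R := h \_ `]s, t]%classic.
  have mS : measurable ([set s] : set (measurableTypeR R)) by exact: measurable_set1.
  have mT : measurable ([set t] : set (measurableTypeR R)) by exact: measurable_set1.
  rewrite (@curve_length_ae _ _ _ K_compact K_int0 _ H (N `|` [set s] `|` [set t])).
  - rewrite /H -Rintegral_mkcondl; congr Rintegral; apply/setIidPl => r.
    rewrite /= !in_itv /= => /andP[sr rt].
    by rewrite (le_trans s0 (ltW sr)) (le_trans rt t1).
  - by apply: measurableU => //; exact: measurableU.
  - have z0 : mu [set s] = 0%E by exact: lebesgue_measure_set1.
    have z1 : mu [set t] = 0%E by exact: lebesgue_measure_set1.
    apply: null_set_setU => //; first exact: measurableU.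
    exact: null_set_setU.
  - by apply/(measurable_restrictT h (mI false s false t)); exact: measurable_funTS mh.
  - by move=> r; rewrite /H patchE; case: ifP.
  move=> r r01 nr; rewrite /H patchE.
  have rs : r != s by apply/eqP => rs; apply: nr; left; right.
  have rt : r != t by apply/eqP => rt; apply: nr; right.
  have Nr : ~ N r by move=> Nr; apply: nr; left; left.
  have eqd (g : R -> 'rV[R]_n) : (\forall y \near r, stopped s t gamma y = g y) ->
      derive1 (stopped s t gamma) r = derive1 g r.
    by move=> E; rewrite !derive1E; exact: near_eq_derive.
  case: (ltgtP r s) rs => // rs _.
    rewrite (eqd (cst (gamma s))); last first.
      near=> y; rewrite /stopped /= clamp_lo //.
      by apply/ltW; near: y; exact: lt_nbhsl.
    rewrite derive1_cst rho0_0 //.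
    by rewrite memNset //= in_itv /= => /andP[]; rewrite ltNge ltW.
  case: (ltgtP r t) rt => // rt _.
    rewrite (eqd gamma); last first.
      near=> y; rewrite /stopped /= clamp_id //.
        by apply/ltW; near: y; exact: lt_nbhsr.
      by apply/ltW; near: y; exact: lt_nbhsl.
    by rewrite dG1 // mem_set //= in_itv /= rs ltW.
  rewrite (eqd (cst (gamma t))); last first.
    near=> y; rewrite /stopped /= clamp_hi //.
    by apply/ltW; near: y; exact: lt_nbhsr.
  rewrite derive1_cst rho0_0 //.
  by rewrite memNset //= in_itv /= => /andP[_]; rewrite leNgt rt.
exists V; split => //.
- exact: parameterized_integral_continuous (ihS _ (mI _ _ _ _)).
- move=> s t s0 st t1; rewrite VB //.
  have [p [Kp -> _]] := rho0_max K_compact K_int0 (gamma t - gamma s).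
  have iGS i : mu.-integrable (`]s, t]%classic : set (measurableTypeR R))
      (EFin \o (fun x => G x ord0 i)).
    by apply: integrableS (iG i) => //; exact: mI.
  have [i1 i2] := Rintegral_lincomb (fun i => p ord0 i) (mI _ _ _ _) iGS.
  have -> : dotmul p (gamma t - gamma s) =
      \int[mu]_(x in `]s, t]) \sum_i p ord0 i * G x ord0 i.
    by rewrite i2; apply: eq_bigr => i _; rewrite IG // !mxE.
  apply: le_Rintegral => //.
  + by apply: ihS; exact: mI.
  + by move=> x _; exact: (dotmul_le_rho0 K_compact K_int0).
- rewrite (@curve_length_ae _ _ _ K_compact K_int0 _ h N) //.
    by rewrite {2}/V set_itv1 Rintegral_set1 subr0.
  by move=> t t01 Nt; rewrite dG1.
move=> v; pose H r := if r <= 2^-1 then 2 * h (2 * r) else 2 * rho0 v.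
have V0 : V 0 = 0 by rewrite /V set_itv1 Rintegral_set1.
have mhalf : measurable ([set 2^-1 : R] : set (measurableTypeR R)).
  exact: measurable_set1.
have H0 r : 0 <= H r by rewrite /H; case: ifP => _; rewrite mulr_ge0 // rho0_ge0.
have mh2 : measurable_fun (setT : set (measurableTypeR R)) (fun r => h (2 * r)).
  apply: (@measurableT_comp _ _ _ _ _ _ h _ (fun r : R => 2 * r)) => //.
  by apply: measurable_funM => //; exact: measurable_cst.
have mH : measurable_fun (setT : set (measurableTypeR R)) H.
  apply: measurable_fun_ifT => //.
    exact: measurable_fun_ler.
  by apply: measurable_funM.
rewrite (@curve_length_ae _ _ _ K_compact K_int0 _ H ([set x | N (2 * x)] `|` [set 2^-1])) //.
- rewrite V0 subr0 /V /Rintegral.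
  have E01 : `[0, 1]%classic = (`[0, 2^-1] `|` `]2^-1, 1])%classic :> set R.
    rewrite -itv_bndbnd_setU // ?bnd_simp //; lra.
  rewrite [in LHS]E01 ge0_integral_setU //=; last 3 first.
  - by apply/measurable_EFinP; exact: measurable_funTS.
  - by move=> x _; rewrite lee_fin.
  - apply/disj_setPS => y [/=]; rewrite !in_itv /= => /andP[_ y1] /andP[+ _].
    by rewrite ltNge y1.
  rewrite (eq_integral (fun r : measurableTypeR R => 2%:E * (h (2 * (r : R))%R)%:E)%E); last first.
    by move=> x; rewrite inE /= in_itv /= /H => /andP[_ ->].
  rewrite [X in (_ + X)%E](eq_integral (cst (2 * rho0 v)%:E)); last first.
    by move=> x; rewrite inE /= in_itv /= /H => /andP[x1 _]; rewrite leNgt x1.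
  rewrite integral_cst; last exact: mI.
  have /= -> := lebesgue_measure_itv (`]2^-1, 1] : interval R).
  rewrite ge0_integralZl //; last 2 first.
  - by apply/measurable_EFinP; exact: measurable_funTS.
  - by move=> x _; rewrite lee_fin.
  have mhE : measurable_fun (setT : set (measurableTypeR R)) (fun r => (h r)%:E).
    exact/measurable_EFinP.
  have HH := integral_half mhE (fun r => h0 r).
  rewrite -[X in (X + _)%E]HH.
  rewrite lte_fin invf_lt1 // ltr1n -EFinB -EFinM fineD //.
    by congr (_ + _); rewrite /=; field.
  by apply: integrable_fin_num; [exact: mI|apply: ihS; exact: mI].
- by apply: measurableU => //; exact: measurable_half.
- apply: null_set_setU => //; first exact: measurable_half.
    exact: null_half.
  exact: lebesgue_measure_set1.
move=> r /andP[r0 r1] nr.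
have r12 : r != 2^-1 by apply/eqP => rE; apply: nr; right.
have Nr : ~ N (2 * r) by move=> Nr; apply: nr; left.
have eqd (g : R -> 'rV[R]_n) (l : 'rV[R]_n) : (\forall y \near r, g y = extend gamma v y) ->
    is_derive r (1:R) g l -> derive1 (extend gamma v) r = l.
  move=> E dg; have [_ <-] := near_eq_is_derive E dg.
  by rewrite derive1E.
rewrite /H; case: (ltgtP r 2^-1) r12 => // rh _.
  have r2 : 0 < 2 * r < 1 by apply/andP; split; lra.
  have D1 : is_derive r (1 : R) (fun y => gamma (2 * y)) (2 *: G (2 * r)).
    apply/is_derive_rV => i; rewrite mxE mulrC.
    have := dG (2 * r) r2 Nr => /is_derive_rV/(_ i) dgi.
    apply: (@is_derive1_comp _ (fun y => gamma y ord0 i) (fun y : R => 2 * y) r _ _ dgi).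
    have -> : (fun y : R => 2 * y) = 2 *: id by apply/funext.
    by apply: is_derive_eq; rewrite [2 *: _]mulr1.
  rewrite (@eqd _ _ _ D1) ?rho0Z //.
  near=> y; rewrite /extend.
  have y1 : y < 2^-1 by near: y; exact: lt_nbhsl.
  by rewrite min_l ?max_r ?scale0r ?addr0 //; lra.
have D1 : is_derive r (1 : R) (fun y : R => gamma 1 + (2 * y - 1) *: v) (2 *: v).
  apply/is_derive_rV => i; rewrite mxE.
  have -> : (fun t : R => (gamma 1 + (2 * t - 1) *: v) ord0 i) =
      cst (gamma 1 ord0 i) + (v ord0 i) *: (2 *: id - cst 1).
    by apply/funext => y; rewrite !mxE mulrC.
  exact: is_derive_half_speed.
rewrite (@eqd _ _ _ D1) ?rho0Z //.
near=> y; rewrite /extend.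
have y1 : 2^-1 < y by near: y; exact: lt_nbhsr.
by rewrite min_r ?max_l //; lra.
Unshelve. all: by end_near. Qed.

End length_profile.

(** * Weak gradients control increments *)

Section test_functions.
Context {R : realType} {n : nat}.
Variable Omega : set 'rV[R]_n.
Implicit Types (eta : 'rV[R]_n -> R) (S : set 'rV[R]_n).

Lemma compact_supp_bounded eta S : continuous eta -> compact S ->
  (forall x, ~ S x -> eta x = 0) -> exists2 C : R, 0 < C & forall x, `|eta x| <= C.
Proof.
move=> ceta cS eta0; have := cS; move=> /(continuous_compact (continuous_subspaceT ceta)).
move=> /compact_bounded[M [_ HM]]; exists (`|M| + 1); first by rewrite ltr_wpDl.
move=> x; have [Sx|Sx] := pselect (S x).
  by apply: (HM (`|M| + 1)); [rewrite ltr_pwDr // ler_norm|exists x].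
by rewrite eta0 // normr0 addr_ge0.
Qed.

Lemma test_continuous eta : test_function Omega eta -> continuous eta.
Proof. by case=> /(_ 0%N) [c _] _ _ x; exact: c. Qed.

Lemma test_Ck eta k : test_function Omega eta -> Ck_on k setT eta.
Proof. by case. Qed.

Lemma test_partial_continuous eta i :
  test_function Omega eta -> continuous (partial i eta).
Proof. by case=> /(_ 1%N) [_ /(_ i) [_ [c _]]] _ _ x; exact: c. Qed.

Lemma test_is_derive eta x v : test_function Omega eta ->
  is_derive x v eta (\sum_i v ord0 i * partial i eta x).
Proof.
move=> te; apply: (@C1_is_derive _ _ setT) => //; first exact: openT.
exact: test_Ck te.
Qed.

Definition supp eta := closure [set x | eta x != 0].

Lemma supp_out eta x : ~ supp eta x -> eta x = 0.
Proof.
move=> nx; apply: contrapT => /eqP ex; apply: nx; exact: subset_closure.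
Qed.

Lemma derive_supp_out eta v x : ~ supp eta x -> 'D_v eta x = 0.
Proof.
move=> nx; have oS : open (~` supp eta) by rewrite openC; exact: closed_closure.
rewrite (@near_eq_derive _ _ _ _ (cst 0)) ?derive_cst //.
have : nbhs x (~` supp eta) by exact: open_nbhs_nbhs.
by apply: filterS => y; exact: supp_out.
Qed.

Lemma test_bounded eta : test_function Omega eta ->
  exists2 C : R, 0 < C & forall x, `|eta x| <= C.
Proof.
move=> te; case: (te) => _ cS _.
exact: compact_supp_bounded (test_continuous te) cS (@supp_out eta).
Qed.

Lemma test_partial_bounded eta i : test_function Omega eta ->
  exists2 C : R, 0 < C & forall x, `|partial i eta x| <= C.
Proof.
move=> te; case: (te) => _ cS _.
apply: (compact_supp_bounded (@test_partial_continuous eta i te) cS) => x.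
exact: derive_supp_out.
Qed.

End test_functions.

Section bounded_domain.
Context {R : realType} {n : nat}.
Variable Omega : set 'rV[R]_n.
Hypothesis Omega_bounded : bounded_set Omega.
Hypothesis Omega_open : open Omega.

Lemma mOmega : measurable Omega.
Proof. exact: open_measurable_rV. Qed.

Lemma Omega_box : exists2 M : R, 0 < M & forall x, Omega x -> `|x| < M.
Proof.
have [M [_ HM]] := Omega_bounded; exists (`|M| + 2); first by rewrite ltr_wpDl.
move=> x Ox; apply: (@le_lt_trans _ _ (`|M| + 1)); last by rewrite ltrD2l ltr1n.
by apply: HM => //; rewrite ltr_pwDr // ler_norm.
Qed.

Lemma Omega_finite : (lebesgue_rV Omega < +oo)%E.
Proof.
have [M M0 HM] := Omega_box.
apply: le_lt_trans (lebesgue_rV_box_lty (fun=> - M) (fun=> M)).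
apply: le_measure; rewrite ?inE; [exact: mOmega|exact: measurable_rV_box|].
move=> x /HM xM i; rewrite -ltr_norml; exact: le_lt_trans (norm_coord _ _) xM.
Qed.

Lemma integrable_Linfty h : Linfty Omega h ->
  lebesgue_rV.-integrable Omega (EFin \o h).
Proof.
move=> [mh [M HM]]; apply/integrableP; split; first exact/measurable_EFinP.
apply: (@le_lt_trans _ _ (\int[lebesgue_rV]_(x in Omega) (cst `|M|%:E) x)%E).
  apply: ae_ge0_le_integral => //; first exact: mOmega.
  - by apply: measurableT_comp => //; exact/measurable_EFinP.
  - by move=> x _; rewrite lee_fin.
  - apply: filterS HM.
    by move=> x h1 Ox; rewrite lee_fin (le_trans (h1 Ox)) // ler_norm.
rewrite integral_cst; last exact: mOmega.
by rewrite lte_mul_pinfty // Omega_finite.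
Qed.

Lemma integrable_mul_bounded (f h : 'rV[R]_n -> R) (C : R) :
  lebesgue_rV.-integrable Omega (EFin \o f) -> measurable_fun Omega h ->
  (forall x, Omega x -> `|h x| <= C) ->
  lebesgue_rV.-integrable Omega (EFin \o (fun x => f x * h x)).
Proof.
move=> fi mh hC.
have mf : measurable_fun Omega f by apply/measurable_EFinP; case/integrableP : fi.
apply: (@le_integrable _ _ _ lebesgue_rV _ _ _ (fun x => C%:E * (f x)%:E)%E).
- exact: mOmega.
- by apply/measurable_EFinP; exact: measurable_funM.
- move=> x Ox; rewrite /= lee_fin !normrM mulrC ler_wpM2r //.
  by rewrite (le_trans (hC x Ox)) // ler_norm.
- by apply: integrableZl => //; exact: mOmega.
Qed.

End bounded_domain.

Section mollification.
Context {R : realType} {n : nat}.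
Local Notation mu := (@lebesgue_rV R n).

Lemma gbump_shift (m : R) (a b : 'I_n -> R) L (c z : 'rV[R]_n) :
  gbump m (fun i => a i + c ord0 i) (fun i => b i + c ord0 i) L z =
  gbump m a b L (z - c).
Proof.
apply: eq_bigr => i _; rewrite /bump1 !mxE; apply: eq_bigr => p _.
by congr (flat _ (m * _) * flat _ (m * _)); ring.
Qed.

(** All bumps of radius [e] are translates of one of them, so their mass does not
    depend on the centre. *)
Definition cbump (e : R) (c : 'rV[R]_n) : 'rV[R]_n -> R :=
  bump 1 (fun i => - e + c ord0 i) (fun i => e + c ord0 i).

Lemma cbumpE e c z : cbump e c z = cbump e 0 (z - c).
Proof.
rewrite /cbump /bump !gbump_shift; congr (gbump _ _ _ _ _).
by rewrite subr0.
Qed.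

Lemma partial_cbumpE e c i z : partial i (cbump e c) z = partial i (cbump e 0) (z - c).
Proof.
rewrite /partial /cbump /bump.
have [_ ->] := is_derive_gbump 1 (fun i => - e + c ord0 i) (fun i => e + c ord0 i)
  (fun=> [:: (1, 1)]) z i.
have [_ ->] := is_derive_gbump 1 (fun i => - e + (0 : 'rV[R]_n) ord0 i)
  (fun i => e + (0 : 'rV[R]_n) ord0 i) (fun=> [:: (1, 1)]) (z - c) i.
by rewrite !gbump_shift subr0.
Qed.

Lemma cbump_neq0 e c z : 0 <= e -> cbump e c z != 0 -> `|z - c| <= e.
Proof.
move=> e0 /eqP h; have : rV_box (fun i => - e + c ord0 i) (fun i => e + c ord0 i) z.
  by apply: contrapT => nz; apply: h; exact: bump_out.
move=> H; apply: norm_rV_le => // i; have /andP[h1 h2] := H i.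
by rewrite !mxE ler_norml; apply/andP; split; lra.
Qed.

Lemma cbump_ge0 e c z : 0 <= cbump e c z.
Proof. exact: bump_ge0. Qed.

Lemma test_cbump (Omega : set 'rV[R]_n) e c : 0 <= e ->
  (forall z, `|z - c| <= e -> Omega z) -> test_function Omega (cbump e c).
Proof.
move=> e0 H; apply: test_function_bump => // z zc; apply: H.
apply: norm_rV_le => // i; have /andP[h1 h2] := zc i.
by rewrite !mxE ler_norml; apply/andP; split; lra.
Qed.

Lemma test_cbumpT e c : 0 <= e -> test_function setT (cbump e c).
Proof. by move=> e0; exact: test_cbump. Qed.

Definition cbump_mass e := \int[mu]_(z in setT) cbump e 0 z.

Lemma measurable_cbump e c : 0 <= e -> measurable_fun setT (cbump e c).
Proof.
move=> e0; apply: continuous_measurable_rV.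
exact: test_continuous (@test_cbumpT e c e0).
Qed.

Lemma cbump_integral (Omega : set 'rV[R]_n) e c : 0 <= e ->
  (forall z, `|z - c| <= e -> Omega z) ->
  \int[mu]_(z in Omega) cbump e c z = cbump_mass e.
Proof.
move=> e0 H; rewrite Rintegral_mkcond /cbump_mass /Rintegral.
have mb : measurable_fun setT (fun z => (cbump e 0 z)%:E).
  by apply/measurable_EFinP; exact: measurable_cbump.
rewrite -[in RHS](integral_shift (- c) mb); congr fine; apply: eq_integral => z _.
rewrite -cbumpE patchE; case: ifPn => // zO; congr EFin; apply/esym.
apply: contrapT => /eqP /(cbump_neq0 e0) /H Oz.
by case/negP: zO; rewrite inE.
Qed.

Lemma cbump_integrable (Omega : set 'rV[R]_n) e c : 0 <= e ->
  (lebesgue_rV Omega < +oo)%E -> measurable Omega ->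
  mu.-integrable Omega (EFin \o cbump e c).
Proof.
move=> e0 fO mO.
apply: (@le_integrable _ _ _ mu _ _ _ (cst 1%E)) => //.
- by apply/measurable_EFinP; apply: measurable_funTS; exact: measurable_cbump.
- move=> z _ /=; rewrite lee_fin normr1 ger0_norm ?cbump_ge0 //; exact: bump_le1.
- apply/integrableP; split; first exact: measurable_cst.
  under eq_integral do rewrite /= normr1; rewrite integral_cst // mul1e //.
Qed.

Lemma cbump_mass_gt0 e : 0 < e -> 0 < cbump_mass e.
Proof.
move=> e0.
have m0 : 0 <= cbump_mass e by apply: Rintegral_ge0 => z _; exact: cbump_ge0.
rewrite lt_neqAle m0 andbT eq_sym; apply/eqP => mE.
pose B : set 'rV[R]_n := rV_box (fun i => - e + (0 : 'rV[R]_n) ord0 i)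
  (fun i => e + (0 : 'rV[R]_n) ord0 i).
have mB : measurable B by exact: measurable_rV_box.
have fB : (lebesgue_rV B < +oo)%E by exact: lebesgue_rV_box_lty.
have iB : mu.-integrable B (EFin \o cbump e 0) by apply: cbump_integrable => //; exact: ltW.
have E : cbump_mass e = \int[mu]_(z in B) cbump e 0 z.
  rewrite /cbump_mass [RHS]Rintegral_mkcond; apply: eq_Rintegral => z _.
  rewrite patchE; case: ifPn => // zB; apply: bump_out => // nB.
  by case/negP: zB; rewrite inE.
have f1 := integrable_fin_num mB iB.
have Z : (\int[mu]_(z in B) (EFin \o cbump e 0) z = 0)%E.
  by rewrite -(fineK f1); congr EFin; rewrite -mE E.
have Z' : (\int[mu]_(z in B) `|(EFin \o cbump e 0) z| = 0)%E.
  rewrite -[RHS]Z; apply: eq_integral => z _.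
  by rewrite /= ger0_norm // cbump_ge0.
have mcb : measurable_fun B (EFin \o cbump e 0).
  by apply/measurable_EFinP/measurable_funTS; apply: measurable_cbump; exact: ltW.
have [N [mN N0 BN]] := (ae_eq_integral_abs mu mB mcb).1 Z'.
have : (lebesgue_rV B <= lebesgue_rV N)%E.
  apply: le_measure; rewrite ?inE // => z Bz; apply: BN => /= /(_ Bz) /eqP.
  by rewrite eqe gt_eqF // bump_gt0.
rewrite [X in (_ <= X)%E -> _]N0 lebesgue_rV_boxE; last by move=> i; lra.
by rewrite lee_fin leNgt prodr_gt0 // => i _; lra.
Qed.

End mollification.

Section ae_comparison.
Context d (T : measurableType d) (R : realType).
Variable mu : {measure set T -> \bar R}.

Lemma ae_ge0_integral_ge0 (D : set T) (f : T -> \bar R) :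
  measurable D -> measurable_fun D f ->
  {ae mu, forall x, D x -> 0 <= f x}%E -> (0 <= \int[mu]_(x in D) f x)%E.
Proof.
move=> mD mf f0; rewrite integralE.
rewrite (@ae_eq_integral _ _ _ mu D (cst 0%E) (f^\-)%E) //; last 2 first.
- exact: measurable_funeneg.
- apply: filterS f0 => x f0 Dx; rewrite /= funenegE max_r // oppe_le0; exact: f0.
by rewrite integral0 sube0 integral_ge0.
Qed.

Lemma ae_le_Rintegral (D : set T) (f g : T -> R) : measurable D ->
  mu.-integrable D (EFin \o f) -> mu.-integrable D (EFin \o g) ->
  {ae mu, forall x, D x -> f x <= g x} ->
  \int[mu]_(x in D) f x <= \int[mu]_(x in D) g x.
Proof.
move=> mD fi gi fg; rewrite -subr_ge0 -RintegralB // /Rintegral fine_ge0 //.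
apply: ae_ge0_integral_ge0 => //.
  by have := measurable_int mu (integrableB mD gi fi).
by apply: filterS fg => x h /h; rewrite lee_fin subr_ge0.
Qed.

End ae_comparison.

Section weak_mean_value.
Context {R : realType} {n : nat}.
Local Notation mu := (@lebesgue_rV R n).
Variables (Omega K : set 'rV[R]_n).
Hypothesis Omega_bounded : bounded_set Omega.
Hypothesis Omega_open : open Omega.
Hypothesis K_compact : compact K.
Hypothesis K_int0 : interior K 0.
Local Notation rho0 := (gauge (polar K)).
Variables (u : 'rV[R]_n -> R) (g : 'rV[R]_n -> 'rV[R]_n).
Hypothesis ug : W1infty Omega u g.
Hypothesis gK : \forall x \ae lebesgue_rV, Omega x -> K (g x).

Let mO : measurable Omega := mOmega Omega_open.

Let iu : mu.-integrable Omega (EFin \o u).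
Proof. by case: ug => Lu _ _; exact: integrable_Linfty. Qed.

Let ig i : mu.-integrable Omega (EFin \o (fun x => g x ord0 i)).
Proof. by case: ug => _ Lg _; exact: integrable_Linfty. Qed.

Let slope e (c v : 'rV[R]_n) (z : 'rV[R]_n) : R :=
  \sum_i (- v) ord0 i * partial i (cbump e c) z.

Let is_derive_moving e (y v z : 'rV[R]_n) (s : R) : 0 <= e ->
  is_derive s (1 : R) (fun s : R => cbump e (y + s *: v) z) (slope e (y + s *: v) v z).
Proof.
move=> e0.
have -> : (fun s : R => cbump e (y + s *: v) z) = (fun s : R => cbump e 0 (z - y + s *: (- v))).
  by apply/funext => t; rewrite cbumpE opprD scalerN addrA.
have -> : slope e (y + s *: v) v z = slope e 0 v (z - y + s *: (- v)).
  apply: eq_bigr => i _; rewrite partial_cbumpE; congr (_ * partial _ _ _).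
  by rewrite opprD scalerN addrA.
by apply: is_derive_line_at; exact: test_is_derive (test_cbumpT 0 e0).
Qed.

Let slope_bounded e v : 0 <= e -> exists2 C : R, 0 < C &
  forall c z, `|slope e c v z| <= C.
Proof.
move=> e0.
have /choice[C HC] : forall i : 'I_n, exists C : R,
    0 < C /\ forall x, `|partial i (cbump e 0) x| <= C.
  by move=> i; have [C C0 HC] := test_partial_bounded i (@test_cbumpT R n e 0 e0); exists C.
exists (\sum_i `|v ord0 i| * C i + 1).
  rewrite ltr_wpDl // sumr_ge0 // => i _; rewrite mulr_ge0 // ltW //.
  by have [] := HC i.
move=> c z; apply: (le_trans (ler_norm_sum _ _ _)); rewrite ler_wpDr //.
apply: ler_sum => i _; rewrite normrM mxE normrN ler_wpM2l // partial_cbumpE.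
by have [_] := HC i.
Qed.

Let F e (y v : 'rV[R]_n) (s : R) := \int[mu]_(z in Omega) (u z * cbump e (y + s *: v) z).

Let is_derive_F e y v s : 0 <= e -> is_derive s (1 : R) (F e y v)
  (\int[mu]_(z in Omega) (u z * slope e (y + s *: v) v z)).
Proof.
move=> e0; have [C C0 HC] := slope_bounded v e0.
pose f (s : R) z := u z * cbump e (y + s *: v) z.
have df (s' : R) z : is_derive s' (1 : R) (f ^~ z) (u z * slope e (y + s' *: v) v z).
  by have := is_derive_moving y v z s' e0 => d; apply: is_derive_eq.
have sI : `](s - 1), (s + 1)[%classic s by rewrite /= in_itv /=; apply/andP; split; lra.
have intf (x : R) : `](s - 1), (s + 1)[%classic x -> mu.-integrable Omega (EFin \o f x).
  move=> _; apply: (@integrable_mul_bounded _ _ _ Omega_open _ _ 1) => //.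
    by apply: measurable_funTS; exact: measurable_cbump.
  by move=> z _; rewrite ger0_norm ?cbump_ge0 // bump_le1.
have derf (x : R) z : `](s - 1), (s + 1)[%classic x -> Omega z -> derivable (f ^~ z) x 1.
  by move=> _ _; have [] := df x z.
have G0 z : 0 <= `|u z * C| by [].
have iG : mu.-integrable Omega (EFin \o (fun z => `|u z * C|)).
  have := @integrable_mul_bounded _ _ _ Omega_open u (cst C) C iu (measurable_cst _) _.
  move=> /(_ _)/integrable_abse; apply => x _ /=; by rewrite gtr0_norm.
have Gub (x : R) z : `](s - 1), (s + 1)[%classic x -> Omega z ->
    `|partial1of2 f x z| <= `|u z * C|.
  move=> _ _; rewrite partial1of2E; have [_ ->] := df x z.
  by rewrite !normrM ler_wpM2l // (le_trans (HC _ _)) // ler_norm.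
have D1 := derivable_under_integral mO sI intf derf G0 iG Gub.
apply: DeriveDef => //.
have := differentiation_under_integral mO sI intf derf G0 iG Gub.
rewrite derive1E => ->; apply: eq_Rintegral => z _.
by rewrite partial1of2E; have [_] := df s z.
Qed.

(** The derivative of the mollified function in the direction [v] is an average
    of [<Du, v>], which is at most [rho0 v] because [Du] lies in [K]. *)
Lemma mollified_increment e y v : 0 <= e ->
  (forall s, 0 <= s <= 1 -> forall z, `|z - (y + s *: v)| <= e -> Omega z) ->
  F e y v 1 - F e y v 0 <= rho0 v * @cbump_mass R n e.
Proof.
move=> e0 inO.
have [c c01 ->] : exists2 c, c \in `[0, 1] & F e y v 1 - F e y v 0 =
    (\int[mu]_(z in Omega) (u z * slope e (y + c *: v) v z)) * (1 - 0).
  apply: MVT_segment => // [x _|]; first exact: is_derive_F.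
  apply: continuous_subspaceT => x.
  by have [/derivable1_diffP/differentiable_continuous] := is_derive_F y v x e0.
rewrite subr0 mulr1; move: c01; rewrite in_itv /= => c01.
have tc := test_cbump e0 (inO c c01).
set cc := y + c *: v.
have iup i : mu.-integrable Omega (EFin \o (fun z => u z * partial i (cbump e cc) z)).
  have [C C0 HC] := test_partial_bounded i tc.
  apply: (@integrable_mul_bounded _ _ _ Omega_open _ _ C) => //.
  apply: measurable_funTS; apply: continuous_measurable_rV.
  exact: test_partial_continuous tc.
have igc i : mu.-integrable Omega (EFin \o (fun z => g z ord0 i * cbump e cc z)).
  apply: (@integrable_mul_bounded _ _ _ Omega_open _ _ 1) => //.
    by apply: measurable_funTS; exact: measurable_cbump.
  by move=> z _; rewrite ger0_norm ?cbump_ge0 // bump_le1.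
have -> : \int[mu]_(z in Omega) (u z * slope e cc v z) =
    \int[mu]_(z in Omega) (\sum_i v ord0 i * (g z ord0 i * cbump e cc z)).
  have [_ ->] := Rintegral_lincomb (fun i => v ord0 i) mO igc.
  have [_ E2] := Rintegral_lincomb (fun i => (- v) ord0 i) mO iup.
  rewrite (_ : \int[mu]_(z in Omega) (u z * slope e cc v z) =
    \int[mu]_(z in Omega) (\sum_i (- v) ord0 i * (u z * partial i (cbump e cc) z))).
    rewrite E2; apply: eq_bigr => i _; case: ug => _ _ /(_ _ tc i) ->.
    by rewrite mxE mulrNN.
  apply: eq_Rintegral => z _; rewrite /slope mulr_sumr; apply: eq_bigr => i _.
  by rewrite mulrCA.
have cint := cbump_integral e0 (inO c c01).
have icb : mu.-integrable Omega (EFin \o cbump e cc).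
  by apply: (cbump_integrable cc e0 _ mO); exact: Omega_finite.
rewrite -cint -(RintegralZl _ mO icb).
apply: (ae_le_Rintegral mO).
- by have [i1 _] := Rintegral_lincomb (fun i => v ord0 i) mO igc.
- by have := integrableZl mO (rho0 v) icb; apply: eq_integrable.
- apply: filterS gK => z gz Oz.
  apply: le_trans (ler_wpM2r (cbump_ge0 e cc z) (dotmul_le_rho0 K_compact K_int0 v (gz Oz))).
  rewrite /dotmul mulr_suml le_eqVlt; apply/orP; left; apply/eqP.
  by apply: eq_bigr => i _; ring.
Qed.

(** The mollified functions converge to [u] at [x] and [y] as their radius tends
    to zero. *)
Lemma weak_gradient_increment_near (c x y : 'rV[R]_n) (r : R) : 0 < r ->
  (forall z, Omega z -> {for z, continuous u}) ->
  (forall z, `|z - c| < 2 * r -> Omega z) -> `|x - c| < r -> `|y - c| < r ->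
  u x - u y <= rho0 (x - y).
Proof.
move=> r0 cu cO xc yc; apply/ler_addgt0Pr => w w0.
have Ox : Omega x by apply: cO; lra.
have Oy : Omega y by apply: cO; lra.
have w4 : 0 < w / 4 by rewrite divr_gt0.
have [e [e0 er Hx Hy]] : exists e : R, [/\ 0 < e, e < r,
    forall z, `|z - x| <= e -> `|u z - u x| <= w / 4 &
    forall z, `|z - y| <= e -> `|u z - u y| <= w / 4].
  have key p : Omega p -> exists2 e : R, 0 < e & forall z, `|z - p| <= e -> `|u z - u p| <= w / 4.
    move=> Op; have /cvgrPdist_le/(_ _ w4)/nbhs_ballP[d /= d0 Hd] := cu p Op.
    exists (d / 2); first by rewrite divr_gt0.
    move=> z zp; rewrite distrC; apply: Hd; rewrite -ball_normE /ball_ /= distrC.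
    by apply: (le_lt_trans zp); lra.
  have [e1 e10 H1] := key x Ox; have [e2 e20 H2] := key y Oy.
  exists (Num.min (r / 2) (Num.min e1 e2)); split.
  - by rewrite !lt_min e10 e20 divr_gt0.
  - by rewrite gt_min; apply/orP; left; lra.
  - by move=> z; rewrite !le_min => /and3P[_ h _]; exact: H1.
  - by move=> z; rewrite !le_min => /and3P[_ _ h]; exact: H2.
have inO (s : R) : 0 <= s <= 1 -> forall z, `|z - (y + s *: (x - y))| <= e -> Omega z.
  move=> /andP[s0 s1] z zs; apply: cO.
  have -> : z - c = (z - (y + s *: (x - y))) + ((1 - s) *: (y - c) + s *: (x - c)).
    by apply/rowP => i; rewrite !mxE; ring.
  apply: (le_lt_trans (ler_normD _ _)).
  apply: (@le_lt_trans _ _ (e + ((1 - s) * r + s * r))); last by lra.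
  apply: lerD => //; apply: (le_trans (ler_normD _ _)).
  rewrite !normrZ [`|1 - s|]ger0_norm; last by lra.
  rewrite ger0_norm // lerD // ler_wpM2l ?(ltW yc) ?(ltW xc) //; lra.
have M0 := @cbump_mass_gt0 R n e e0.
have I1 := mollified_increment (ltW e0) inO.
have approx (p : 'rV[R]_n) : (forall z, `|z - p| <= e -> Omega z) ->
    (forall z, `|z - p| <= e -> `|u z - u p| <= w / 4) ->
    `|\int[mu]_(z in Omega) (u z * cbump e p z) - u p * @cbump_mass R n e| <= w / 4 * @cbump_mass R n e.
  move=> pO pe.
  have icb : mu.-integrable Omega (EFin \o cbump e p).
    by apply: cbump_integrable => //; [exact: ltW|exact: Omega_finite].
  have iucb : mu.-integrable Omega (EFin \o (fun z => u z * cbump e p z)).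
    apply: (@integrable_mul_bounded _ _ _ Omega_open _ _ 1) => //.
      by apply: measurable_funTS; apply: measurable_cbump; exact: ltW.
    by move=> z _; rewrite ger0_norm ?cbump_ge0 // bump_le1.
  have iZ (k : R) : mu.-integrable Omega (EFin \o (fun z => k * cbump e p z)).
    by have := integrableZl mO k icb; apply: eq_integrable.
  have cE := cbump_integral (ltW e0) pO.
  have -> : \int[mu]_(z in Omega) (u z * cbump e p z) - u p * @cbump_mass R n e =
      \int[mu]_(z in Omega) (u z * cbump e p z - u p * cbump e p z).
    rewrite (@RintegralB _ _ _ mu Omega (fun z => u z * cbump e p z)
      (fun z => u p * cbump e p z) mO iucb (iZ (u p))).
    by rewrite (RintegralZl _ mO icb) cE.
  have iB : mu.-integrable Omega (EFin \o (fun z => u z * cbump e p z - u p * cbump e p z)).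
    by have := integrableB mO iucb (iZ (u p)).
  rewrite -cE -(RintegralZl _ mO icb).
  apply: (le_trans (le_normr_Rintegral mO iB)).
  apply: (le_Rintegral mO).
  - by have := integrable_abse iB; apply: eq_integrable.
  - exact: iZ.
  move=> z _ /=; rewrite -mulrBl normrM (ger0_norm (cbump_ge0 _ _ _)).
  have [->|cz] := eqVneq (cbump e p z) 0; first by rewrite !mulr0.
  by rewrite ler_wpM2r ?cbump_ge0 //; apply: pe; exact: cbump_neq0 (ltW e0) cz.
have A1 := approx x _ Hx; have A2 := approx y _ Hy.
move: I1; rewrite /F scale1r scale0r addr0 subrKC => I1.
have {}A1 : `|\int[mu]_(z in Omega) (u z * cbump e x z) - u x * @cbump_mass R n e| <= w / 4 * @cbump_mass R n e.
  apply: A1 => z zx; apply: (inO 1); rewrite ?ler01 ?lexx //.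
  by rewrite scale1r subrKC.
have {}A2 : `|\int[mu]_(z in Omega) (u z * cbump e y z) - u y * @cbump_mass R n e| <= w / 4 * @cbump_mass R n e.
  by apply: A2 => z zy; apply: (inO 0); rewrite ?ler01 ?lexx // scale0r addr0.
rewrite -(ler_pM2r M0).
move: A1 A2; rewrite !ler_norml => /andP[a1 a2] /andP[b1 b2].
have wM : 0 < w * @cbump_mass R n e by rewrite mulr_gt0.
set I := \int[mu]_(z in Omega) (u z * cbump e x z) in I1 a1 a2.
set I' := \int[mu]_(z in Omega) (u z * cbump e y z) in I1 b1 b2.
rewrite mulrBl mulrDl; lra.
Qed.

End weak_mean_value.

(** * Weak gradients of Lipschitz functions *)

Section real_limsup.
Context {R : realType}.
Implicit Types s : nat -> R.

(** The upper limit gives a measurable candidate for a directional derivative,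
    defined at every point. *)
Definition rlimsup s : R := fine (limn_esup (EFin \o s)).

Lemma limn_esup_bounds s (a b : R) (k0 : nat) :
  (forall k, (k0 <= k)%N -> a <= s k <= b) ->
  (a%:E <= limn_esup (EFin \o s) <= b%:E)%E.
Proof.
move=> H; apply/andP; split; last first.
  apply: (@le_trans _ _ (ereal_sup ((EFin \o s) @` [set k | (k0 <= k)%N]))).
    by apply: ereal_inf_lbound; exists [set k | (k0 <= k)%N] => //; exists k0.
  by apply: ge_ereal_sup => _ [k /= /H /andP[_ h] <-]; rewrite lee_fin.
apply: le_ereal_inf_tmp => _ [A [r /= _ rA] <-].
have /H/andP[h _] : (k0 <= maxn k0 r)%N by rewrite leq_maxl.
apply: (@le_trans _ _ (s (maxn k0 r))%:E); first by rewrite lee_fin.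
by apply: ereal_sup_ubound; exists (maxn k0 r) => //; apply: rA; rewrite /= leq_maxr.
Qed.

Lemma rlimsup_bounds s (a b : R) (k0 : nat) :
  (forall k, (k0 <= k)%N -> a <= s k <= b) -> a <= rlimsup s <= b.
Proof.
move=> /limn_esup_bounds; rewrite /rlimsup; case: (limn_esup _) => [r||].
- by rewrite !lee_fin.
- by move=> /andP[_].
- by move=> /andP[].
Qed.

Lemma cvg_limn_esup_einf s (l : R) : s @ \oo --> l ->
  limn_esup (EFin \o s) = l%:E /\ limn_einf (EFin \o s) = l%:E.
Proof.
move=> sl; have el : (EFin \o s) @ \oo --> l%:E.
  by apply: cvg_EFin => //; exact: nearW.
split.
  by rewrite is_cvg_limn_esupE; [exact/cvg_lim|apply/cvg_ex; eexists; exact: el].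
by rewrite is_cvg_limn_einfE; [exact/cvg_lim|apply/cvg_ex; eexists; exact: el].
Qed.

Lemma rlimsup_cvg s (l : R) : s @ \oo --> l -> rlimsup s = l.
Proof. by move=> /cvg_limn_esup_einf[E _]; rewrite /rlimsup E. Qed.

Lemma limn_esup_einf_cvg s (l : R) : limn_esup (EFin \o s) = l%:E ->
  limn_einf (EFin \o s) = l%:E -> s @ \oo --> l.
Proof.
move=> E1 E2.
have c : (EFin \o s) @ \oo --> l%:E.
  apply: (@squeeze_cvge _ _ _ _ (einfs (EFin \o s)) _ (esups (EFin \o s))).
  - near=> k; apply/andP; split.
      by apply: ereal_inf_lbound; exists k => /=.
    by apply: ereal_sup_ubound; exists k => /=.
  - rewrite -E2 limn_einf_lim; exact: is_cvg_einfs.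
  - rewrite -E1 limn_esup_lim; exact: is_cvg_esups.
exact: (fine_cvg c).
Unshelve. all: by end_near. Qed.

End real_limsup.

Section measurable_limits.
Context d (T : measurableType d) (R : realType).
Variable mu : {measure set T -> \bar R}.
Implicit Types (f : nat -> T -> R).

Lemma measurable_rlimsup (D : set T) f : (forall k, measurable_fun D (f k)) ->
  measurable_fun D (fun x => rlimsup (f ^~ x)).
Proof.
move=> mf; apply: (@measurableT_comp _ _ _ _ _ _ fine) => //.
by apply: measurable_fun_limn_esup => k; exact/measurable_EFinP.
Qed.

Lemma measurable_not_cvg f (B : R) : (forall k, measurable_fun setT (f k)) ->
  (forall k x, `|f k x| <= B) -> measurable [set x | ~ cvg (f ^~ x @ \oo)].
Proof.
move=> mf fB.
have mE k : measurable_fun setT (fun x => (f k x)%:E) by exact/measurable_EFinP.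
have m1 : measurable_fun setT (fun x => limn_esup (fun k => (f k x)%:E)).
  exact: measurable_fun_limn_esup.
have m2 : measurable_fun setT (fun x => limn_einf (fun k => (f k x)%:E)).
  rewrite /limn_einf; apply: measurableT_comp => //.
  apply: measurable_fun_limn_esup => k.
  by apply: measurableT_comp.
have := emeasurable_neq measurableT (emeasurable_funB m1 m2) 0%E.
rewrite setTI; congr measurable; apply/seteqP.
have fin x : exists r q : R, limn_esup (EFin \o f ^~ x) = r%:E /\
    limn_einf (EFin \o f ^~ x) = q%:E.
  have b1 : (forall k, (0 <= k)%N -> - B <= f k x <= B).
    by move=> k _; have := fB k x; rewrite ler_norml.
  have b2 : (forall k, (0 <= k)%N -> - B <= - f k x <= B).
    by move=> k _; have := fB k x; rewrite -normrN ler_norml.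
  have := limn_esup_bounds b1; have := limn_esup_bounds b2.
  rewrite /limn_einf.
  have -> : (\- (EFin \o f^~ x))%E = EFin \o (fun k => - f k x) by apply/funext.
  case: (limn_esup (EFin \o (fun k => - f k x))) => [q||] h1; last 2 first.
  - by move: h1 => /andP[_].
  - by move: h1 => /andP[].
  case: (limn_esup _) => [r||] h2; last 2 first.
  - by move: h2 => /andP[_].
  - by move: h2 => /andP[].
  by exists r, (- q).
split=> x /=.
  have [r [q [E1 E2]]] := fin x; move=> /eqP h /cvg_ex[l /= cl]; apply: h.
  have [E3 E4] := cvg_limn_esup_einf cl.
  by rewrite [X in (X - _)%E]E3 [X in (_ - X)%E]E4 subee.
have [r [q [E1 E2]]] := fin x; move=> nc; apply/eqP => h; apply: nc.
rewrite [X in (X - _)%E]E1 [X in (_ - X)%E]E2 -EFinB in h.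
have rq : r = q by move: h => [] /eqP; rewrite subr_eq0 => /eqP.
by apply/cvg_ex; exists r; apply: limn_esup_einf_cvg => //; rewrite rq.
Qed.

Lemma dominated_Rintegral (D : set T) f (h g : T -> R) : measurable D ->
  (forall k, measurable_fun D (f k)) -> measurable_fun D h ->
  mu.-integrable D (EFin \o g) ->
  {ae mu, forall x, D x -> f ^~ x @ \oo --> h x} ->
  (forall k x, D x -> `|f k x| <= g x) ->
  \int[mu]_(x in D) f k x @[k --> \oo] --> \int[mu]_(x in D) h x.
Proof.
move=> mD mf mh ig cf fg.
have mfE k : measurable_fun D (fun x => (f k x)%:E) by exact/measurable_EFinP.
have mhE : measurable_fun D (fun x => (h x)%:E) by exact/measurable_EFinP.
have cE : {ae mu, forall x, D x -> (fun k => (f k x)%:E) @ \oo --> (h x)%:E}.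
  apply: filterS cf => x H Dx; apply: cvg_EFin; first exact: nearW.
  exact: H.
have bE : {ae mu, forall x k, D x -> `|(f k x)%:E| <= (EFin \o g) x}%E.
  by apply: aeW => x k Dx; rewrite lee_fin; exact: fg.
have [i1 _ c] := dominated_convergence mD mfE mhE cE ig bE.
apply: fine_cvg; rewrite fineK //; exact: integrable_fin_num.
Qed.

End measurable_limits.

Section local_negligibility.
Context {R : realType} {n : nat}.
Implicit Types (A N U : set 'rV[R]_n).

(** By second countability a set is null as soon as it is locally null. *)
Lemma negligible_local A N :
  (forall x, A x -> exists U, [/\ open U, U x & lebesgue_rV.-negligible (N `&` U)]) ->
  lebesgue_rV.-negligible (N `&` A).
Proof.
move=> H.
pose Q (q : {ffun 'I_n -> rat * rat}) : set 'rV[R]_n :=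
  rV_box (fun i => ratr (q i).1) (fun i => ratr (q i).2).
pose P q := `[< lebesgue_rV.-negligible (N `&` Q q) >].
pose S (k : nat) := if unpickle k is Some q then (if P q then N `&` Q q else set0) else set0.
apply: (@negligibleS _ _ _ _ (\bigcup_k S k)).
  move=> x [Nx Ax]; have [U [oU Ux nU]] := H x Ax.
  move: Ux; rewrite {1}(open_rV_bigcup oU) => -[q /= qU Qx].
  exists (pickle q) => //; rewrite /S pickleK.
  have -> : P q by apply/asboolP; apply: negligibleS nU => y [Ny Qy]; split => //; exact: qU.
  by split.
apply: negligible_bigcup => k; rewrite /S.
case: unpickle => [q|]; last exact: negligible_set0.
case: ifPn => [/asboolP //|_]; exact: negligible_set0.
Qed.

Lemma compact_margin (S U : set 'rV[R]_n) : compact S -> open U -> S `<=` U ->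
  exists2 d : R, 0 < d & forall x, S x -> forall z, `|z - x| < d -> U z.
Proof.
move=> cS oU SU.
have /compact_near_coveringP := cS.
move=> /(_ R (0 : R)^'+ (fun d x => forall z, `|z - x| < d -> U z) _).
have H : forall x, S x -> \forall x' \near x & d \near (0 : R)^'+,
    forall z, `|z - x'| < d -> U z.
  move=> x Sx; have : nbhs x U by apply: open_nbhs_nbhs; split => //; exact: SU.
  move=> /nbhs_ballP[r /= r0 rU].
  have r2 : 0 < r / 2 by rewrite divr_gt0.
  exists ([set x' | `|x - x'| < r / 2], [set d | d < r / 2]) => /=.
    split; first by apply/nbhs_ballP; exists (r / 2) => //= y; rewrite -ball_normE.
    exact: nbhs_right_lt.
  move=> [x' d] /= [xx' dr] z zx'; apply: rU; rewrite -ball_normE /ball_ /=.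
  rewrite -[x - z](subrKA x'); apply: (le_lt_trans (ler_normD _ _)).
  by rewrite [ltRHS]splitr ltrD // distrC (lt_trans zx').
move=> /(_ H) near_d.
have [d [d0 Hd]] : exists d : R, 0 < d /\ S `<=` (fun x => forall z, `|z - x| < d -> U z).
  near (0 : R)^'+ => d; exists d; split; near: d; first exact: nbhs_right_gt.
  exact: near_d.
by exists d.
Unshelve. all: by end_near. Qed.

End local_negligibility.

Section directional_derivatives_ae.
Context {R : realType} {n : nat}.

Definition dquot (w : 'rV[R]_n -> R) (v : 'rV[R]_n) (k : nat) (x : 'rV[R]_n) : R :=
  k.+1%:R * (w (x + k.+1%:R^-1 *: v) - w x).

Lemma derivable_cvg_seq (psi : R -> R) (t d : R) : is_derive t (1 : R) psi d ->
  k.+1%:R * (psi (t + k.+1%:R^-1) - psi t) @[k --> \oo] --> d.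
Proof.
move=> [/cvg_ex[l cl] <-].
have -> : 'D_1 psi t = l by rewrite /derive; apply/cvg_lim.
have /cvgr_dnbhsP := cl => /(_ (fun k => k.+1%:R^-1)).
have H : (forall k, (k.+1%:R^-1 : R) != 0) /\ k.+1%:R^-1 @[k --> \oo] --> (0 : R).
  by split; [move=> k; rewrite invr_eq0 pnatr_eq0|exact: cvg_harmonic].
move=> /(_ H); apply: cvg_trans; apply: near_eq_cvg; near=> k => /=.
by rewrite invrK /GRing.scale /= mulr1 [_ + t]addrC.
Unshelve. all: by end_near. Qed.

Lemma lipschitz_continuous (w : 'rV[R]_n -> R) (C : R) :
  (forall x y, `|w x - w y| <= C * `|x - y|) -> continuous w.
Proof.
move=> wC x; apply/(@cvgrPdist_le _ _ _ _ (nbhs_filter x)) => e e0; near=> y.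
apply: (le_trans (wC _ _)); apply: (@le_trans _ _ ((`|C| + 1) * `|x - y|)).
  by rewrite ler_wpM2r // (le_trans (ler_norm _)) // lerDl.
have C1 : 0 < `|C| + 1 by rewrite ltr_wpDl.
rewrite -ler_pdivlMl //; near: y; apply: near_norm_le.
by rewrite mulr_gt0 // invr_gt0.
Unshelve. all: by end_near. Qed.

Lemma measurable_dquot (w : 'rV[R]_n -> R) v k :
  measurable_fun setT w -> measurable_fun setT (dquot w v k).
Proof.
move=> mw; apply: measurable_funM; first exact: measurable_cst.
apply: measurable_funB => //.
by apply: (@measurableT_comp _ _ _ _ _ _ w) => //; exact: measurable_shift.
Qed.

(** On a line a Lipschitz function is absolutely continuous, hence derivable
    almost everywhere; a set that is null on all parallel lines is null. *)
Lemma lipschitz_dquot_cvg (w : 'rV[R]_n -> R) (C : R) v :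
  (forall x y, `|w x - w y| <= C * `|x - y|) ->
  lebesgue_rV.-negligible [set x | ~ cvg (dquot w v ^~ x @ \oo)].
Proof.
move=> wC; have mw := continuous_measurable_rV (lipschitz_continuous wC).
set N := [set x | _].
have mN : measurable N.
  apply: (@measurable_not_cvg _ _ _ (dquot w v) (C * `|v|)).
    by move=> k; exact: measurable_dquot.
  move=> k x; rewrite /dquot normrM ger0_norm //.
  rewrite -ler_pdivlMl //; apply: (le_trans (wC _ _)).
  by rewrite [x + _]addrC addrK normrZ ger0_norm ?invr_ge0 // mulrCA.
suff N0 : lebesgue_rV N = 0%E by exists N; split.
apply: (@null_on_lines _ _ _ v) => // x.
pose psi (t : R) := w (x + t *: v).
have psiAC : chain_AC psi.
  move=> e e0; pose B := `|C| * `|v| + 1.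
  have B0 : 0 < B by rewrite ltr_wpDl // mulr_ge0.
  exists (e / B); first exact: divr_gt0.
  move=> s /andP[/allP sl _] sd.
  apply: (@le_trans _ _ (B * chain_length s)).
    rewrite /chain_variation /chain_length big_seq mulr_sumr [leRHS]big_seq.
    apply: ler_sum => p /sl /and3P[_ p21 _].
    apply: (le_trans (wC _ _)); rewrite opprD addrACA subrr add0r -scalerBl normrZ.
    rewrite (ger0_norm (_ : 0 <= p.1 - p.2)) ?subr_ge0 // mulrCA mulrC.
    rewrite ler_wpM2r ?subr_ge0 //.
    apply: (@le_trans _ _ (`|C| * `|v|)); last by rewrite lerDl.
    by rewrite ler_wpM2r // ler_norm.
  by rewrite mulrC -ler_pdivlMr // ltW.
have [gg [_ _ dae]] := chain_AC_density psiAC.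
apply: measure_negligible.
  rewrite (_ : [set t | _] = (`]0, 1[%classic `&` (fun t : R => x + t *: v) @^-1` N)).
    apply: measurableI; first exact: measurable_itv.
    rewrite -[X in measurable X]setTI.
    have ml : measurable_fun (setT : set (measurableTypeR R)) (fun t : R => x + t *: v).
      apply: measurable_fun_rV => i.
      have -> : (fun p : R => (x + p *: v) ord0 i) = (fun p => x ord0 i + p * v ord0 i).
        by apply/funext => p; rewrite !mxE.
      by apply: measurable_funD; [exact: measurable_cst|exact: measurable_funM].
    exact: ml.
  by apply/seteqP; split => t /=; rewrite in_itv /=.
have : lebesgue_measure.-negligible
    (~` (fun t : R => 0 < t < 1 -> is_derive t 1 psi (gg t))) by exact: dae.
apply: negligibleS => t /= [t01 nc] H; apply: nc.
apply/cvg_ex; exists (gg t); have := derivable_cvg_seq (H t01).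
apply: cvg_trans; apply: near_eq_cvg; near=> k.
by rewrite /dquot /psi scalerDl addrA.
Unshelve. all: by end_near. Qed.

End directional_derivatives_ae.

Lemma clamp_lip {R : realType} (s t a b : R) : `|clamp s t a - clamp s t b| <= `|a - b|.
Proof.
wlog ab : a b / a <= b.
  move=> H; case: (leP a b) => [|/ltW] /H //.
  by rewrite distrC [`|b - a|]distrC.
rewrite (ler0_norm (_ : a - b <= 0)) ?subr_le0 // /clamp.
set p := Num.min a t; set q := Num.min b t.
have [pq qp] : p <= q /\ q - p <= b - a.
  by rewrite /p /q; case: (leP a t) => h1; case: (leP b t) => h2; split; lra.
by case: (leP s p) => h3; case: (leP s q) => h4; rewrite ler_norml; apply/andP; split; lra.
Qed.

Lemma open_sub_ball {R : realType} {n : nat} (c : 'rV[R]_n) (r : R) : open [set z | `|z - c| < r].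
Proof.
have -> : [set z | `|z - c| < r] = ball c r.
  by apply/seteqP; split => z; rewrite -ball_normE /ball_ /= distrC.
exact: ball_open.
Qed.

Lemma segment_ball {R : realType} {n : nat} (c x y : 'rV[R]_n) (d s : R) :
  `|x - c| < d -> `|y - c| < d ->
  0 <= s <= 1 -> `|y + s *: (x - y) - c| < d.
Proof.
move=> xc yc /andP[s0 s1].
have -> : y + s *: (x - y) - c = (1 - s) *: (y - c) + s *: (x - c).
  by apply/rowP => i; rewrite !mxE; ring.
apply: (le_lt_trans (ler_normD _ _)); rewrite !normrZ.
rewrite (ger0_norm s0) (ger0_norm (_ : 0 <= 1 - s)); last by lra.
case: (ltgtP s 0) s0 => // [s0 _|-> _]; last by rewrite subr0 mul1r mul0r addr0.
have -> : d = (1 - s) * d + s * d by ring.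
by apply: ler_ltD; [rewrite ler_wpM2l ?(ltW yc) // subr_ge0|rewrite ltr_pM2l].
Qed.

Section weak_gradient_of_lipschitz.
Context {R : realType} {n : nat}.
Local Notation mu := (@lebesgue_rV R n).
Variables (Omega K : set 'rV[R]_n).
Hypothesis Omega_bounded : bounded_set Omega.
Hypothesis Omega_open : open Omega.
Hypothesis K_compact : compact K.
Hypothesis K_convex : convex_set (K : set (convex_lmodType 'rV[R]_n)).
Hypothesis K_int0 : interior K 0.
Local Notation rho0 := (gauge (polar K)).
Variables (u : 'rV[R]_n -> R) (M : R).
Hypothesis u_cont : forall x, Omega x -> {for x, continuous u}.
Hypothesis u_bounded : forall x, Omega x -> `|u x| <= M.
Hypothesis u_rho0 : forall x y, (forall s : R, 0 <= s <= 1 -> Omega (y + s *: (x - y))) ->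
  u x - u y <= rho0 (x - y).

Let mO : measurable Omega := mOmega Omega_open.
Let ut : 'rV[R]_n -> R := u \_ Omega.

Definition dir_deriv (v x : 'rV[R]_n) : R := rlimsup (dquot ut v ^~ x).

Let utE x : Omega x -> ut x = u x.
Proof. by move=> Ox; rewrite /ut patchE mem_set. Qed.

Let ut0 x : ~ Omega x -> ut x = 0.
Proof. by move=> Ox; rewrite /ut patchE memNset. Qed.

Let mut : measurable_fun setT ut.
Proof. by apply/(measurable_restrictT _ mO); exact: open_continuous_measurable_rV. Qed.

Let ut_bounded x : `|ut x| <= `|M|.
Proof.
have [Ox|Ox] := pselect (Omega x).
  by rewrite utE // (le_trans (u_bounded Ox)) // ler_norm.
by rewrite ut0 // normr0.
Qed.

Let integrable_supp (f : 'rV[R]_n -> R) (B : R) : measurable_fun setT f ->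
  (forall x, `|f x| <= B) -> (forall x, ~ Omega x -> f x = 0) ->
  mu.-integrable setT (EFin \o f).
Proof.
move=> mf fB f0.
have <- : (EFin \o f) \_ Omega = EFin \o f.
  apply/funext => x; rewrite patchE; case: ifPn => // xO /=.
  by rewrite f0 // => Ox; case/negP: xO; rewrite inE.
rewrite -integrable_mkcond //.
apply: (@integrable_Linfty _ _ _ Omega_bounded Omega_open f).
split; first exact: measurable_funTS.
by exists B; apply: aeW => x _; exact: fB.
Qed.

Let dquot_bounds (v x : 'rV[R]_n) (d : R) (k : nat) :
  (forall z, `|z - x| < d -> Omega z) -> `|k.+1%:R^-1 *: v| < d -> 0 < d ->
  - rho0 (- v) <= dquot ut v k x <= rho0 v.
Proof.
move=> xO kv d0; set a := k.+1%:R^-1 *: v.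
have Ox : Omega x by apply: xO; rewrite subrr normr0.
have xa : `|x + a - x| < d by rewrite [x + a]addrC addrK.
have xx : `|x - x| < d by rewrite subrr normr0.
have h1 : u (x + a) - u x <= rho0 a.
  have := @u_rho0 (x + a) x; rewrite [x + a - x]addrAC subrr add0r; apply => s s01.
  by apply: xO; have := segment_ball xa xx s01; rewrite [x + a - x]addrAC subrr add0r.
have h2 : u x - u (x + a) <= rho0 (- a).
  have := @u_rho0 x (x + a); rewrite opprD addrA subrr add0r; apply => s s01.
  by apply: xO; have := segment_ball xx xa s01; rewrite opprD addrA subrr add0r.
have k0 : 0 <= k.+1%:R^-1 :> R by rewrite invr_ge0.
rewrite /dquot !utE //; last exact: xO.
rewrite -/a; apply/andP; split; last first.
  by rewrite -ler_pdivlMl //; move: h1; rewrite /a rho0Z.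
rewrite -scalerN rho0Z // in h2.
rewrite lerNl -mulrN opprB -ler_pdivlMl //.
Qed.

Let kbound (v : 'rV[R]_n) (d : R) (k : nat) : 0 < d ->
  (Num.truncn (`|v| / d) <= k)%N -> `|k.+1%:R^-1 *: v| < d.
Proof.
move=> d0 kk; rewrite normrZ ger0_norm ?invr_ge0 // mulrC ltr_pdivrMr // mulrC.
rewrite -ltr_pdivrMr //; apply: (lt_le_trans (truncnS_gt _)).
by rewrite ler_nat ltnS.
Qed.

Let Omega_margin x : Omega x -> exists2 d : R, 0 < d & forall z, `|z - x| < d -> Omega z.
Proof.
move=> Ox; have /nbhs_ballP[d /= d0 dO] : nbhs x Omega by exact: open_nbhs_nbhs.
by exists d => // z zx; apply: dO; rewrite -ball_normE /ball_ /= distrC.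
Qed.

Lemma dir_deriv_bounds v x : Omega x -> - rho0 (- v) <= dir_deriv v x <= rho0 v.
Proof.
move=> /Omega_margin[d d0 dO].
apply: (@rlimsup_bounds _ _ _ _ (Num.truncn (`|v| / d))) => k kk.
by apply: (dquot_bounds dO) => //; exact: kbound.
Qed.

Lemma measurable_dir_deriv v : measurable_fun setT (dir_deriv v).
Proof. by apply: measurable_rlimsup => k; exact: measurable_dquot. Qed.

(** The statement is local. Composing with the projection onto a small cube makes
    [u] globally Lipschitz and leaves it unchanged near the centre of the cube. *)
Lemma dir_deriv_ae v : {ae mu, forall x, Omega x -> dquot ut v ^~ x @ \oo --> dir_deriv v x}.
Proof.
have H : mu.-negligible ([set x | ~ cvg (dquot ut v ^~ x @ \oo)] `&` Omega).
  apply: negligible_local => x Ox; have [d d0 dO] := Omega_margin Ox.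
  pose r := d / 2; have r0 : 0 < r by rewrite divr_gt0.
  pose cl (z : 'rV[R]_n) : 'rV[R]_n :=
    \row_i clamp (x ord0 i - r) (x ord0 i + r) (z ord0 i).
  have xr i : x ord0 i - r <= x ord0 i + r by lra.
  have clid z : `|z - x| < r -> cl z = z.
    move=> zx; apply/rowP => i; rewrite mxE clamp_id //;
    by have := le_lt_trans (norm_coord (z - x) i) zx; rewrite !mxE ltr_norml => /andP[]; lra.
  have clx z : `|cl z - x| < d.
    apply: (@le_lt_trans _ _ r); last by rewrite /r; lra.
    apply: norm_rV_le; first exact: ltW.
    move=> i; rewrite !mxE /clamp; case: (leP (z ord0 i) (x ord0 i + r)) => h1;
      [case: (leP (x ord0 i - r) (z ord0 i)) => h2|case: (leP (x ord0 i - r) (x ord0 i + r)) => h2];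
      rewrite ler_norml; apply/andP; split; lra.
  have cll z z' : `|cl z - cl z'| <= `|z - z'|.
    apply: norm_rV_le => // i; apply: le_trans (norm_coord (z - z') i).
    by rewrite !mxE; exact: clamp_lip.
  pose w z := u (cl z); have [C C0 HC] := rho0_le_norm K_compact K_int0.
  have clO z z' : u (cl z) - u (cl z') <= C * `|z - z'|.
    apply: (@le_trans _ _ (rho0 (cl z - cl z'))).
      by apply: u_rho0 => s s01; apply: dO; exact: segment_ball.
    apply: (le_trans (HC _)); rewrite ler_pM2l //.
  have wC z z' : `|w z - w z'| <= C * `|z - z'|.
    rewrite ler_norml clO andbT lerNl opprB [`|z - z'|]distrC; exact: clO.
  exists [set z | `|z - x| < r]; split; first exact: open_sub_ball.
    by rewrite /= subrr normr0.
  apply: negligibleS (lipschitz_dquot_cvg v wC) => z /= [nc zr] wc; apply: nc.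
  have e0 : 0 < r - `|z - x| by rewrite subr_gt0.
  move/cvg_ex: wc => [l wl]; apply/cvg_ex; exists l; move: wl.
  apply: cvg_trans; apply: near_eq_cvg; near=> k.
  have zk : `|z + k.+1%:R^-1 *: v - x| < r.
    rewrite addrAC; apply: (le_lt_trans (ler_normD _ _)); rewrite -ltrBrDl.
    apply: kbound => //; near: k; exact: nbhs_infty_ge.
  by rewrite /dquot /w !clid // !utE //; apply: dO; apply: (lt_trans (_ : _ < r));
    rewrite // /r; lra.
have : mu.-negligible (~` (fun x => Omega x -> cvg (dquot ut v ^~ x @ \oo))).
  apply: negligibleS H => x /=.
  have [Ox|Ox] := pselect (Omega x); last by move=> h; exfalso; apply: h => /Ox.
  by move=> h; split => // c; apply: h.
move=> H'; apply: (@negligibleS _ _ _ mu _ _ _ H') => x /= h h'; apply: h => Ox.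
by have /cvg_ex[l cl] := h' Ox; rewrite /dir_deriv (rlimsup_cvg cl).
Unshelve. all: by end_near. Qed.

Lemma dir_deriv_bounded v : exists2 B : R, 0 <= B & forall x, Omega x -> `|dir_deriv v x| <= B.
Proof.
exists (rho0 v + rho0 (- v)); first by rewrite addr_ge0 // rho0_ge0.
move=> x /(dir_deriv_bounds v) /andP[h1 h2].
have := rho0_ge0 K_compact K_int0 v; have := rho0_ge0 K_compact K_int0 (- v).
by move=> h3 h4; rewrite ler_norml; apply/andP; split; lra.
Qed.

Let test_gradient_bounded eta (v : 'rV[R]_n) : test_function Omega eta ->
  exists2 C : R, 0 < C & forall x, `|\sum_i v ord0 i * partial i eta x| <= C.
Proof.
move=> te; have H i : exists C : R, 0 < C /\ forall x, `|partial i eta x| <= C.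
  by have [C C0 HC] := test_partial_bounded i te; exists C.
have [B HB] := choice H; exists (1 + \sum_i `|v ord0 i| * B i).
  by rewrite ltr_pwDl // sumr_ge0 // => i _; rewrite mulr_ge0 // ltW //; case: (HB i).
move=> x; apply: (le_trans (ler_norm_sum _ _ _)).
apply: (@le_trans _ _ (\sum_i `|v ord0 i| * B i)); last by rewrite lerDr.
by apply: ler_sum => i _; rewrite normrM ler_wpM2l //; case: (HB i) => _; apply.
Qed.

Let test_dquot_bounded eta (v : 'rV[R]_n) : test_function Omega eta ->
  exists2 C : R, 0 < C & forall k x, `|dquot eta v k x| <= C.
Proof.
move=> te; have [C C0 HC] := test_gradient_bounded v te; exists C => // k x.
pose F (t : R) := eta (x + t *: v).
have [c _ Fc] := @mvt_from0 _ F (fun t => \sum_i v ord0 i * partial i eta (x + t *: v))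
  k.+1%:R^-1 (fun t _ => is_derive_line_at (test_is_derive (x + t *: v) v te)).
move: Fc; rewrite /F scale0r addr0 /dquot => ->.
by rewrite mulrCA mulfV // mulr1.
Qed.

Let test_dquot_cvg eta v x : test_function Omega eta ->
  dquot eta v ^~ x @ \oo --> \sum_i v ord0 i * partial i eta x.
Proof.
move=> te; have := derivable_cvg_seq ((is_derive_line _ _ _ _).2 (test_is_derive x v te)).
by rewrite scale0r addr0; under eq_fun do rewrite add0r.
Qed.

Let RintegralT (h : 'rV[R]_n -> R) : (forall x, ~ Omega x -> h x = 0) ->
  \int[mu]_(x in setT) h x = \int[mu]_(x in Omega) h x.
Proof.
move=> h0; rewrite [RHS]Rintegral_mkcond; congr (Rintegral _ _ _).
apply/funext => x; rewrite patchE; case: ifPn => // xO.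
by apply: h0 => Ox; case/negP: xO; rewrite inE.
Qed.

Let test_out eta x : test_function Omega eta -> ~ Omega x -> eta x = 0.
Proof. by case=> _ _ sO Ox; apply: supp_out => /sO. Qed.

(** Translation invariance moves the difference quotient from [u] to the test
    function. *)
Let discrete_ibp eta v k : test_function Omega eta ->
  \int[mu]_(x in Omega) (ut x * dquot eta (- v) k x) =
  \int[mu]_(x in Omega) (dquot ut v k x * eta x).
Proof.
move=> te; have [Ce Ce0 HCe] := test_bounded te.
have me : measurable_fun setT eta.
  exact: continuous_measurable_rV (test_continuous te).
set c : R := k.+1%:R; set a := c^-1 *: v.
have msh (w : 'rV[R]_n -> R) (b : 'rV[R]_n) :
    measurable_fun setT w -> measurable_fun setT (fun x : 'rV[R]_n => w (x + b)).
  move=> mw.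
  by apply: (@measurableT_comp _ _ _ _ _ _ w) => //; exact: measurable_shift.
have i1 : mu.-integrable setT (EFin \o (fun x : 'rV[R]_n => ut x * eta (x - a))).
  apply: (@integrable_supp _ (`|M| * Ce)).
  - by apply: measurable_funM => //; exact: msh.
  - by move=> x; rewrite normrM ler_pM.
  - by move=> x Ox; rewrite ut0 // mul0r.
have i2 : mu.-integrable setT (EFin \o (fun x : 'rV[R]_n => ut (x + a) * eta x)).
  apply: (@integrable_supp _ (`|M| * Ce)).
  - by apply: measurable_funM => //; exact: msh.
  - by move=> x; rewrite normrM ler_pM.
  - by move=> x Ox; rewrite (test_out te) // mulr0.
have i3 : mu.-integrable setT (EFin \o (fun x : 'rV[R]_n => ut x * eta x)).
  apply: (@integrable_supp _ (`|M| * Ce)).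
  - exact: measurable_funM.
  - by move=> x; rewrite normrM ler_pM.
  - by move=> x Ox; rewrite ut0 // mul0r.
rewrite -RintegralT; last by move=> x Ox; rewrite ut0 // mul0r.
rewrite -RintegralT; last by move=> x Ox; rewrite (test_out te) // mulr0.
transitivity (c * (\int[mu]_(x in setT) (ut x * eta (x - a)) -
                   \int[mu]_(x in setT) (ut x * eta x))).
  rewrite -RintegralB // -RintegralZl //; last exact: (integrableB _ i1 i3).
  by apply: eq_Rintegral => x _; rewrite /dquot scalerN -/c -/a; ring.
transitivity (c * (\int[mu]_(x in setT) (ut (x + a) * eta x) -
                   \int[mu]_(x in setT) (ut x * eta x))); last first.
  rewrite -RintegralB // -RintegralZl //; last exact: (integrableB _ i2 i3).
  by apply: eq_Rintegral => x _; rewrite /dquot -/c -/a; ring.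
congr (c * (_ - _)); rewrite /Rintegral; congr fine.
rewrite -(@integral_shift _ _ a); last first.
  by apply/measurable_EFinP; apply: measurable_funM => //; exact: msh.
by apply: eq_integral => x _; rewrite addrK.
Qed.

(** Dominated convergence in [discrete_ibp], on both sides. *)
Lemma dir_deriv_ibp eta (v : 'rV[R]_n) : test_function Omega eta ->
  \int[mu]_(x in Omega) (u x * \sum_i v ord0 i * partial i eta x) =
  - \int[mu]_(x in Omega) (dir_deriv v x * eta x).
Proof.
move=> te; have [Ce Ce0 HCe] := test_bounded te.
have me : measurable_fun setT eta.
  exact: continuous_measurable_rV (test_continuous te).
have [C C0 HC] := test_dquot_bounded (- v) te.
have [_ cS sO] := te; have [d d0 Hd] := compact_margin cS Omega_open sO.
pose k0 := Num.truncn (`|v| / d).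
pose B := rho0 v + rho0 (- v).
have B0 : 0 <= B by rewrite addr_ge0 // rho0_ge0.
have ic (c : R) : mu.-integrable Omega (EFin \o cst c).
  apply: (@integrable_Linfty _ _ _ Omega_bounded Omega_open (cst c)); split => //.
  by exists `|c|; apply: aeW.
have mp : measurable_fun setT (fun x : 'rV[R]_n => \sum_i (- v) ord0 i * partial i eta x).
  apply: measurable_sum => i; apply: measurable_funM => //.
  exact: continuous_measurable_rV (@test_partial_continuous _ _ _ _ i te).
have L1 : \int[mu]_(x in Omega) (ut x * dquot eta (- v) (k + k0)%N x) @[k --> \oo] -->
    \int[mu]_(x in Omega) (ut x * \sum_i (- v) ord0 i * partial i eta x).
  apply: (dominated_Rintegral (f := fun k (x : 'rV[R]_n) => ut x * dquot eta (- v) (k + k0)%N x)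
    (h := fun x : 'rV[R]_n => ut x * \sum_i (- v) ord0 i * partial i eta x)
    (g := cst (`|M| * C))) => //.
  - move=> k; apply: measurable_funTS; apply: measurable_funM => //.
    exact: measurable_dquot.
  - by apply: measurable_funTS; exact: measurable_funM.
  - apply: aeW => x Ox; apply: cvgMr; have := @test_dquot_cvg eta (- v) x te.
    by rewrite -(cvg_shiftn k0).
  - by move=> k x _; rewrite normrM ler_pM.
have L2 : \int[mu]_(x in Omega) (dquot ut v (k + k0)%N x * eta x) @[k --> \oo] -->
    \int[mu]_(x in Omega) (dir_deriv v x * eta x).
  apply: (dominated_Rintegral (f := fun k (x : 'rV[R]_n) => dquot ut v (k + k0)%N x * eta x)
    (h := fun x : 'rV[R]_n => dir_deriv v x * eta x) (g := cst (B * Ce))) => //.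
  - move=> k; apply: measurable_funTS; apply: measurable_funM => //.
    exact: measurable_dquot.
  - by apply: measurable_funTS; apply: measurable_funM => //; exact: measurable_dir_deriv.
  - apply: filterS (dir_deriv_ae v) => x H Ox; apply: cvgMl.
    by have := H Ox; rewrite -(cvg_shiftn k0).
  - move=> k x _; have [Sx|Sx] := pselect (supp eta x); last first.
      by rewrite (supp_out Sx) mulr0 normr0 mulr_ge0 // ltW.
    rewrite normrM ler_pM //.
    have /andP[h1 h2] : - rho0 (- v) <= dquot ut v (k + k0)%N x <= rho0 v.
      by apply: (dquot_bounds (Hd _ Sx)) => //; apply: kbound => //; exact: leq_addl.
    have := rho0_ge0 K_compact K_int0 v; have := rho0_ge0 K_compact K_int0 (- v).
    by move=> h3 h4; rewrite ler_norml /B; apply/andP; split; lra.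
have E : (fun k => \int[mu]_(x in Omega) (ut x * dquot eta (- v) (k + k0)%N x)) =
    (fun k => \int[mu]_(x in Omega) (dquot ut v (k + k0)%N x * eta x)).
  by apply/funext => k; exact: discrete_ibp.
rewrite E in L1; rewrite -(cvg_unique _ L1 L2) //.
rewrite (_ : (fun x : 'rV[R]_n => ut x * _) = (fun x => -1 * (ut x * \sum_i v ord0 i * partial i eta x))); last first.
  apply/funext => x; rewrite mulN1r -mulrN -sumrN; congr (_ * _).
  by apply: eq_bigr => i _; rewrite mxE mulNr.
rewrite RintegralZl //; last first.
  have [C' C'0 HC'] := test_gradient_bounded v te.
  apply: integrableS (@integrable_supp (fun x => ut x * \sum_i v ord0 i * partial i eta x)
    (`|M| * C') _ _ _) => //.
  - apply: measurable_funM => //.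
    apply: measurable_sum => i; apply: measurable_funM => //.
    exact: continuous_measurable_rV (@test_partial_continuous _ _ _ _ i te).
  - by move=> x; rewrite normrM ler_pM.
  - by move=> x Ox; rewrite ut0 // mul0r.
rewrite mulN1r opprK; apply: eq_Rintegral => x; rewrite inE => Ox; by rewrite utE.
Qed.

End weak_gradient_of_lipschitz.

Section density_measure.
Context d (T : measurableType d) (R : realType) (mu : {measure set T -> \bar R}).
Variable F : T -> \bar R.
Hypothesis mF : measurable_fun setT F.
Hypothesis F0 : forall x, (0 <= F x)%E.

Definition density_measure of measurable_fun setT F & (forall x, (0 <= F x)%E) :=
  fun A : set T => (\int[mu]_(x in A) F x)%E.

Let density0 : density_measure mF F0 set0 = 0%E.
Proof. by rewrite /density_measure integral_set0. Qed.

Let density_ge0 A : (0 <= density_measure mF F0 A)%E.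
Proof. by apply: integral_ge0 => x _; exact: F0. Qed.

Let density_additive : semi_sigma_additive (density_measure mF F0).
Proof. exact: semi_sigma_additive_nng_induced. Qed.

HB.instance Definition _ := isMeasure.Build _ _ _ (density_measure mF F0)
  density0 density_ge0 density_additive.

End density_measure.

Section vanishing_on_boxes.
Context {R : realType} {n : nat}.
Local Notation mu := (@lebesgue_rV R n).
Variables (Omega : set 'rV[R]_n).
Hypothesis Omega_bounded : bounded_set Omega.
Hypothesis Omega_open : open Omega.

Lemma bounded_integrable (h : 'rV[R]_n -> R) (B : R) : measurable_fun Omega h ->
  (forall x, Omega x -> `|h x| <= B) -> mu.-integrable Omega (EFin \o h).
Proof.
move=> mh hB; apply: (@integrable_Linfty _ _ _ Omega_bounded Omega_open); split => //.
by exists B; apply: aeW => x; exact: hB.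
Qed.

(** If [B] bounds [|h|], then [B + h] and [B] are nonnegative densities with the same
    integral on every box, hence the densities of the same measure. *)
Lemma ae0_on_boxes (h : 'rV[R]_n -> R) (B : R) : measurable_fun setT h ->
  (forall x, Omega x -> `|h x| <= B) ->
  (forall a b, cbox a b `<=` Omega ->
    \int[mu]_(x in Omega) (h x * \1_(rV_box a b) x) = 0) ->
  {ae mu, forall x, Omega x -> h x = 0}.
Proof.
move=> mh hB h0; have mO := mOmega Omega_open.
suff : mu.-negligible (~` [set x | h x = 0] `&` Omega).
  apply: negligibleS => x /= hx; have [Ox|Ox] := pselect (Omega x).
    by split => // h1; apply: hx.
  by exfalso; apply: hx => /Ox.
apply: negligible_local => c Oc.
have [d /= d0 dO] : nbhs_ball c Omega by apply/nbhs_ballP; exact: open_nbhs_nbhs.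
pose r := d / 2; have r0 : 0 < r by rewrite divr_gt0.
pose a i := c ord0 i - r; pose b i := c ord0 i + r.
have abO : cbox a b `<=` Omega.
  move=> x xab; apply: dO; rewrite -ball_normE /ball_ /= distrC.
  apply: (@le_lt_trans _ _ r); last by rewrite /r; lra.
  apply: norm_rV_le; first exact: ltW.
  move=> i; have /andP[h1 h2] := xab i; rewrite !mxE ler_norml.
  by move: h1 h2; rewrite /a /b => h1 h2; apply/andP; split; lra.
pose Q := rV_box a b; have mQ : measurable Q := measurable_rV_box a b.
have QO : Q `<=` Omega by apply: subset_trans abO; exact: rV_box_cbox.
have B0 : 0 <= B by apply: le_trans (hB c Oc).
have indE (A : set 'rV[R]_n) x : A x -> \1_A x = 1 :> R by move=> Ax; rewrite indicE mem_set.
have indN (A : set 'rV[R]_n) x : ~ A x -> \1_A x = 0 :> R by move=> Ax; rewrite indicE memNset.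
pose F1 x : \bar R := ((B + h x) * \1_Q x)%:E.
pose F2 x : \bar R := (B * \1_Q x)%:E.
have mI A : measurable A -> measurable_fun setT (\1_A : 'rV[R]_n -> R).
  by move=> mA; exact: measurable_indic.
have mF1 : measurable_fun setT F1.
  apply/measurable_EFinP; apply: measurable_funM; last exact: mI.
  by apply: measurable_funD => //; exact: measurable_cst.
have mF2 : measurable_fun setT F2.
  by apply/measurable_EFinP; apply: measurable_funM; [exact: measurable_cst|exact: mI].
have F10 x : (0 <= F1 x)%E.
  rewrite lee_fin; have [Qx|Qx] := pselect (Q x); last by rewrite indN // mulr0.
  rewrite indE // mulr1; have := hB x (QO _ Qx).
  by rewrite ler_norml => /andP[h1 _]; lra.
have F20 x : (0 <= F2 x)%E by rewrite lee_fin mulr_ge0 // indicE.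
have ind_bd (A : set 'rV[R]_n) x : `|\1_A x| <= 1 :> R.
  by rewrite indicE; case: (_ \in _); rewrite ?normr1 ?normr0.
have box_eq a' b' : (\int[mu]_(x in rV_box a' b') F1 x = \int[mu]_(x in rV_box a' b') F2 x)%E.
  pose a2 i := Num.max (a' i) (a i); pose b2 i := Num.min (b' i) (b i).
  have EB : rV_box a' b' `&` Q = rV_box a2 b2.
    apply/seteqP; split => x /=.
      move=> [H1 H2] i; rewrite gt_max lt_min; have := H1 i; have := H2 i.
      by move=> /andP[-> ->] /andP[-> ->].
    move=> H; split => i; have := H i; rewrite gt_max lt_min;
      by move=> /andP[/andP[h1 h2] /andP[h3 h4]]; rewrite ?h1 ?h2 ?h3 ?h4.
  have O2 : cbox a2 b2 `<=` Omega.
    move=> x xab; apply: abO => i; have := xab i; rewrite ge_max le_min.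
    by move=> /andP[/andP[h1 h2] /andP[h3 h4]]; rewrite h2 h4.
  have I2 : rV_box a2 b2 `<=` Omega by apply: subset_trans O2; exact: rV_box_cbox.
  have red (k : 'rV[R]_n -> R) : (\int[mu]_(x in rV_box a' b') (k x * \1_Q x)%:E =
      \int[mu]_(x in Omega) (k x * \1_(rV_box a2 b2) x)%:E)%E.
    rewrite [LHS]integral_mkcond [RHS]integral_mkcond; apply: eq_integral => x _.
    rewrite -EB !patchE; case: ifPn => [|] xab; case: ifPn => xO //.
    - by rewrite setIC indicI /= [\1_(rV_box _ _) x]indE ?mulr1 //; rewrite inE in xab.
    - rewrite indN ?mulr0 // => Qx; case/negP: xO; rewrite inE; exact: QO.
    - by rewrite indN ?mulr0 // => -[Bx _]; case/negP: xab; rewrite inE.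
  have mI2 : measurable_fun Omega (\1_(rV_box a2 b2) : 'rV[R]_n -> R).
    by apply: measurable_funTS; apply: mI; exact: measurable_rV_box.
  have i1 : mu.-integrable Omega (EFin \o (fun x => B * \1_(rV_box a2 b2) x)).
    apply: (@bounded_integrable _ (B * 1)) => [|x _].
      by apply: measurable_funM => //; exact: measurable_cst.
    by rewrite normrM ler_pM // ger0_norm.
  have i2 : mu.-integrable Omega (EFin \o (fun x => h x * \1_(rV_box a2 b2) x)).
    apply: (@bounded_integrable _ (B * 1)) => [|x Ox].
      by apply: measurable_funM => //; exact: measurable_funTS.
    by rewrite normrM ler_pM // hB.
  rewrite /F1 /F2 !red.
  rewrite (eq_integral (fun x => (B * \1_(rV_box a2 b2) x)%:E + (h x * \1_(rV_box a2 b2) x)%:E)%E);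
    last by move=> x _; rewrite -EFinD mulrDl.
  rewrite integralD //= [X in (_ + X)%E](_ : _ = 0%E) ?adde0 //.
  have := h0 _ _ O2; rewrite /Rintegral.
  have := integrable_fin_num mO i2; rewrite /=.
  by case: (integral _ _ _) => // q _ /= ->.
pose m1 : {measure set 'rV[R]_n -> \bar R} := density_measure mu mF1 F10.
pose m2 : {measure set 'rV[R]_n -> \bar R} := density_measure mu mF2 F20.
have i2 : mu.-integrable setT F2.
  have -> : F2 = (cst B%:E \_ Q)%E.
    apply/funext => x; rewrite /F2 patchE; case: ifPn => xQ.
      by rewrite indE ?mulr1 //; rewrite inE in xQ.
    by rewrite indN ?mulr0 // => Qx; case/negP: xQ; rewrite inE.
  rewrite -integrable_mkcond //; apply/integrableP; split; first exact: measurable_cst.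
  rewrite integral_cst // lte_mul_pinfty //.
  exact: lebesgue_rV_box_lty.
have meq A : measurable A -> (\int[mu]_(x in A) F1 x = \int[mu]_(x in A) F2 x)%E.
  move=> mA; apply: (@box_measure_unique _ _ m1 m2 _ _ A mA) => //.
  move=> a' b'; rewrite [X in (X < _)%E]box_eq.
  have : mu.-integrable (rV_box a' b') F2 by apply: integrableS i2 => //; exact: measurable_rV_box.
  by move=> /(integrable_fin_num (measurable_rV_box a' b')); rewrite ltey_eq => ->.
exists Q; split; [exact: open_rV_box|by move=> i; rewrite /a /b; apply/andP; split; lra|].
have [N [mN N0 HN]] := @integral_ae_eq _ _ _ mu setT measurableT F1 F2 i2 mF1
  (fun E _ mE => esym (meq E mE)).
exists N; split => // x /= [hx Qx]; apply: HN => /= H; apply: hx.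
move: (H I); rewrite /F1 /F2 indE // !mulr1 => -[]; lra.
Qed.

End vanishing_on_boxes.

Section lipschitz_gradient.
Context {R : realType} {n : nat}.
Local Notation mu := (@lebesgue_rV R n).
Variables (Omega K : set 'rV[R]_n).
Hypothesis Omega_bounded : bounded_set Omega.
Hypothesis Omega_open : open Omega.
Hypothesis K_compact : compact K.
Hypothesis K_convex : convex_set (K : set (convex_lmodType 'rV[R]_n)).
Hypothesis K_int0 : interior K 0.
Local Notation rho0 := (gauge (polar K)).
Variables (u : 'rV[R]_n -> R) (M : R).
Hypothesis u_cont : forall x, Omega x -> {for x, continuous u}.
Hypothesis u_bounded : forall x, Omega x -> `|u x| <= M.
Hypothesis u_rho0 : forall x y, (forall s : R, 0 <= s <= 1 -> Omega (y + s *: (x - y))) ->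
  u x - u y <= rho0 (x - y).

Let mO : measurable Omega := mOmega Omega_open.
Let dd := dir_deriv Omega u.
Let g (x : 'rV[R]_n) : 'rV[R]_n := \row_i dd (delta_mx ord0 i) x.

Let mdd v : measurable_fun setT (dd v) := measurable_dir_deriv Omega_open u_cont v.

Let bdd v : exists2 B : R, 0 <= B & forall x, Omega x -> `|dd v x| <= B :=
  dir_deriv_bounded Omega_open K_compact K_int0 u_rho0 v.

Let ibp := dir_deriv_ibp Omega_bounded Omega_open K_compact K_int0 u_cont u_bounded u_rho0.

Let gradient_weak : weak_gradient Omega u g.
Proof.
move=> eta te i; have := ibp (delta_mx ord0 i) te.
rewrite (_ : (fun x => g x ord0 i * eta x) = (fun x => dd (delta_mx ord0 i) x * eta x)); last first.
  by apply/funext => x; rewrite mxE.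
move=> <-; apply: eq_Rintegral => x _; congr (_ * _).
rewrite (bigD1 i) //= big1 ?addr0 => [|j ji]; first by rewrite mxE !eqxx mul1r.
by rewrite mxE (negbTE ji) andbF mul0r.
Qed.

(** Both sides have the same integral against every test function, and bumps
    converge to the indicator functions of boxes. *)
Let dotmul_gradient v : {ae mu, forall x, Omega x -> dotmul (g x) v = dd v x}.
Proof.
pose h x := \sum_i v ord0 i * dd (delta_mx ord0 i) x - dd v x.
have mS : measurable_fun setT (fun x => \sum_i v ord0 i * dd (delta_mx ord0 i) x).
  by apply: measurable_sum => i; apply: measurable_funM => //; exact: mdd.
have mh : measurable_fun setT h by apply: measurable_funB => //; exact: mdd.
have [B hB] : exists B : R, forall x, Omega x -> `|h x| <= B.
  have H i : exists C : R, forall x, Omega x -> `|dd (delta_mx ord0 i) x| <= C.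
    by have [C _ HC] := bdd (delta_mx ord0 i); exists C.
  have [C HC] := choice H; have [C' _ HC'] := bdd v.
  exists (\sum_i `|v ord0 i| * C i + C') => x Ox.
  apply: (le_trans (ler_normB _ _)); apply: lerD; last exact: HC'.
  apply: (le_trans (ler_norm_sum _ _ _)); apply: ler_sum => i _.
  by rewrite normrM ler_wpM2l // HC.
have h_test eta : test_function Omega eta -> \int[mu]_(x in Omega) (h x * eta x) = 0.
  move=> te; have [Ce Ce0 HCe] := test_bounded te.
  have me : measurable_fun setT eta := continuous_measurable_rV (test_continuous te).
  have ide w : mu.-integrable Omega (EFin \o (fun x => dd w x * eta x)).
    have [C C0 HC] := bdd w.
    apply: (@bounded_integrable _ _ _ Omega_bounded Omega_open _ (C * Ce)) => [|x Ox].
      by apply: measurable_funTS; apply: measurable_funM => //; exact: mdd.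
    by rewrite normrM ler_pM // HC.
  have iue i : mu.-integrable Omega (EFin \o (fun x => u x * partial i eta x)).
    have [C C0 HC] := test_partial_bounded i te.
    apply: (@bounded_integrable _ _ _ Omega_bounded Omega_open _ (M * C)) => [|x Ox].
      apply: measurable_funM; first exact: open_continuous_measurable_rV.
      apply: measurable_funTS.
      exact: continuous_measurable_rV (@test_partial_continuous _ _ _ _ i te).
    by rewrite normrM ler_pM // u_bounded.
  have [_ E1] := Rintegral_lincomb (fun i => v ord0 i) mO iue.
  have [I2 E2] := Rintegral_lincomb (fun i => v ord0 i) mO (fun i => ide (delta_mx ord0 i)).
  transitivity (\int[mu]_(x in Omega) (\sum_i v ord0 i * (dd (delta_mx ord0 i) x * eta x)) -
      \int[mu]_(x in Omega) (dd v x * eta x)).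
    rewrite -RintegralB //; apply: eq_Rintegral => x _.
    rewrite /h mulrBl mulr_suml; congr (_ - _); apply: eq_bigr => i _; by rewrite mulrA.
  rewrite E2 -[X in _ - X]opprK -(ibp v te) opprK.
  rewrite (_ : \int[mu]_(x in Omega) (u x * \sum_i v ord0 i * partial i eta x) =
    \int[mu]_(x in Omega) (\sum_i v ord0 i * (u x * partial i eta x))); last first.
    by apply: eq_Rintegral => x _; rewrite mulr_sumr; apply: eq_bigr => i _; ring.
  rewrite E1 -big_split /= big1 // => i _; rewrite -mulrDr (gradient_weak te i).
  rewrite (_ : (fun x => g x ord0 i * eta x) = (fun x => dd (delta_mx ord0 i) x * eta x)); last first.
    by apply/funext => x; rewrite mxE.
  by rewrite addrN mulr0.
have h_box a b : cbox a b `<=` Omega ->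
    \int[mu]_(x in Omega) (h x * \1_(rV_box a b) x) = 0.
  move=> abO.
  have tb k : test_function Omega (bump k.+1%:R a b) by exact: test_function_bump.
  have L : \int[mu]_(x in Omega) (h x * bump k.+1%:R a b x) @[k --> \oo] -->
      \int[mu]_(x in Omega) (h x * \1_(rV_box a b) x).
    apply: (dominated_Rintegral (f := fun k (x : 'rV[R]_n) => h x * bump k.+1%:R a b x)
      (h := fun x : 'rV[R]_n => h x * \1_(rV_box a b) x) (g := cst B)) => //.
    - move=> k; apply: measurable_funTS; apply: measurable_funM => //.
      exact: continuous_measurable_rV (test_continuous (tb k)).
    - apply: measurable_funTS; apply: measurable_funM => //.
      by apply: measurable_indic; exact: measurable_rV_box.
    - apply: (@bounded_integrable _ _ _ Omega_bounded Omega_open _ `|B|) => //.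
    - by apply: aeW => x Ox; apply: cvgMr; exact: cvg_bump.
    - move=> k x Ox; rewrite normrM -[leRHS]mulr1 ler_pM // ?hB //.
      by rewrite ger0_norm ?bump_ge0 // bump_le1.
  rewrite (_ : (fun k => _) = cst 0) in L; last by apply/funext => k; exact: h_test.
  by apply: (cvg_unique _ L) => //; exact: cvg_cst.
apply: filterS (ae0_on_boxes Omega_bounded Omega_open mh hB h_box) => x H Ox.
move/eqP: (H Ox); rewrite /h subr_eq0 => /eqP <-.
by apply: eq_bigr => i _; rewrite mxE mulrC.
Qed.

(** The exceptional sets of the rational directions are countably many; all other
    directions follow by continuity, and [g x] lies in [K] by separation. *)
Let gradient_in_K : {ae mu, forall x, Omega x -> K (g x)}.
Proof.
pose vq (q : {ffun 'I_n -> rat}) : 'rV[R]_n := \row_i ratr (q i).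
have : {ae mu, forall x, forall k : nat,
    if unpickle k is Some q then Omega x -> dotmul (g x) (vq q) = dd (vq q) x else True}.
  apply/ae_foralln => k; case: (unpickle k) => [q|]; first exact: dotmul_gradient.
  exact: aeW.
apply: filterS => x H Ox.
apply: (support_separation K_compact K_convex K_int0) => v; rewrite leNgt; apply/negP => lt.
pose m := (dotmul (g x) v + rho0 v) / 2.
have : \forall w \near v, m < dotmul (g x) w /\ rho0 w < m.
  near=> w; split; near: w.
    by apply: (cvgr_gt (dotmul (g x) v)); [exact: continuous_dotmul|rewrite /m; lra].
  by apply: (cvgr_lt (rho0 v)); [exact: (continuous_rho0 K_compact K_int0)|rewrite /m; lra].
move=> /nbhs_ballP[e /= e0 He].
have Hq i : exists q : rat, v ord0 i - e / 2 < ratr q < v ord0 i + e / 2.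
  have [|q] := @rat_in_itvoo R (v ord0 i - e / 2) (v ord0 i + e / 2).
    have : 0 < e / 2 by rewrite divr_gt0.
    lra.
  by rewrite in_itv /=; exists q.
have [q qv] := choice Hq; have := He (vq [ffun i => q i]).
have bq : ball v e (vq [ffun i => q i]).
  rewrite -ball_normE /ball_ /= distrC; apply: (@le_lt_trans _ _ (e / 2)); last by lra.
  apply: norm_rV_le; first by rewrite divr_ge0 // ltW.
  move=> i; have /andP[h1 h2] := qv i; rewrite !mxE ffunE ler_norml; apply/andP; split; lra.
move=> /(_ bq) [h1 h2]; have := lt_trans h2 h1; rewrite ltNge => /negP; apply.
have := H (pickle [ffun i => q i]); rewrite pickleK => ->//.
by have /andP[] := dir_deriv_bounds Omega_open K_compact K_int0 u_rho0 (vq [ffun i => q i]) Ox.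
Unshelve. all: by end_near. Qed.

Lemma lipschitz_weak_gradient : exists g, W1infty Omega u g /\
  {ae mu, forall x, Omega x -> K (g x)}.
Proof.
exists g; split; last exact: gradient_in_K.
split; last exact: gradient_weak.
- split; first exact: open_continuous_measurable_rV.
  by exists M; apply: aeW => x; exact: u_bounded.
- move=> i; have [B _ HB] := bdd (delta_mx ord0 i).
  rewrite (_ : (fun x => g x ord0 i) = dd (delta_mx ord0 i)); last first.
    by apply/funext => x; rewrite mxE.
  split; first by apply: measurable_funTS; exact: mdd.
  by exists B; apply: aeW => x; exact: HB.
Qed.

End lipschitz_gradient.

(** * Admissible functions along curves *)

Section one_variable.
Context {R : realType}.

(** The supremum of the times [r] with [Phi s <= Phi r] can only be [t]. *)
Lemma local_to_global_monotone (Phi : R -> R) (s t : R) : s <= t ->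
  (forall r, s <= r <= t -> exists2 e : R, 0 < e &
    forall r', s <= r' <= t -> `|r' - r| < e ->
      (r' <= r -> Phi r' <= Phi r) /\ (r <= r' -> Phi r <= Phi r')) ->
  Phi s <= Phi t.
Proof.
move=> st H; pose A := [set r | s <= r <= t /\ Phi s <= Phi r].
have As : A s by split => //; rewrite lexx st.
have uA : ubound A t by move=> r [/andP[_ rt] _].
have hA : has_sup A by split; [exists s|exists t].
pose c := sup A.
have sc : s <= c by apply: ub_le_sup => //; exists t.
have ct : c <= t by apply: ge_sup => //; exists s.
have cst : s <= c <= t by rewrite sc ct.
have [e e0 He] := H c cst.
have [r [/andP[sr rt] Pr] rc] := sup_adherent e0 hA.
have rc' : r <= c by apply: ub_le_sup; [exists t|split => //; rewrite sr rt].
have Pc : Phi s <= Phi c.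
  apply: (le_trans Pr); apply: (He r _ _).1 => //; first by rewrite sr rt.
  by rewrite ler0_norm ?subr_le0 //; move: rc; rewrite -/c; lra.
have [tc|tc] := leP t c; first by have -> : t = c by apply/eqP; rewrite eq_le tc ct.
pose r2 := Num.min (c + e / 2) t.
have r2c : c < r2 by rewrite /r2 lt_min tc andbT; lra.
have r2t : r2 <= t by rewrite /r2 ge_min lexx orbT.
have r2e : r2 <= c + e / 2 by rewrite /r2 ge_min lexx.
suff : r2 <= c by rewrite leNgt r2c.
apply: ub_le_sup; first by exists t.
split; first by rewrite r2t (le_trans sc (ltW r2c)).
apply: (le_trans Pc); apply: (He r2 _ _).2; [|by rewrite gtr0_norm ?subr_gt0 //; lra|exact: ltW].
by rewrite r2t (le_trans sc (ltW r2c)).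
Qed.

Context {n : nat}.

Lemma first_exit (Omega : set 'rV[R]_n) (c : R -> 'rV[R]_n) (s t : R) : open Omega -> s <= t ->
  (forall r, s <= r <= t -> forall e : R, 0 < e -> exists2 d : R, 0 < d &
    forall r', s <= r' <= t -> `|r' - r| < d -> `|c r' - c r| < e) ->
  ~ Omega (c t) ->
  exists r, [/\ s <= r <= t, ~ Omega (c r) & forall r', s <= r' -> r' < r -> Omega (c r')].
Proof.
move=> oO st cc nt; pose B := [set r | s <= r <= t /\ ~ Omega (c r)].
have Bt : B t by split => //; rewrite lexx st.
have lB : lbound B s by move=> r [/andP[]].
have hB : has_inf B by split; [exists t|exists s].
pose r := inf B.
have sr : s <= r by apply: lb_le_inf => //; exists t.
have rt : r <= t by apply: ge_inf => //; exists s.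
have srt : s <= r <= t by rewrite sr rt.
exists r; split => //; last first.
  move=> r' sr' rr'; apply: contrapT => no.
  have : r <= r'; last by rewrite leNgt rr'.
  apply: ge_inf; first by exists s.
  by split => //; rewrite sr' (le_trans (ltW rr') rt).
move=> Or; have [e /= e0 eO] : nbhs_ball (c r) Omega by apply/nbhs_ballP; exact: open_nbhs_nbhs.
have [d d0 Hd] := cc r srt e e0.
have [r' [r'st nr'] r'r] := inf_adherent d0 hB.
have rr' : r <= r' by apply: ge_inf; [exists s|].
apply: nr'; apply: eO; rewrite -ball_normE /ball_ /= distrC; apply: Hd => //.
by rewrite ger0_norm ?subr_ge0 //; move: r'r; rewrite -/r; lra.
Qed.

Lemma within_continuous_eps (A : set 'rV[R]_n) (u : 'rV[R]_n -> R) :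
  {within A, continuous u} <-> (forall x, A x -> forall e : R, 0 < e -> exists2 d : R, 0 < d &
    forall y, A y -> `|y - x| < d -> `|u y - u x| <= e).
Proof.
split.
  move=> /subspace_continuousP cu x Ax e e0.
  have := cu x Ax; move=> /cvgrPdist_le /(_ e e0).
  move=> /nbhs_ballP[d /= d0 Hd]; exists d => // y Ay yx; rewrite distrC.
  by apply: Hd => //; rewrite -ball_normE /ball_ /= distrC.
move=> H; apply/subspace_continuousP => x Ax.
apply/cvgrPdist_le => e e0; have [d d0 Hd] := H x Ax e e0.
apply/nbhs_ballP; exists d => // y; rewrite -ball_normE /ball_ /= distrC => yx Ay.
by rewrite distrC; exact: Hd.
Qed.

Lemma within_continuous_itv_eps (V : R -> R) : {within `[0, 1], continuous V} ->
  (forall x, 0 <= x <= 1 -> forall e : R, 0 < e -> exists2 d : R, 0 < d &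
    forall y, 0 <= y <= 1 -> `|y - x| < d -> `|V y - V x| <= e).
Proof.
move=> /subspace_continuousP cu x Ax e e0.
have := cu x; rewrite /= in_itv /= => /(_ Ax) /cvgrPdist_le /(_ e e0).
move=> /nbhs_ballP[d /= d0 Hd]; exists d => // y Ay yx; rewrite distrC.
by apply: (Hd y); [rewrite /ball /= distrC|rewrite /= in_itv /= Ay].
Qed.

Lemma AC_cst (x : 'rV[R]_n) : absolutely_continuous01 (cst x).
Proof.
by apply: (@AC_lipschitz _ _ _ 0) => a b _ ab _; rewrite subrr normr0 mul0r.
Qed.

Variable K : set 'rV[R]_n.
Hypothesis K_compact : compact K.
Hypothesis K_int0 : interior K 0.
Local Notation rho0 := (gauge (polar K)).

Lemma length_cst (x : 'rV[R]_n) : curve_length K (cst x) = 0.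
Proof.
have [V [_ HV _ _ _]] := length_profile K_compact K_int0 (AC_cst x).
by have := HV 0 0 (lexx _) (lexx _) ler01; rewrite subrr.
Qed.

(** A straight curve that waits at [x] during the first half of the time: this
    form inherits its length from [length_profile]. *)
Definition straight (x v : 'rV[R]_n) := extend (cst x) v.

Lemma length_straight (x v : 'rV[R]_n) : curve_length K (straight x v) = rho0 v.
Proof.
have [V [_ _ _ H ->]] := length_profile K_compact K_int0 (AC_cst x).
by rewrite -H length_cst add0r.
Qed.

Lemma rho0_le_length gamma : absolutely_continuous01 gamma ->
  rho0 (gamma 1 - gamma 0) <= curve_length K gamma.
Proof.
by move=> /(length_profile K_compact K_int0)[V [_ _ H -> _]]; exact: H.
Qed.

Variable Omega : set 'rV[R]_n.

Lemma curves_cst (x : 'rV[R]_n) : closure Omega x -> curves Omega x x (cst x).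
Proof. by move=> cx; split => //; exact: AC_cst. Qed.

Lemma curves_extend (y x v : 'rV[R]_n) gamma : curves Omega y x gamma ->
  (forall s : R, 0 <= s <= 1 -> closure Omega (x + s *: v)) ->
  curves Omega y (x + v) (extend gamma v).
Proof.
move=> [gAC gO g0 g1] H; split; first exact: AC_extend.
- move=> t t01; rewrite /extend; have [h|h] := leP (2 * t) 1.
    rewrite max_r ?scale0r ?addr0; last by lra.
    by apply: gO; lra.
  by rewrite g1 max_l; [apply: H|]; lra.
- rewrite /extend mulr0 sub0r min_l ?ler01 // max_r ?scale0r ?addr0 //; lra.
- by rewrite /extend mulr1 min_r ?max_l; [rewrite g1; congr (_ + _); rewrite (_ : 2 - 1 = 1) ?scale1r //; ring| |]; lra.
Qed.

Lemma curves_straight (x v : 'rV[R]_n) :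
  (forall s : R, 0 <= s <= 1 -> closure Omega (x + s *: v)) ->
  curves Omega x (x + v) (straight x v).
Proof.
move=> H; apply: curves_extend => //; apply: curves_cst.
by have := H 0; rewrite scale0r addr0; apply; rewrite lexx ler01.
Qed.

Lemma curves_stopped (y x : 'rV[R]_n) gamma (s t : R) : curves Omega y x gamma ->
  0 <= s -> s <= t -> t <= 1 -> curves Omega (gamma s) (gamma t) (stopped s t gamma).
Proof.
move=> [gAC gO _ _] s0 st t1; split; first exact: AC_stopped.
- move=> r /andP[r0 r1]; apply: gO; have [h1 _ h2 _ _] := clampP s0 st t1 (lexx r).
  by rewrite (le_trans s0 h1) (le_trans h2 t1).
- by rewrite /stopped /= clamp_lo.
- by rewrite /stopped /= clamp_hi.
Qed.

End one_variable.

Section domain.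
Context {R : realType} {n : nat}.
Hypothesis hn : (1 <= n)%N.
Variable Omega : set 'rV[R]_n.
Hypothesis Omega_bounded : bounded_set Omega.
Hypothesis Omega_open : open Omega.

Lemma closure_eps (A : set 'rV[R]_n) x :
  (forall e : R, 0 < e -> exists2 z, A z & `|z - x| < e) -> closure A x.
Proof.
move=> H B /nbhs_ballP[e /= e0 eB]; have [z Az zx] := H e e0.
by exists z; split => //; apply: eB; rewrite -ball_normE /ball_ /= distrC.
Qed.

Lemma frontierE x : frontier Omega x <-> closure Omega x /\ ~ Omega x.
Proof. by rewrite /frontier (interior_id Omega).1. Qed.

Lemma closure_cases x : closure Omega x -> Omega x \/ frontier Omega x.
Proof.
by move=> cx; have [Ox|Ox] := pselect (Omega x); [left|right; exact/frontierE].
Qed.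

Lemma frontier_closure x : frontier Omega x -> closure Omega x.
Proof. by case. Qed.

Lemma compact_closure : compact (closure Omega).
Proof.
apply: bounded_closed_compact; last exact: closed_closure.
have [M M0 HM] := Omega_box Omega_bounded.
exists M; split; first exact: num_real.
move=> r Mr x cx; apply: contrapT => /negP; rewrite -ltNge => rx.
have e0 : 0 < `|x| - r by rewrite subr_gt0.
have [z [Oz]] := cx _ (nbhsx_ballx x (`|x| - r) e0).
rewrite -ball_normE /ball_ /= => xz.
have := HM z Oz; have := ler_dist_dist x z; rewrite ler_norml => /andP[_].
by have := ler_norm (`|x| - `|z|); have := lerB_dist x z; lra.
Qed.

Lemma compact_frontier : compact (frontier Omega).
Proof.
apply: (@subclosed_compact _ _ (closure Omega)); last by move=> x; exact: frontier_closure.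
  rewrite /frontier (interior_id Omega).1 // setDE; apply: closedI; first exact: closed_closure.
  exact: open_closedC.
exact: compact_closure.
Qed.

Lemma outside : exists z, ~ Omega z.
Proof.
have [M M0 HM] := Omega_box Omega_bounded.
exists (const_mx M) => /HM; have := norm_coord (const_mx M : 'rV[R]_n) (Ordinal hn).
by rewrite mxE; have := ler_norm M; lra.
Qed.

Lemma closure_approach x v (t : R) : 0 < t ->
  (forall s, 0 <= s -> s < t -> Omega (x + s *: v)) -> closure Omega (x + t *: v).
Proof.
move=> t0 H; apply: closure_eps => e e0.
pose d := Num.min t (e / (2 * (`|v| + 1))).
have v1 : 0 < `|v| + 1 by rewrite ltr_wpDl.
have d0 : 0 < d by rewrite /d lt_min t0 divr_gt0 // mulr_gt0.
have dt : d <= t by rewrite /d ge_min lexx.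
exists (x + (t - d) *: v); first by apply: H; lra.
rewrite opprD addrACA subrr add0r -scalerBl normrZ.
have -> : t - d - t = - d by ring.
rewrite normrN gtr0_norm //; apply: (@le_lt_trans _ _ (e / (2 * (`|v| + 1)) * (`|v| + 1))).
  by apply: ler_pM => //; [exact: ltW|rewrite /d ge_min lexx orbT|rewrite lerDl].
by rewrite invfM mulrA -mulrA mulVf ?mulr1 ?gt_eqF //; lra.
Qed.

Lemma exit_point x z : Omega x -> ~ Omega z -> exists t : R,
  [/\ 0 < t, t <= 1, frontier Omega (x + t *: (z - x)) &
     forall s, 0 <= s -> s < t -> Omega (x + s *: (z - x))].
Proof.
move=> Ox nz; pose c (s : R) := x + s *: (z - x).
have [r|nt|t [/andP[t0 t1] nt tO]] := @first_exit R n Omega c 0 1 Omega_open ler01.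
- move=> r01 e e0; exists (e / (`|z - x| + 1)); first by rewrite divr_gt0 // ltr_wpDl.
  move=> r' r'01 rr; rewrite /c opprD addrACA subrr add0r -scalerBl normrZ.
  have v1 : 0 < `|z - x| + 1 by rewrite ltr_wpDl.
  apply: (@le_lt_trans _ _ (`|r' - r| * (`|z - x| + 1))); first by rewrite ler_wpM2l // lerDl.
  by rewrite -ltr_pdivlMr.
- by apply: nz; move: nt; rewrite /c scale1r addrC subrK.
have tp : 0 < t.
  rewrite lt_neqAle t0 andbT; apply/eqP => t0'.
  by apply: nt; rewrite -t0' /c scale0r addr0.
exists t; split => //.
by apply/frontierE; split => //; exact: closure_approach.
Qed.

Lemma within_bounded (u : 'rV[R]_n -> R) : {within closure Omega, continuous u} ->
  exists M : R, forall x, closure Omega x -> `|u x| <= M.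
Proof.
move=> cu; have := continuous_compact cu compact_closure.
move=> /compact_bounded[M [_ HM]]; exists (`|M| + 1) => x cx.
by apply: (HM (`|M| + 1)); [rewrite ltr_pwDr // ler_norm|exists x].
Qed.

Lemma within_continuous_inside (u : 'rV[R]_n -> R) : {within closure Omega, continuous u} ->
  forall x, Omega x -> {for x, continuous u}.
Proof.
move=> /within_continuous_eps cu x Ox; apply/(@cvgrPdist_le _ _ _ _ (nbhs_filter x)) => e e0.
have [d d0 Hd] := cu x (subset_closure Ox) e e0.
have [d' /= d'0 dO] : nbhs_ball x Omega by apply/nbhs_ballP; exact: open_nbhs_nbhs.
apply/(nbhs_ballP x); exists (Num.min d d'); first by rewrite /= lt_min d0.
move=> y; rewrite -ball_normE /ball_ /= lt_min => /andP[h1 h2]; rewrite distrC.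
apply: Hd; last by rewrite distrC.
by apply: subset_closure; apply: dO; rewrite -ball_normE.
Qed.

Lemma AC_eps (gamma : R -> 'rV[R]_n) : absolutely_continuous01 gamma ->
  forall r, 0 <= r <= 1 -> forall e : R, 0 < e -> exists2 d : R, 0 < d &
    forall r', 0 <= r' <= 1 -> `|r' - r| < d -> `|gamma r' - gamma r| < e.
Proof.
move=> gAC r /andP[r0 r1] e e0; have [d d0 Hd] := AC_near gAC e0.
exists d => // r' /andP[r'0 r'1] rr; have [h|h] := leP r r'.
  by apply: Hd => //; apply: le_lt_trans rr; exact: ler_norm.
rewrite distrC; apply: Hd => //; first exact: ltW.
by apply: le_lt_trans rr; rewrite distrC; exact: ler_norm.
Qed.

End domain.

Section admissible_functions.
Context {R : realType} {n : nat}.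
Variable Omega : set 'rV[R]_n.
Variable K : set 'rV[R]_n.
Variable phi : 'rV[R]_n -> R.
Hypothesis Omega_bounded : bounded_set Omega.
Hypothesis Omega_open : open Omega.
Hypothesis K_compact : compact K.
Hypothesis K_int0 : interior K 0.
Hypothesis phi_compat : forall x y gamma, frontier Omega x -> frontier Omega y ->
      curves Omega y x gamma -> phi x - phi y <= curve_length K gamma.
Local Notation rho0 := (gauge (polar K)).
Variable u : 'rV[R]_n -> R.
Hypothesis uX : X_phi Omega K phi u.

Let cu : {within closure Omega, continuous u}. Proof. by case: uX. Qed.

Lemma admissible_increment_near c d : (forall z, `|z - c| < 2 * d -> Omega z) -> 0 < d ->
  forall x y, `|x - c| < d -> `|y - c| < d -> u x - u y <= rho0 (x - y).
Proof.
move=> cO d0 x y xc yc; have [_ _ [g [ug gK]]] := uX.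
apply: (@weak_gradient_increment_near _ _ _ _ Omega_bounded Omega_open K_compact K_int0 _ _ ug gK c _ _ d) => //.
exact: within_continuous_inside.
Qed.

Section along_a_curve.
Variables (gamma : R -> 'rV[R]_n) (V : R -> R).
Hypothesis gAC : absolutely_continuous01 gamma.
Hypothesis gO : forall t, 0 <= t <= 1 -> closure Omega (gamma t).
Hypothesis cV : {within `[0, 1], continuous V}.
Hypothesis HVs : forall s t, 0 <= s -> s <= t -> t <= 1 ->
  curve_length K (stopped s t gamma) = V t - V s.
Hypothesis HV : forall s t, 0 <= s -> s <= t -> t <= 1 ->
  rho0 (gamma t - gamma s) <= V t - V s.

Let Phi r := V r - u (gamma r).

Let Phi_eps r : 0 <= r <= 1 -> forall e : R, 0 < e -> exists2 d : R, 0 < d &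
  forall r', 0 <= r' <= 1 -> `|r' - r| < d -> `|Phi r' - Phi r| <= e.
Proof.
move=> r01 e e0; have e2 : 0 < e / 2 by rewrite divr_gt0.
have [d1 d10 H1] := within_continuous_itv_eps cV r01 e2.
have [d2 d20 H2] := (within_continuous_eps _ _).1 cu _ (gO r01) _ e2.
have [d3 d30 H3] := AC_eps gAC r01 d20.
exists (Num.min d1 d3); first by rewrite lt_min d10.
move=> r' r'01; rewrite lt_min => /andP[h1 h3].
have := H1 r' r'01 h1; have := H2 _ (gO r'01) (H3 r' r'01 h3).
rewrite /Phi !ler_norml => /andP[a1 a2] /andP[a3 a4]; apply/andP; split; lra.
Qed.

Let mono_inside s t : 0 <= s -> s <= t -> t <= 1 ->
  (forall r, s <= r <= t -> Omega (gamma r)) -> Phi s <= Phi t.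
Proof.
move=> s0 st t1 H; apply: local_to_global_monotone => // r srt.
have r01 : 0 <= r <= 1 by move: srt => /andP[h1 h2]; lra.
have [d /= d0 dO] : nbhs_ball (gamma r) Omega.
  by apply/nbhs_ballP; apply: open_nbhs_nbhs; split => //; exact: H.
have d2 : 0 < d / 2 by rewrite divr_gt0.
have [e e0 He] := AC_eps gAC r01 d2.
have inc x y : `|x - gamma r| < d / 2 -> `|y - gamma r| < d / 2 -> u x - u y <= rho0 (x - y).
  apply: admissible_increment_near => // z zc; apply: dO.
  by rewrite -ball_normE /ball_ /= distrC; lra.
have gg : `|gamma r - gamma r| < d / 2 by rewrite subrr normr0.
exists e => // r' sr't rr'; have r'01 : 0 <= r' <= 1 by move: sr't => /andP[h1 h2]; lra.
have gr' := He r' r'01 rr'; move/andP: r01 => [r0 r1]; move/andP: r'01 => [r'0 r'1].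
split => h.
  by have := inc _ _ gg gr'; have := HV r'0 h r1; rewrite /Phi; lra.
by have := inc _ _ gr' gg; have := HV r0 h r'1; rewrite /Phi; lra.
Qed.

Let mono_left s t : 0 <= s -> s <= t -> t <= 1 ->
  (forall r, s <= r -> r < t -> Omega (gamma r)) -> Phi s <= Phi t.
Proof.
move=> s0 st t1 H; have [ts|ts] := leP t s; first by have -> : t = s by apply/eqP; rewrite eq_le ts st.
apply/ler_addgt0Pr => e e0; have t01 : 0 <= t <= 1 by rewrite t1 (le_trans s0 st).
have [d d0 Hd] := Phi_eps t01 e0.
pose r := Num.max s (t - d / 2).
have sr : s <= r by rewrite /r le_max lexx.
have rt : r < t by rewrite /r gt_max ts; lra.
have rd : t - d / 2 <= r by rewrite /r le_max lexx orbT.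
have r01 : 0 <= r <= 1 by rewrite (le_trans s0 sr) (le_trans (ltW rt) t1).
have h1 : Phi s <= Phi r.
  apply: mono_inside => //; first by case/andP: r01.
  by move=> r' /andP[h1 h2]; apply: H => //; exact: le_lt_trans h2 rt.
have : `|Phi r - Phi t| <= e by apply: Hd => //; rewrite ler0_norm ?subr_le0 ?(ltW rt) //; lra.
by rewrite ler_norml => /andP[_ h2]; lra.
Qed.

Let mono_right s t : 0 <= s -> s <= t -> t <= 1 ->
  (forall r, s < r -> r <= t -> Omega (gamma r)) -> Phi s <= Phi t.
Proof.
move=> s0 st t1 H; have [ts|ts] := leP t s; first by have -> : t = s by apply/eqP; rewrite eq_le ts st.
apply/ler_addgt0Pr => e e0; have s01 : 0 <= s <= 1 by rewrite s0 (le_trans st t1).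
have [d d0 Hd] := Phi_eps s01 e0.
pose r := Num.min t (s + d / 2).
have rt : r <= t by rewrite /r ge_min lexx.
have sr : s < r by rewrite /r lt_min ts; lra.
have rd : r <= s + d / 2 by rewrite /r ge_min lexx orbT.
have r01 : 0 <= r <= 1 by rewrite (le_trans s0 (ltW sr)) (le_trans rt t1).
have h1 : Phi r <= Phi t.
  apply: mono_inside => //; first by case/andP: r01.
  by move=> r' /andP[h1 h2]; apply: H => //; exact: lt_le_trans sr h1.
have : `|Phi r - Phi s| <= e by apply: Hd => //; rewrite ger0_norm ?subr_ge0 ?(ltW sr) //; lra.
by rewrite ler_norml => /andP[h2 _]; lra.
Qed.

(** If the curve leaves [Omega] between the times [s] and [t], it lies in [Omega]
    before its first contact with the frontier and after its last one, and
    [phi_compat] bounds the increment between these contacts. *)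
Lemma admissible_monotone s t : 0 <= s -> s <= t -> t <= 1 ->
  u (gamma t) - u (gamma s) <= V t - V s.
Proof.
move=> s0 st t1; suff : Phi s <= Phi t by rewrite /Phi; lra.
have [allO|] := pselect (forall r, s <= r <= t -> Omega (gamma r)); first exact: mono_inside.
move=> /existsNP[r1 /not_implyP[/andP[sr1 r1t] nr1]].
have [a [/andP[sa ar1] na Ha]] : exists r, [/\ s <= r <= r1, ~ Omega (gamma r) &
    forall r', s <= r' -> r' < r -> Omega (gamma r')].
  apply: first_exit => // r /andP[h1 h2] e e0.
  have r01 : 0 <= r <= 1 by lra.
  have [d d0 Hd] := AC_eps gAC r01 e0; exists d => // r' /andP[h3 h4]; apply: Hd; lra.
have [b' [/andP[rb' b't] nb Hb]] : exists r, [/\ r1 <= r <= t, ~ Omega (gamma (r1 + t - r)) &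
    forall r', r1 <= r' -> r' < r -> Omega (gamma (r1 + t - r'))].
  apply: (@first_exit R n Omega (fun r => gamma (r1 + t - r))) => //; last by rewrite addrK.
  move=> r /andP[h1 h2] e e0.
  have r01 : 0 <= r1 + t - r <= 1 by lra.
  have [d d0 Hd] := AC_eps gAC r01 e0; exists d => // r' /andP[h3 h4] rr; apply: Hd; first lra.
  have -> : r1 + t - r' - (r1 + t - r) = - (r' - r) by ring.
  by rewrite normrN.
pose b := r1 + t - b'; have b1 : r1 <= b by rewrite /b; lra.
have bt : b <= t by rewrite /b; lra.
have Hb' r : b < r -> r <= t -> Omega (gamma r).
  move=> br rt; have E : r = r1 + t - (r1 + t - r) by ring.
  rewrite E; apply: Hb; first lra.
  by move: br; rewrite /b; lra.
have fa : frontier Omega (gamma a) by apply/frontierE => //; split => //; apply: gO; lra.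
have fb : frontier Omega (gamma b) by apply/frontierE => //; split => //; apply: gO; lra.
have P1 : Phi s <= Phi a by apply: mono_left => //; lra.
have P3 : Phi b <= Phi t by apply: mono_right => //; lra.
apply: (le_trans P1); apply: le_trans P3.
have gc : curves Omega (gamma 0) (gamma 1) gamma by split.
have a0 : 0 <= a by lra.
have ab : a <= b by lra.
have b01 : b <= 1 by lra.
have := phi_compat fb fa (curves_stopped gc a0 ab b01).
rewrite HVs // /Phi; have [_ up _] := uX; rewrite !up //; lra.
Qed.

End along_a_curve.
End admissible_functions.

(** * The Lax-Hopf function *)

Section lax_hopf.
Context {R : realType} {n : nat}.
Hypothesis hn : (1 <= n)%N.
Variable Omega : set 'rV[R]_n.
Variable K : set 'rV[R]_n.
Variable phi : 'rV[R]_n -> R.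
Hypothesis Omega_nonempty : Omega !=set0.
Hypothesis Omega_bounded : bounded_set Omega.
Hypothesis Omega_open : open Omega.
Hypothesis K_compact : compact K.
Hypothesis K_convex : convex_set (K : set (convex_lmodType 'rV[R]_n)).
Hypothesis K_int0 : interior K 0.
Hypothesis phi_continuous : {within frontier Omega, continuous phi}.
Hypothesis phi_compat : forall x y gamma, frontier Omega x -> frontier Omega y ->
      curves Omega y x gamma -> phi x - phi y <= curve_length K gamma.
Local Notation rho0 := (gauge (polar K)).
Local Notation L := (curve_length K).
Local Notation cl := (closure Omega).
Local Notation U := (u_phi Omega K phi).

Let rg0 := rho0_ge0 K_compact K_int0.

Lemma length_ge0 y x gamma : curves Omega y x gamma -> 0 <= L gamma.
Proof. by move=> [gAC _ _ _]; apply: le_trans (rho0_le_length K_compact K_int0 gAC). Qed.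

Lemma frontier_nonempty : frontier Omega !=set0.
Proof.
have [x Ox] := Omega_nonempty; have [z nz] := outside hn Omega_bounded.
by have [t [_ _ ft _]] := exit_point Omega_open Ox nz; eexists; exact: ft.
Qed.

Lemma phi_bounded_below : exists m : R, forall y, frontier Omega y -> m <= phi y.
Proof.
have [c _ Hc] := compact_EVT_min frontier_nonempty (compact_frontier Omega_bounded Omega_open) phi_continuous.
by exists (phi c) => y fy; apply: Hc; rewrite inE.
Qed.

Let costs x := [set r | exists y gamma,
    [/\ frontier Omega y, curves Omega y x gamma & r = phi y + L gamma]].

Let costs_lb x : has_lbound (costs x).
Proof.
have [m Hm] := phi_bounded_below; exists m => _ [y [gamma [fy cg ->]]].
by have := Hm y fy; have := length_ge0 cg; lra.
Qed.

Lemma segment_from_frontier x : Omega x -> exists w,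
  frontier Omega w /\ curves Omega w x (straight w (x - w)).
Proof.
move=> Ox; have [z nz] := outside hn Omega_bounded.
have [t [t0 t1 ft Ht]] := exit_point Omega_open Ox nz.
exists (x + t *: (z - x)); split => //.
set w := x + _; have -> : curves Omega w x = curves Omega w (w + (x - w)) by rewrite addrC subrK.
apply: curves_straight => s /andP[s0 s1]; rewrite {1 2}/w.
have -> : x + t *: (z - x) + s *: (x - (x + t *: (z - x))) = x + ((1 - s) * t) *: (z - x).
  by apply/rowP => i; rewrite !mxE; ring.
have [->|s0'] := eqVneq s 0; first by rewrite subr0 mul1r; exact: frontier_closure.
apply: subset_closure; apply: Ht; first by rewrite mulr_ge0 ?(ltW t0) // subr_ge0.
rewrite gtr_pMl //; have : 0 < s by rewrite lt_neqAle eq_sym s0' s0.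
lra.
Qed.

Let costs_nonempty x : cl x -> costs x !=set0.
Proof.
move=> /(closure_cases Omega_open)[Ox|fx].
  have [w [fw cw]] := segment_from_frontier Ox.
  by eexists; exists w, (straight w (x - w)).
by eexists; exists x, (cst x); split => //; apply: curves_cst; exact: frontier_closure.
Qed.

Lemma u_phi_le x y gamma : frontier Omega y -> curves Omega y x gamma -> U x <= phi y + L gamma.
Proof. by move=> fy cg; apply: (ge_inf (costs_lb x)); exists y, gamma. Qed.

Lemma le_u_phi x c : cl x ->
  (forall y gamma, frontier Omega y -> curves Omega y x gamma -> c <= phi y + L gamma) -> c <= U x.
Proof.
move=> cx H; apply: lb_le_inf; first exact: costs_nonempty.
by move=> _ [y [gamma [fy cg ->]]]; exact: H.
Qed.

Lemma u_phi_frontier x : frontier Omega x -> U x = phi x.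
Proof.
move=> fx; apply/eqP; rewrite eq_le; apply/andP; split.
  have := u_phi_le fx (curves_cst (frontier_closure fx)).
  by rewrite length_cst // addr0.
apply: le_u_phi; first exact: frontier_closure.
by move=> y gamma fy cg; have := phi_compat fx fy cg; lra.
Qed.

(** A curve ending at [x] is prolonged by the segment. *)
Lemma u_phi_extend x v : cl x -> (forall s : R, 0 <= s <= 1 -> cl (x + s *: v)) ->
  U (x + v) <= U x + rho0 v.
Proof.
move=> cx H; rewrite -lerBlDr; apply: le_u_phi => // y gamma fy cg.
have := u_phi_le fy (curves_extend cg H); case: cg => gAC _ _ _.
have [V [_ _ _ -> ->]] := length_profile K_compact K_int0 gAC; lra.
Qed.

Lemma u_phi_segment x y : (forall s : R, 0 <= s <= 1 -> Omega (y + s *: (x - y))) ->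
  U x - U y <= rho0 (x - y).
Proof.
move=> H; rewrite lerBlDl.
have := @u_phi_extend y (x - y); rewrite addrCA subrr addr0; apply.
  by have := H 0; rewrite scale0r addr0 => h; apply: subset_closure; apply: h; rewrite lexx ler01.
by move=> s s01; apply: subset_closure; exact: H.
Qed.

(** The witness is the point where the segment from [x] to [z] leaves [Omega]; it
    compares [u_phi] with [phi] near the frontier. *)
Lemma u_phi_near_exit x z : Omega x -> ~ Omega z -> exists w,
  [/\ frontier Omega w, `|w - z| <= `|x - z|, `|w - x| <= `|x - z|,
      U x <= phi w + rho0 (x - w) & phi w <= U x + rho0 (w - x)].
Proof.
move=> Ox nz; have [t [t0 t1 ft Ht]] := exit_point Omega_open Ox nz.
set w := x + t *: (z - x) in ft.
have wx : w - x = t *: (z - x) by rewrite /w addrAC subrr add0r.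
have seg s : 0 <= s -> s <= 1 -> cl (x + s *: (w - x)).
  move=> s0 s1; rewrite wx scalerA; have [->|s1'] := eqVneq s 1.
    by rewrite mul1r; exact: frontier_closure.
  apply: subset_closure; apply: Ht; first by rewrite mulr_ge0 // ltW.
  by rewrite gtr_pMl // lt_neqAle s1' s1.
exists w; split => //.
- have -> : w - z = (1 - t) *: (x - z) by apply/rowP => i; rewrite !mxE; ring.
  by rewrite normrZ ger0_norm ?subr_ge0 // ler_piMl //; lra.
- by rewrite wx normrZ gtr0_norm // distrC ler_piMl.
- have h : forall s : R, 0 <= s <= 1 -> cl (w + s *: (x - w)).
    move=> s /andP[s0 s1]; have := @seg (1 - s); rewrite (_ : x + _ = w + s *: (x - w)); last first.
      by apply/rowP => i; rewrite !mxE; ring.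
    by apply; lra.
  have := u_phi_le ft (curves_straight h); rewrite length_straight //.
  by rewrite addrCA subrr addr0.
- have := @u_phi_extend x (w - x); rewrite addrCA subrr addr0 (u_phi_frontier ft); apply.
    exact: subset_closure.
  by move=> s /andP[]; exact: seg.
Qed.

Lemma u_phi_continuous : {within cl, continuous U}.
Proof.
have [C C0 HC] := rho0_le_norm K_compact K_int0.
apply/within_continuous_eps => x cx e e0.
have [Ox|fx] := closure_cases Omega_open cx.
  have [d /= d0 dO] : nbhs_ball x Omega by apply/nbhs_ballP; exact: open_nbhs_nbhs.
  exists (Num.min d (e / C)); first by rewrite lt_min d0 divr_gt0.
  move=> y cy; rewrite lt_min ltr_pdivlMr // => /andP[yd ye].
  have seg (a b : 'rV[R]_n) (s : R) : `|a - x| < d -> `|b - x| < d -> 0 <= s <= 1 -> Omega (b + s *: (a - b)).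
    move=> ad bd s01; apply: dO; rewrite -ball_normE /ball_ /= distrC.
    exact: segment_ball.
  have xx : `|x - x| < d by rewrite subrr normr0.
  have h1 := u_phi_segment (fun s => seg y x s yd xx).
  have h2 := u_phi_segment (fun s => seg x y s xx yd).
  have := HC (y - x); have := HC (x - y); rewrite [`|x - y|]distrC => h3 h4.
  rewrite ler_norml; apply/andP; split; lra.
have [d1 d10 H1] := (within_continuous_eps _ _).1 phi_continuous x fx (e / 2) ltac:(lra).
exists (Num.min d1 (e / 2 / C)); first by rewrite lt_min d10 !divr_gt0.
move=> y cy; rewrite lt_min ltr_pdivlMr // => /andP[yd ye].
have [Oy|fy] := closure_cases Omega_open cy; last first.
  rewrite !u_phi_frontier //; apply: (le_trans (H1 y fy yd)); lra.
have [_ nx] := (frontierE Omega_open x).1 fx.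
have [w [fw wx wy h1 h2]] := u_phi_near_exit Oy nx.
have := H1 w fw (le_lt_trans wx yd); rewrite (u_phi_frontier fx).
have := HC (y - w); have := HC (w - y); rewrite [`|y - w|]distrC => h3 h4.
have : C * `|w - y| <= e / 2.
  by apply: (@le_trans _ _ (C * `|y - x|)); [rewrite ler_pM2l|rewrite mulrC ltW].
rewrite !ler_norml => h5 /andP[h6 h7]; apply/andP; split; lra.
Qed.

Theorem u_phi_admissible : X_phi Omega K phi U.
Proof.
split; [exact: u_phi_continuous|exact: u_phi_frontier|].
have [M HM] := within_bounded Omega_bounded u_phi_continuous.
apply: (@lipschitz_weak_gradient _ _ _ _ Omega_bounded Omega_open K_compact K_convex K_int0 U M).
- exact: within_continuous_inside u_phi_continuous.
- by move=> x Ox; apply: HM; exact: subset_closure.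
- exact: u_phi_segment.
Qed.

Lemma admissible_curve u x z gamma : X_phi Omega K phi u -> curves Omega x z gamma ->
  u z - u x <= L gamma.
Proof.
move=> uX [gAC gO <- <-].
have [V [cV HVs HV -> _]] := length_profile K_compact K_int0 gAC.
by apply: (admissible_monotone Omega_bounded Omega_open K_compact K_int0 phi_compat uX gAC gO).
Qed.

Lemma admissible_le_u_phi u x : X_phi Omega K phi u -> cl x -> u x <= U x.
Proof.
move=> uX cx; apply: le_u_phi => // y gamma fy cg.
have := admissible_curve uX cg; have [_ up _] := uX; rewrite (up y fy); lra.
Qed.

Section lower_barrier.
Variable f : 'rV[R]_n -> R.
Local Notation Uf := (u_f Omega f K phi).
Local Notation S := (spt Omega f).

Lemma spt_closure : S `<=` cl.
Proof. by move=> x []. Qed.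

Lemma obstacle_closure z : (frontier Omega `|` S) z -> cl z.
Proof. by move=> [fz|Sz]; [exact: frontier_closure|exact: spt_closure]. Qed.

Lemma u_f_ge x z gamma : (frontier Omega `|` S) z -> curves Omega x z gamma ->
  U z - L gamma <= Uf x.
Proof.
move=> Sz cg; apply: ub_le_sup; last by exists z, gamma.
exists (U x) => _ [z' [g' [_ cg' ->]]].
by have := admissible_curve u_phi_admissible cg'; lra.
Qed.

Lemma u_f_le x c : cl x ->
  (forall z gamma, (frontier Omega `|` S) z -> curves Omega x z gamma -> U z - L gamma <= c) ->
  Uf x <= c.
Proof.
move=> cx H; apply: ge_sup; last by move=> _ [z [gamma [Sz cg ->]]]; exact: H.
have [Ox|fx] := closure_cases Omega_open cx; last first.
  by eexists; exists x, (cst x); split => //; [left|exact: curves_cst].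
have [z nz] := outside hn Omega_bounded.
have [t [t0 t1 ft Ht]] := exit_point Omega_open Ox nz.
eexists; exists (x + t *: (z - x)), (straight x (t *: (z - x))); split => //; first by left.
apply: curves_straight => s /andP[s0 s1]; rewrite scalerA.
have [->|s1'] := eqVneq s 1; first by rewrite mul1r; exact: frontier_closure.
apply: subset_closure; apply: Ht; first by rewrite mulr_ge0 // ltW.
by rewrite gtr_pMl // lt_neqAle s1' s1.
Qed.

Lemma u_f_obstacle z : (frontier Omega `|` S) z -> U z <= Uf z.
Proof.
move=> Sz; have := u_f_ge Sz (curves_cst (obstacle_closure Sz)).
by rewrite length_cst // subr0.
Qed.

Lemma u_f_le_u_phi x : cl x -> Uf x <= U x.
Proof.
move=> cx; apply: u_f_le => // z gamma _ cg.
by have := admissible_curve u_phi_admissible cg; lra.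
Qed.

(** Contact on [spt f] spreads along curves by [admissible_curve]; conversely,
    constant curves give [u_f = u_phi] on [spt f]. *)
Lemma barriers_characterise u : X_phi Omega K phi u ->
  (forall x, S x -> u x = U x) <-> (forall x, cl x -> Uf x <= u x <= U x).
Proof.
move=> uX; split => H x.
  move=> cx; rewrite (admissible_le_u_phi uX cx) andbT; apply: u_f_le => // z gamma Sz cg.
  have <- : u z = U z by case: Sz => [fz|/H //]; rewrite u_phi_frontier //; case: uX => _ ->.
  by have := admissible_curve uX cg; lra.
move=> Sx; have /andP[h1 h2] := H x (spt_closure Sx).
by apply/eqP; rewrite eq_le h2 (le_trans _ h1) //; apply: u_f_obstacle; right.
Qed.

End lower_barrier.
End lax_hopf.

(** * Minimisers *)

Section minimisers.
Context {R : realType} {n : nat}.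
Local Notation mu := (@lebesgue_rV R n).
Hypothesis hn : (1 <= n)%N.
Variable Omega : set 'rV[R]_n.
Variable f : 'rV[R]_n -> R.
Variable K : set 'rV[R]_n.
Variable phi : 'rV[R]_n -> R.
Hypothesis Omega_nonempty : Omega !=set0.
Hypothesis Omega_bounded : bounded_set Omega.
Hypothesis Omega_open : open Omega.
Hypothesis f_L1 : lebesgue_rV.-integrable Omega (fun x => (f x)%:E).
Hypothesis f_ge0 : \forall x \ae lebesgue_rV, Omega x -> 0 <= f x.
Hypothesis K_compact : compact K.
Hypothesis K_convex : convex_set (K : set (convex_lmodType 'rV[R]_n)).
Hypothesis K_int0 : interior K 0.
Hypothesis phi_continuous : {within frontier Omega, continuous phi}.
Hypothesis phi_compat : forall x y gamma, frontier Omega x -> frontier Omega y ->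
      curves Omega y x gamma -> phi x - phi y <= curve_length K gamma.
Local Notation cl := (closure Omega).
Local Notation U := (u_phi Omega K phi).
Local Notation S := (spt Omega f).

Let UX : X_phi Omega K phi U := u_phi_admissible hn Omega_nonempty Omega_bounded Omega_open
  K_compact K_convex K_int0 phi_continuous phi_compat.

Let u_le_U u x : X_phi Omega K phi u -> cl x -> u x <= U x :=
  @admissible_le_u_phi _ _ hn Omega _ _ Omega_bounded Omega_open
    K_compact K_int0 phi_compat u x.

Let mO := mOmega Omega_open.

Lemma integrable_work u : {within cl, continuous u} ->
  mu.-integrable Omega (EFin \o (fun x => f x * u x)).
Proof.
move=> cu; have [M HM] := within_bounded Omega_bounded cu.
apply: (@integrable_mul_bounded _ _ _ Omega_open _ _ M) => //.
  by apply: open_continuous_measurable_rV => //; exact: within_continuous_inside cu.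
by move=> x Ox; apply: HM; exact: subset_closure.
Qed.

Lemma X_phi_continuous u : X_phi Omega K phi u -> {within cl, continuous u}.
Proof. by case. Qed.

Lemma u_phi_optimal u : X_phi Omega K phi u ->
  objective Omega f U <= objective Omega f u.
Proof.
move=> uX; rewrite lerN2; apply: ae_le_Rintegral => //.
- exact: integrable_work (X_phi_continuous uX).
- exact: integrable_work (X_phi_continuous UX).
- apply: filterS f_ge0 => x fx Ox; rewrite ler_wpM2l ?fx //.
  by apply: u_le_U => //; exact: subset_closure.
Qed.

Lemma outside_spt x : cl x -> ~ S x -> exists O, [/\ open O, O x,
  {ae mu, forall y, O y -> Omega y -> f y = 0} & forall y, cl y -> O y -> ~ S y].
Proof.
move=> cx nS; have [A [[[W oO AE] Af] Ax]] : exists A, ([set A |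
    (exists2 O, open O & A = O `&` closure Omega) /\
    \forall x \ae lebesgue_rV, (A `&` Omega) x -> f x = 0] A /\ A x).
  apply: contrapT => h; apply: nS; split => // -[A HA Ax]; apply: h; by exists A.
move: Ax Af; rewrite AE => -[Ox _] Af; exists W; split => //.
  by apply: filterS Af => y H Oy Py; apply: H; split => //; split => //; exact: subset_closure.
move=> y cy Oy [_]; apply; exists (W `&` cl); last by split.
by split; [exists W|].
Qed.

(** By second countability, the open sets on which [f] vanishes almost everywhere
    have a union on which it still does. *)
Lemma spt_charges : {ae mu, forall x, Omega x -> ~ S x -> f x = 0}.
Proof.
have : mu.-negligible ([set x | f x != 0] `&` (Omega `\` S)).
  apply: negligible_local => x [Ox nS].
  have [W [oO Oxx Of _]] := outside_spt (subset_closure Ox) nS.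
  exists (W `&` Omega); split; [exact: openI|by split|].
  apply: negligibleS Of => y /= [fy [Oy Py]] H; move/eqP: fy; apply; exact: H.
apply: negligibleS => x /= H; apply: contrapT => h; apply: H => Ox nS.
by apply: contrapT => /eqP fx; apply: h; split => //; split.
Qed.

(** Comparing [u] with the minimiser [u_phi] shows that [f * (u_phi - u)], which
    is nonnegative, vanishes almost everywhere. If [u < u_phi] at a point, then by
    continuity [f] vanishes almost everywhere around it. *)
Lemma solution_iff_contact u : X_phi Omega K phi u ->
  solution_P Omega f K phi u <-> (forall x, S x -> u x = U x).
Proof.
move=> uX; have iu := integrable_work (X_phi_continuous uX).
have iU := integrable_work (X_phi_continuous UX).
split=> [[_ /(_ _ UX) opt]|H]; last first.
  split => // v vX; apply: le_trans (u_phi_optimal vX).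
  rewrite lerN2; apply: ae_le_Rintegral => //.
  apply: filterS spt_charges => x fx Ox; have [Sx|Sx] := pselect (S x); first by rewrite H.
  by rewrite fx // !mul0r.
pose h x := f x * U x - f x * u x.
have ih : mu.-integrable Omega (EFin \o h) by have := integrableB mO iU iu.
have h_ge0 : {ae mu, forall x, Omega x -> 0 <= h x}.
  apply: filterS f_ge0 => x fx Ox; rewrite /h -mulrBr mulr_ge0 ?fx // subr_ge0.
  by apply: u_le_U => //; exact: subset_closure.
have h_int : \int[mu]_(x in Omega) h x <= 0.
  by rewrite /h RintegralB // subr_le0 -lerN2.
have iah : mu.-integrable Omega (EFin \o (fun x => `|h x|)).
  by have := integrable_abse ih.
have h0 : (\int[mu]_(x in Omega) `|(h x)%:E| = 0)%E.
  have r0 : \int[mu]_(x in Omega) `|h x| = 0.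
    apply/eqP; rewrite eq_le; apply/andP; split; last by apply: Rintegral_ge0.
    apply: le_trans h_int; apply: ae_le_Rintegral => //.
    by apply: filterS h_ge0 => x hx Ox; rewrite ger0_norm // hx.
  have := integrable_fin_num mO iah; move: r0; rewrite /Rintegral /=.
  by case: (integral _ _ _) => // q /= ->.
have mh : measurable_fun Omega (EFin \o h) := measurable_int _ ih.
have hae := (ae_eq_integral_abs mu mO mh).1 h0.
move=> x Sx; have cx : cl x by case: Sx.
apply/eqP; rewrite eq_le u_le_U //= leNgt; apply/negP => lt.
pose e := (U x - u x) / 4; have e0 : 0 < e by rewrite divr_gt0 // subr_gt0.
have [d1 d10 H1] := (within_continuous_eps _ _).1 (X_phi_continuous uX) x cx e e0.
have [d2 d20 H2] := (within_continuous_eps _ _).1 (X_phi_continuous UX) x cx e e0.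
pose O := [set y | `|y - x| < Num.min d1 d2].
case: Sx => _; apply; exists (O `&` cl); last first.
  by split => //; rewrite /O /= subrr normr0 lt_min d10.
split; first by exists O => //; exact: open_sub_ball.
apply: filterS hae => y hy [[Oy cy] Py]; move: Oy; rewrite /O /= lt_min => /andP[y1 y2].
have := H1 y cy y1; have := H2 y cy y2; rewrite !ler_norml => /andP[a1 a2] /andP[a3 a4].
have : h y = 0 by case: (hy Py).
rewrite /h -mulrBr => /eqP; rewrite mulf_eq0 => /orP[/eqP //|/eqP Uy].
by exfalso; move: e0 a1 a2 a3 a4; rewrite /e; lra.
Qed.

End minimisers.

(** * Transport rays *)

Section transport_rays.
Context {R : realType} {n : nat}.
Hypothesis hn : (1 <= n)%N.
Variable Omega : set 'rV[R]_n.
Variable f : 'rV[R]_n -> R.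
Variable K : set 'rV[R]_n.
Variable phi : 'rV[R]_n -> R.
Hypothesis Omega_nonempty : Omega !=set0.
Hypothesis Omega_bounded : bounded_set Omega.
Hypothesis Omega_open : open Omega.
Hypothesis K_compact : compact K.
Hypothesis K_convex : convex_set (K : set (convex_lmodType 'rV[R]_n)).
Hypothesis K_C1 : class_C1 K.
Hypothesis K_int0 : interior K 0.
Hypothesis phi_continuous : {within frontier Omega, continuous phi}.
Hypothesis phi_compat : forall x y gamma, frontier Omega x -> frontier Omega y ->
      curves Omega y x gamma -> phi x - phi y <= curve_length K gamma.
Local Notation rho0 := (gauge (polar K)).
Local Notation L := (curve_length K).
Local Notation cl := (closure Omega).
Local Notation U := (u_phi Omega K phi).
Local Notation S := (spt Omega f).

Let UX : X_phi Omega K phi U := u_phi_admissible hn Omega_nonempty Omega_bounded Omega_open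
  K_compact K_convex K_int0 phi_continuous phi_compat.
Let cU : {within cl, continuous U} := X_phi_continuous UX.

Let U_segment x y : (forall s : R, 0 <= s <= 1 -> Omega (y + s *: (x - y))) ->
  U x - U y <= rho0 (x - y).
Proof. by apply: u_phi_segment. Qed.

Let U_le x y gamma : frontier Omega y -> curves Omega y x gamma -> U x <= phi y + L gamma.
Proof. by apply: u_phi_le. Qed.

Let U_frontier x : frontier Omega x -> U x = phi x.
Proof. by apply: u_phi_frontier. Qed.

Let U_monotone gamma (V : R -> R) : absolutely_continuous01 gamma ->
  (forall t, 0 <= t <= 1 -> cl (gamma t)) -> {within `[0, 1], continuous V} ->
  (forall s t, 0 <= s -> s <= t -> t <= 1 -> L (stopped s t gamma) = V t - V s) ->
  (forall s t, 0 <= s -> s <= t -> t <= 1 -> rho0 (gamma t - gamma s) <= V t - V s) ->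
  forall s t, 0 <= s -> s <= t -> t <= 1 -> U (gamma t) - U (gamma s) <= V t - V s.
Proof.
move=> gAC gO cV HVs HV s t.
exact: (admissible_monotone Omega_bounded Omega_open K_compact K_int0 phi_compat UX gAC gO cV HVs HV).
Qed.

Let rg0 := rho0_ge0 K_compact K_int0.
Let rZ := rho0Z K_compact K_int0.
Let rgt0 := rho0_gt0 K_compact K_int0.

Lemma segment_in_ball (A : set 'rV[R]_n) (c x y : 'rV[R]_n) (d s : R) :
  (forall z, `|z - c| <= d -> A z) -> `|x - c| <= d -> `|y - c| <= d ->
  0 <= s <= 1 -> A (y + s *: (x - y)).
Proof.
move=> cA xc yc /andP[s0 s1]; apply: cA.
have -> : y + s *: (x - y) - c = (1 - s) *: (y - c) + s *: (x - c).
  by apply/rowP => i; rewrite !mxE; ring.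
apply: (le_trans (ler_normD _ _)); rewrite !normrZ.
rewrite (ger0_norm s0) (ger0_norm (_ : 0 <= 1 - s)); last by lra.
have -> : d = (1 - s) * d + s * d by ring.
by apply: lerD; rewrite ler_wpM2l ?subr_ge0.
Qed.

Lemma closed_ball_in (O : set 'rV[R]_n) (q : 'rV[R]_n) : open O -> O q ->
  exists2 r : R, 0 < r & forall z, `|z - q| <= r -> O z.
Proof.
move=> oO Oq; have [r /= r0 rO] : nbhs_ball q O by apply/nbhs_ballP; exact: open_nbhs_nbhs.
exists (r / 2); first by rewrite divr_gt0.
by move=> z zq; apply: rO; rewrite -ball_normE /ball_ /= distrC; lra.
Qed.

Lemma curve_crosses_sphere (gamma : R -> 'rV[R]_n) (q : 'rV[R]_n) (r : R) :
  absolutely_continuous01 gamma ->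
  Num.min `|gamma 0 - q| `|gamma 1 - q| <= r <= Num.max `|gamma 0 - q| `|gamma 1 - q| ->
  exists t, [/\ 0 <= t, t <= 1 & `|gamma t - q| = r].
Proof.
move=> gAC rr; have [|t] := @IVT R (fun t => `|gamma t - q|) 0 1 r ler01 _ rr.
  apply/subspace_continuousP => x; rewrite /= in_itv /= => x01.
  apply/cvgrPdist_le => e e0; have [d d0 Hd] := AC_eps gAC x01 e0.
  apply/nbhs_ballP; exists d => // y; rewrite /ball /= distrC => yx.
  rewrite in_itv /= => y01; rewrite distrC; apply: (le_trans (ler_dist_dist _ _)).
  by rewrite opprB addrA subrK ltW //; apply: Hd.
by rewrite in_itv /= => /andP[t0 t1] ct; exists t.
Qed.

Lemma attained_on_sphere (F : 'rV[R]_n -> R) (q : 'rV[R]_n) (r c : R) :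
  (forall z, `|z - q| <= r -> cl z) -> {within cl, continuous F} ->
  (forall e : R, 0 < e -> exists w, `|w - q| = r /\ F w <= c + e) ->
  exists w, `|w - q| = r /\ F w <= c.
Proof.
move=> qr cF H; pose A : set 'rV[R]_n := [set w | `|w - q| = r].
have A0 : A !=set0 by have [w [wr _]] := H 1 ltr01; exists w.
have cA : compact A.
  apply: (@subclosed_compact _ _ cl); last by move=> w wr; apply: qr; rewrite wr.
    rewrite (_ : A = (fun w : 'rV[R]_n => `|w - q|) @^-1` [set r]); last by [].
    apply: closed_comp; last exact: closed_eq.
    move=> w _; apply/(@cvgrPdist_le _ _ _ _ (nbhs_filter w)) => e e0.
    apply: filterS (near_norm_le w e0) => y wy; apply: (le_trans (ler_dist_dist _ _)).
    by rewrite opprB addrA subrK.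
  exact: compact_closure.
have cFA : {within A, continuous F}.
  by apply: continuous_subspaceW cF => w wr; apply: qr; rewrite wr.
have [w wA Hw] := compact_EVT_min A0 cA cFA; rewrite inE in wA.
exists w; split => //; apply/ler_addgt0Pr => e e0.
have [w' [w'r w'c]] := H e e0; apply: le_trans w'c; apply: Hw; by rewrite inE.
Qed.

Let within_U_rho0 (k j : R) (q : 'rV[R]_n) :
  {within cl, continuous (fun w => k * U w + rho0 (j *: (w - q)))}.
Proof.
have [C C0 HC] := rho0_lip K_compact K_int0.
apply/within_continuous_eps => x cx e e0.
have k1 : 0 < `|k| + 1 by rewrite ltr_wpDl.
have j1 : 0 < `|j| + 1 by rewrite ltr_wpDl.
have [d1 d10 H1] := (within_continuous_eps _ _).1 cU x cx (e / 2 / (`|k| + 1)) ltac:(by rewrite !divr_gt0).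
exists (Num.min d1 (e / 2 / (C * (`|j| + 1)))).
  by rewrite lt_min d10 !divr_gt0 // mulr_gt0.
move=> y cy; rewrite lt_min => /andP[y1 y2].
rewrite opprD addrACA -mulrBr; apply: (le_trans (ler_normD _ _)).
have -> : e = e / 2 + e / 2 by field.
apply: lerD.
  rewrite normrM; apply: (@le_trans _ _ ((`|k| + 1) * `|U y - U x|)).
    by rewrite ler_wpM2r // lerDl.
  by rewrite mulrC -ler_pdivlMr // H1.
apply: (le_trans (HC _ _)); rewrite -scalerBr opprB addrA subrK normrZ.
move: y2; rewrite ltr_pdivlMr ?mulr_gt0 // => y2; apply: le_trans (ltW y2).
rewrite [leRHS]mulrC -mulrA ler_pM2l // ler_wpM2r // lerDl //.
Qed.

Definition unit_dir (v : 'rV[R]_n) := (rho0 v)^-1 *: v.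

Lemma rho0_unit_dir v : v != 0 -> rho0 (unit_dir v) = 1.
Proof. by move=> /rgt0 v0; rewrite rZ ?invr_ge0 ?(ltW v0) // mulVf // gt_eqF. Qed.

Lemma unit_neq0 d : rho0 d = 1 -> d != 0.
Proof.
by move=> d1; apply/eqP => d0; move: d1; rewrite d0 rho0_0 // => /eqP; rewrite eq_sym oner_eq0.
Qed.

Definition rises_after q e := exists2 s1 : R, 0 < s1 & forall s, 0 <= s <= s1 ->
  Omega (q + s *: e) /\ U (q + s *: e) = U q + s.

Definition rises_before q d := exists2 s1 : R, 0 < s1 & forall s, 0 <= s <= s1 ->
  Omega (q - s *: d) /\ U (q - s *: d) = U q - s.

Lemma rises_after_segment (q w : 'rV[R]_n) (r : R) : (forall z, `|z - q| <= r -> Omega z) ->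
  `|w - q| <= r -> w != q -> U q + rho0 (w - q) <= U w ->
  rises_after q (unit_dir (w - q)).
Proof.
move=> qr wr wq Uw; have v0 : w - q != 0 by rewrite subr_eq0.
have qq : `|q - q| <= r by rewrite subrr normr0; exact: le_trans wr.
exists (rho0 (w - q)) => [|s /andP[s0 s1]]; first exact: rgt0.
pose t := s / rho0 (w - q).
have t0 : 0 <= t by rewrite divr_ge0.
have t1 : t <= 1 by rewrite ler_pdivrMr ?rgt0 // mul1r.
have tE : s *: unit_dir (w - q) = t *: (w - q) by rewrite scalerA.
have sE : s = t * rho0 (w - q) by rewrite divfK // gt_eqF // rgt0.
have seg a b u : `|a - q| <= r -> `|b - q| <= r -> 0 <= u <= 1 -> Omega (b + u *: (a - b)).
  exact: segment_in_ball qr.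
have Oz : Omega (q + t *: (w - q)) by apply: seg => //; rewrite t0.
have zr : `|q + t *: (w - q) - q| <= r.
  by rewrite addrAC subrr add0r normrZ ger0_norm // (le_trans _ wr) // ler_piMl.
rewrite tE; split => //.
have h1 := @U_segment (q + t *: (w - q)) q (fun u => seg _ _ u zr qq).
have h2 := @U_segment w (q + t *: (w - q)) (fun u => seg _ _ u wr zr).
rewrite addrAC subrr add0r rZ // -sE in h1.
rewrite (_ : w - (q + t *: (w - q)) = (1 - t) *: (w - q)) in h2; last first.
  by apply/rowP => i; rewrite !mxE; ring.
rewrite rZ ?subr_ge0 // mulrBl mul1r -sE in h2.
lra.
Qed.

Lemma rises_before_segment (q w : 'rV[R]_n) (r : R) : (forall z, `|z - q| <= r -> Omega z) ->
  `|w - q| <= r -> w != q -> U w + rho0 (q - w) <= U q ->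
  rises_before q (unit_dir (q - w)).
Proof.
move=> qr wr wq Uw; have v0 : q - w != 0 by rewrite subr_eq0 eq_sym.
have qq : `|q - q| <= r by rewrite subrr normr0; exact: le_trans wr.
exists (rho0 (q - w)) => [|s /andP[s0 s1]]; first exact: rgt0.
pose t := s / rho0 (q - w).
have t0 : 0 <= t by rewrite divr_ge0.
have t1 : t <= 1 by rewrite ler_pdivrMr ?rgt0 // mul1r.
have tE : q - s *: unit_dir (q - w) = q + t *: (w - q).
  by rewrite scalerA -/t -scalerN opprB.
have sE : s = t * rho0 (q - w) by rewrite divfK // gt_eqF // rgt0.
have seg a b u : `|a - q| <= r -> `|b - q| <= r -> 0 <= u <= 1 -> Omega (b + u *: (a - b)).
  exact: segment_in_ball qr.
have Oz : Omega (q + t *: (w - q)) by apply: seg => //; rewrite t0.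
have zr : `|q + t *: (w - q) - q| <= r.
  by rewrite addrAC subrr add0r normrZ ger0_norm // (le_trans _ wr) // ler_piMl.
rewrite tE; split => //.
have h1 := @U_segment q (q + t *: (w - q)) (fun u => seg _ _ u qq zr).
have h2 := @U_segment (q + t *: (w - q)) w (fun u => seg _ _ u zr wr).
rewrite (_ : q - (q + t *: (w - q)) = t *: (q - w)) in h1; last first.
  by apply/rowP => i; rewrite !mxE; ring.
rewrite (_ : q + t *: (w - q) - w = (1 - t) *: (q - w)) in h2; last first.
  by apply/rowP => i; rewrite !mxE; ring.
rewrite rZ // -sE in h1; rewrite rZ ?subr_ge0 // mulrBl mul1r -sE in h2.
lra.
Qed.

(** Strict convexity of the gauge forbids a ray to bend. *)
Lemma rays_are_straight q d e : Omega q -> rho0 d = 1 -> rho0 e = 1 ->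
  rises_before q d -> rises_after q e -> d = e.
Proof.
move=> Oq d1 e1 [s0 s00 H0] [s1 s10 H1].
have [r r0 rO] := closed_ball_in Omega_open Oq.
pose m := Num.min s0 s1; have m0 : 0 < m by rewrite lt_min s00.
have nd : 0 < `|d| + 1 by rewrite ltr_wpDl.
have ne : 0 < `|e| + 1 by rewrite ltr_wpDl.
pose s := Num.min m (Num.min (r / (`|d| + 1)) (r / (`|e| + 1))).
have sp : 0 < s by rewrite !lt_min s00 s10 !divr_gt0.
have ss0 : s <= s0 by rewrite /s /m !ge_min lexx.
have ss1 : s <= s1 by rewrite /s /m !ge_min lexx !orbT.
have sd : `|s *: d| <= r.
  rewrite normrZ gtr0_norm //; apply: (@le_trans _ _ (s * (`|d| + 1))).
    by rewrite ler_pM2l // lerDl.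
  by rewrite -ler_pdivlMr // /s !ge_min lexx !orbT.
have se : `|s *: e| <= r.
  rewrite normrZ gtr0_norm //; apply: (@le_trans _ _ (s * (`|e| + 1))).
    by rewrite ler_pM2l // lerDl.
  by rewrite -ler_pdivlMr // /s !ge_min lexx !orbT.
have [_ E0] := H0 s ltac:(by rewrite (ltW sp)); have [_ E1] := H1 s ltac:(by rewrite (ltW sp)).
have be : `|q + s *: e - q| <= r by rewrite [q + _]addrC addrK.
have bd : `|q - s *: d - q| <= r by rewrite [q - _]addrC addrK normrN.
have h := @U_segment (q + s *: e) (q - s *: d) (fun u => segment_in_ball rO be bd).
rewrite E0 E1 (_ : q + s *: e - (q - s *: d) = s *: e + s *: d) in h; last first.
  by apply/rowP => i; rewrite !mxE; ring.
have sed : rho0 (s *: e + s *: d) = rho0 (s *: e) + rho0 (s *: d).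
  apply/eqP; rewrite eq_le rho0D //= !rZ ?(ltW sp) // d1 e1; lra.
have := rho0_strict K_compact K_int0 K_C1 _ _ sed.
rewrite !rZ ?(ltW sp) // d1 e1 !mulr1 !scalerA mulVf ?gt_eqF // !scale1r => -> //.
  by rewrite scaler_eq0 gt_eqF //= unit_neq0.
by rewrite scaler_eq0 gt_eqF //= unit_neq0.
Qed.

(** Almost optimal curves reaching [q] cross a small sphere around [q], on which
    [U w + rho0 (q - w)] attains its minimum. *)
Lemma exists_ray_before q : Omega q -> exists d, rho0 d = 1 /\ rises_before q d.
Proof.
move=> Oq; have [r r0 rO] := closed_ball_in Omega_open Oq.
have [w [wr Fw]] : exists w, `|w - q| = r /\ 1 * U w + rho0 ((-1) *: (w - q)) <= U q.
  apply: attained_on_sphere; [by move=> z /rO; exact: subset_closure|exact: within_U_rho0|].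
  move=> e e0; have : ~ (U q + e <= U q) by lra.
  move=> lt; have [y [gamma [fy cg Hg]]] : exists y gamma,
      [/\ frontier Omega y, curves Omega y q gamma & phi y + L gamma < U q + e].
    apply: contrapT => h; apply: lt; apply: le_u_phi => //; first exact: subset_closure.
    move=> y gamma fy cg; rewrite leNgt; apply/negP => lt.
    by apply: h; exists y, gamma.
  have [gAC gO g0 g1] := cg.
  have yr : r < `|y - q|.
    rewrite ltNge; apply/negP => /rO; have [_] := (frontierE Omega_open y).1 fy; exact.
  have [|t [t0 t1 gr]] := @curve_crosses_sphere gamma q r gAC.
    by rewrite g0 g1 subrr normr0 ge_min (ltW r0) orbT le_max (ltW yr).
  have [V [cV HVs HV HL _]] := length_profile K_compact K_int0 gAC.
  exists (gamma t); split => //.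
  have := U_monotone gAC gO cV HVs HV (lexx 0) t0 t1; have := HV _ _ t0 t1 (lexx 1).
  by move: Hg; rewrite HL g0 g1 (U_frontier fy) scaleN1r opprB mul1r; lra.
exists (unit_dir (q - w)).
have wq : w != q by rewrite -subr_eq0 -normr_gt0 wr.
split; first by rewrite rho0_unit_dir // subr_eq0 eq_sym.
apply: (rises_before_segment rO) => //; first by rewrite wr.
by move: Fw; rewrite scaleN1r opprB mul1r.
Qed.

(** Almost optimal curves in the definition of [u_f q] end on the frontier or in
    [spt f], hence cross a small sphere around [q], on which
    [rho0 (w - q) - U w] attains its minimum. *)
Lemma exists_ray_after q : Omega q -> ~ S q -> U q <= u_f Omega f K phi q ->
  exists e, rho0 e = 1 /\ rises_after q e.
Proof.
move=> Oq nS Uf.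
have [W [oW Wq _ WS]] := outside_spt (subset_closure Oq) nS.
have [r r0 rO] := closed_ball_in (openI oW Omega_open) (conj Wq Oq).
have rO' z : `|z - q| <= r -> Omega z by move=> /rO[].
have [w [wr Fw]] : exists w, `|w - q| = r /\ (-1) * U w + rho0 (1 *: (w - q)) <= - U q.
  apply: attained_on_sphere; [by move=> z /rO' ; exact: subset_closure|exact: within_U_rho0|].
  move=> e e0; have : ~ (U q <= U q - e) by lra.
  move=> lt; have [z [gamma [Sz cg Hg]]] : exists z gamma,
      [/\ (frontier Omega `|` S) z, curves Omega q z gamma & U q - e < U z - L gamma].
    apply: contrapT => h; apply: lt; apply: (le_trans Uf); apply: u_f_le => //.
      exact: subset_closure.
    move=> z gamma Sz cg; rewrite leNgt; apply/negP => lt.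
    by apply: h; exists z, gamma.
  have [gAC gO g0 g1] := cg.
  have zr : r < `|z - q|.
    rewrite ltNge; apply/negP => zr; have [Wz Oz] := rO _ zr.
    case: Sz => [/(frontierE Omega_open)[] //|]; apply: WS => //; exact: subset_closure.
  have [|t [t0 t1 gr]] := @curve_crosses_sphere gamma q r gAC.
    by rewrite g0 g1 subrr normr0 ge_min (ltW r0) le_max (ltW zr) orbT.
  have [V [cV HVs HV HL _]] := length_profile K_compact K_int0 gAC.
  exists (gamma t); split => //.
  have := U_monotone gAC gO cV HVs HV t0 t1 (lexx 1); have := HV _ _ (lexx 0) t0 t1.
  by move: Hg; rewrite HL g0 g1 scale1r mulN1r; lra.
exists (unit_dir (w - q)).
have wq : w != q by rewrite -subr_eq0 -normr_gt0 wr.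
split; first by rewrite rho0_unit_dir // subr_eq0.
apply: (rises_after_segment rO') => //; first by rewrite wr.
by move: Fw; rewrite scale1r mulN1r; lra.
Qed.

Lemma ray_limit (x v : 'rV[R]_n) (k c : R) : Omega x -> 0 <= c -> `|k| <= 1 ->
  (forall s, 0 <= s -> s < c -> Omega (x + s *: v) /\ U (x + s *: v) = U x + k * s) ->
  cl (x + c *: v) /\ U (x + c *: v) = U x + k * c.
Proof.
move=> Ox c0 k1 H; have [c00|cn0] := eqVneq c 0.
  by rewrite c00 scale0r mulr0 !addr0; split => //; exact: subset_closure.
have cp : 0 < c by rewrite lt_neqAle eq_sym cn0.
have cx : cl (x + c *: v) by apply: closure_approach => // s s0 sc; exact: (H s s0 sc).1.
split => //; apply/eqP; rewrite -subr_eq0 -normr_le0; apply/ler_addgt0Pr => e e0.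
rewrite add0r.
have [d d0 Hd] := (within_continuous_eps _ _).1 cU _ cx (e / 2) ltac:(by rewrite divr_gt0).
have v1 : 0 < `|v| + 1 by rewrite ltr_wpDl.
pose h := Num.min c (Num.min (e / 2) (d / (2 * (`|v| + 1)))).
have h0 : 0 < h by rewrite !lt_min cp !divr_gt0 // mulr_gt0.
have hc : h <= c by rewrite /h ge_min lexx.
have he : h <= e / 2 by rewrite /h !ge_min lexx !orbT.
have hd : h <= d / (2 * (`|v| + 1)) by rewrite /h !ge_min lexx !orbT.
have [Oz Uz] := H (c - h) ltac:(by rewrite subr_ge0) ltac:(lra).
have zd : `|x + (c - h) *: v - (x + c *: v)| < d.
  have -> : x + (c - h) *: v - (x + c *: v) = - (h *: v) by apply/rowP => i; rewrite !mxE; ring.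
  rewrite normrN normrZ gtr0_norm //; apply: (@le_lt_trans _ _ (h * (`|v| + 1))).
    by rewrite ler_pM2l // lerDl.
  apply: (@le_lt_trans _ _ (d / 2)); last by lra.
  by move: hd; rewrite invfM mulrA ler_pdivlMr.
have := Hd _ (subset_closure Oz) zd; rewrite Uz distrC => a1.
have -> : U (x + c *: v) - (U x + k * c) =
    (U (x + c *: v) - (U x + k * (c - h))) - k * h by ring.
apply: (le_trans (ler_normB _ _)); have -> : e = e / 2 + e / 2 by field.
apply: lerD => //; rewrite normrM (gtr0_norm h0); apply: le_trans he.
by rewrite ger_pMl.
Qed.

Lemma ray_bounded (x v : 'rV[R]_n) : v != 0 -> exists B : R, forall t : R, 0 <= t ->
  (forall s, 0 <= s < t -> Omega (x + s *: v)) -> t <= B.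
Proof.
move=> v0; have [M M0 HM] := Omega_box Omega_bounded.
have nv : 0 < `|v| by rewrite normr_gt0.
exists ((M + `|x|) / `|v|) => t t0 H; rewrite leNgt; apply/negP => lt.
have s0 : 0 <= (M + `|x|) / `|v| by rewrite divr_ge0 // addr_ge0 // ltW.
have := HM _ (H ((M + `|x|) / `|v|) ltac:(by rewrite s0 lt)); set s := _ / _ => xs.
have : `|s *: v| <= `|x + s *: v| + `|x|.
  by rewrite -[X in `|X| <= _](addKr x) addrC; apply: (le_trans (ler_normB _ _)).
by rewrite normrZ ger0_norm // /s divfK ?gt_eqF //; lra.
Qed.

(** The rate 1 gives the times in the definition of [tau]; with the rate -1 a ray
    is followed backwards. *)
Definition ray_times (x v : 'rV[R]_n) (k : R) := [set t : R | [/\ 0 <= t,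
  forall s, 0 <= s < t -> Omega (x + s *: v) &
  forall s, 0 <= s <= t -> U (x + s *: v) = U x + k * s]].

(** The supremum is attained because [U] is continuous up to the frontier. *)
Lemma ray_times_sup (x v : 'rV[R]_n) (k : R) : Omega x -> v != 0 -> `|k| <= 1 ->
  let c := sup (ray_times x v k) in
  [/\ ray_times x v k c, forall t, ray_times x v k t -> t <= c & cl (x + c *: v)].
Proof.
move=> Ox v0 k1 c; have [B HB] := ray_bounded x v0.
have T0 : ray_times x v k 0.
  split => // s; first by move=> /andP[h1]; rewrite ltNge h1.
  move=> h; have -> : s = 0 by apply/eqP; rewrite eq_le andbC.
  by rewrite scale0r mulr0 !addr0.
have ub : ubound (ray_times x v k) B by move=> t [t0 tO _]; exact: HB.
have hs : has_sup (ray_times x v k) by split; [exists 0|exists B].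
have le_c t : ray_times x v k t -> t <= c by move=> Tt; apply: ub_le_sup => //; exists B.
have c0 : 0 <= c by exact: le_c.
have lt_c s : 0 <= s -> s < c -> Omega (x + s *: v) /\ U (x + s *: v) = U x + k * s.
  move=> s0 sc; have cs : 0 < c - s by rewrite subr_gt0.
  have [t [t0 tO tU] ct] := sup_adherent cs hs.
  move: ct; rewrite -/c => ct; have st : s < t by lra.
  by split; [apply: tO; rewrite s0|apply: tU; rewrite s0 ltW].
have [cx Uc] := ray_limit Ox c0 k1 lt_c.
split => //; split => //; first by move=> s /andP[s0 sc]; exact: (lt_c s s0 sc).1.
move=> s /andP[s0]; rewrite le_eqVlt => /orP[/eqP -> //|sc]; exact: (lt_c s s0 sc).2.
Qed.

Lemma ray_times_extend (x v : 'rV[R]_n) (k c s1 : R) : ray_times x v k c -> 0 <= s1 ->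
  (forall s, 0 <= s <= s1 -> Omega (x + c *: v + s *: v) /\
     U (x + c *: v + s *: v) = U (x + c *: v) + k * s) ->
  ray_times x v k (c + s1).
Proof.
move=> [c0 cO cUu] s10 H; have Uc := cUu c ltac:(by rewrite c0 lexx).
have E s : x + s *: v = x + c *: v + (s - c) *: v by apply/rowP => i; rewrite !mxE; ring.
split; first exact: addr_ge0.
- move=> s /andP[s0 sc]; have [h|h] := ltP s c; first by apply: cO; rewrite s0.
  rewrite E; apply: (H _ _).1; lra.
- move=> s /andP[s0 sc]; have [h|h] := leP s c; first by apply: cUu; rewrite s0.
  rewrite E (H _ _).2; [|lra]; rewrite Uc; ring.
Qed.

Lemma Pi_neq q y : Omega q -> Pi Omega K phi q y -> q != y.
Proof.
move=> Oq [[fy _] _]; apply/eqP => E; have [_] := (frontierE Omega_open y).1 fy.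
by apply; rewrite -E.
Qed.

Lemma Pi_rises_before q y : Omega q -> Pi Omega K phi q y ->
  rises_before q (unit_dir (q - y)).
Proof.
move=> Oq Py; have qy := Pi_neq Oq Py; have [[fy vis] Uq] := Py.
have v0 : q - y != 0 by rewrite subr_eq0.
have seg t : 0 <= t -> t < 1 -> Omega (q - t *: (q - y)).
  move=> t0 t1; have [->|t0'] := eqVneq t 0; first by rewrite scale0r subr0.
  apply: vis; split.
    exists (1 - t); first by rewrite /= in_itv /=; lra.
    by apply/rowP => i; rewrite !mxE; ring.
  move=> [/eqP E|/eqP E].
    have : (1 - t) *: (q - y) == 0.
      rewrite -subr_eq0 in E; rewrite -(eqP E); apply/eqP/rowP => i; rewrite !mxE; ring.
    by rewrite scaler_eq0 (negbTE v0) orbF; lra.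
  move: E; rewrite eq_sym addrC -subr_eq subrr eq_sym oppr_eq0 scaler_eq0 (negbTE v0) orbF.
  by rewrite (negbTE t0').
exists (rho0 (q - y) / 2) => [|s /andP[s0 s1]]; first by rewrite divr_gt0 ?rgt0.
pose t := s / rho0 (q - y); have t0 : 0 <= t by rewrite divr_ge0.
have t1 : t < 1 by rewrite ltr_pdivrMr ?rgt0 // mul1r; have := rgt0 v0; lra.
have sE : s = t * rho0 (q - y) by rewrite divfK // gt_eqF // rgt0.
have -> : s *: unit_dir (q - y) = t *: (q - y) by rewrite scalerA.
split; first exact: seg.
have h1 : U (q - t *: (q - y)) <= phi y + (1 - t) * rho0 (q - y).
  rewrite -rZ ?subr_ge0 ?(ltW t1) // -(length_straight K_compact K_int0 y).
  apply: U_le => //; rewrite (_ : q - t *: (q - y) = y + (1 - t) *: (q - y)); last first.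
    by apply/rowP => i; rewrite !mxE; ring.
  apply: curves_straight => u /andP[u0 u1].
  have [->|u0'] := eqVneq u 0; first by rewrite scale0r addr0; exact: frontier_closure.
  rewrite (_ : y + _ = q - (1 - u * (1 - t)) *: (q - y)); last first.
    by apply/rowP => i; rewrite !mxE; ring.
  have up : 0 < u by rewrite lt_neqAle eq_sym u0'.
  apply: subset_closure; apply: seg; last by rewrite ltrBlDr ltrDl mulr_gt0 // subr_gt0.
  by rewrite subr_ge0 mulr_ile1 //; lra.
have h2 : U q - U (q - t *: (q - y)) <= t * rho0 (q - y).
  have := @U_segment q (q - t *: (q - y)); rewrite (_ : q - (q - _) = t *: (q - y)); last first.
    by apply/rowP => i; rewrite !mxE; ring.
  rewrite rZ //; apply => u /andP[u0 u1].
  rewrite (_ : q - _ + _ = q - ((1 - u) * t) *: (q - y)); last by apply/rowP => i; rewrite !mxE; ring.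
  apply: seg; first by rewrite mulr_ge0 // subr_ge0.
  by apply: le_lt_trans t1; rewrite ler_piMl //; lra.
by move: h1 h2; rewrite mulrBl mul1r -sE; lra.
Qed.

(** Follow backwards a ray that arrives at [q] as long as possible. If it stopped
    inside [Omega], the ray arriving at its last point would prolong it, since
    rays are straight. *)
Lemma Pi_nonempty q : Omega q -> Pi Omega K phi q !=set0.
Proof.
move=> Oq; have [d [d1 [s1 s10 Hs]]] := exists_ray_before Oq.
have d0 := unit_neq0 d1; have nd0 : - d != 0 by rewrite oppr_eq0.
have k1 : `|-1| <= 1 :> R by rewrite normrN1.
have [Tc le_c cx] := ray_times_sup Oq nd0 k1.
set c := sup _ in Tc le_c cx; have [c0 cO cUu] := Tc.
have cp : 0 < c.
  apply: (lt_le_trans s10); apply: le_c; split; first exact: ltW.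
    by move=> s /andP[h1 h2]; rewrite scalerN; apply: (Hs s _).1; rewrite h1 ltW.
  by move=> s h; rewrite scalerN mulN1r; exact: (Hs s h).2.
have Up := cUu c ltac:(by rewrite c0 lexx).
set p := q + c *: - d in cx Up.
have fp : frontier Omega p.
  apply/frontierE => //; split => // Op.
  have [d' [d'1 rb]] := exists_ray_before Op.
  have ra : rises_after p d.
    exists c => // s /andP[h1 h2].
    have -> : p + s *: d = q + (c - s) *: - d by apply/rowP => i; rewrite !mxE; ring.
    split; last by rewrite cUu ?Up; [ring|lra].
    have [s0'|s0'] := eqVneq s 0; first by rewrite s0' subr0.
    by apply: cO; have : 0 < s; [by rewrite lt_neqAle eq_sym s0'|lra].
  have E := rays_are_straight Op d'1 d1 rb ra; have [s2 s20 H2] := rb.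
  have : c + s2 <= c; last by lra.
  apply: le_c; apply: ray_times_extend => //; first exact: ltW.
  by move=> s h; rewrite -/p scalerN mulN1r -E; exact: H2.
have qp : q - p = c *: d by apply/rowP => i; rewrite !mxE; ring.
exists p; split; last first.
  by rewrite -U_frontier // qp rZ // d1 Up; ring.
split => // z [[t]]; rewrite /= in_itv /= => /andP[t0 t1] <- nz.
have -> : (1 - t) *: p + t *: q = q + ((1 - t) * c) *: - d.
  by apply/rowP => i; rewrite !mxE; ring.
apply: cO; rewrite mulr_ge0 ?subr_ge0 //= gtr_pMl // ltrBlDr ltrDl lt_neqAle t0 andbT.
by apply/eqP => tE; apply: nz; left; rewrite -tE subr0 scale1r scale0r addr0.
Qed.

Lemma regular_ray x : Omega x -> ~ D Omega K phi x ->
  exists y, Pi Omega K phi x y /\ ray_dir Omega K phi x = unit_dir (x - y).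
Proof.
move=> Ox nD; have [d Dd] : exists d, Delta Omega K phi x = [set d].
  by apply: contrapT => h; apply: nD; split.
have [y Py] := Pi_nonempty Ox; exists y; split => //.
have : Delta Omega K phi x (ray_dir Omega K phi x).
  by apply: (@xgetPex _ 0 (Delta Omega K phi x)); exists d; rewrite Dd.
have : Delta Omega K phi x (unit_dir (x - y)) by exists y.
by rewrite Dd => -> ->.
Qed.

Lemma tauE x : ~ D Omega K phi x ->
  tau Omega K phi x = sup (ray_times x (ray_dir Omega K phi x) 1).
Proof.
move=> nD; rewrite /tau asboolF //; congr sup; apply/seteqP.
by split=> t [a b c]; split => // s h; have := c s h; rewrite mul1r.
Qed.

Lemma ray_end_D x : D Omega K phi x -> ray_end Omega K phi x = x.
Proof. by move=> Dx; rewrite /ray_end /tau asboolT // scale0r addr0. Qed.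

(** The transport ray of [x] is an admissible curve in the definition of [u_f x],
    along which [U] grows exactly by the length. *)
Lemma contact_of_ray_ends : J Omega K phi `&` Omega `<=` S ->
  forall x, Omega x -> u_f Omega f K phi x = U x.
Proof.
move=> JS x Ox; have cx := subset_closure Ox.
apply/eqP; rewrite eq_le u_f_le_u_phi //=.
have [Dx|nD] := pselect (D Omega K phi x).
  apply: u_f_obstacle => //; right; apply: JS; split => //.
  by exists x => //; exact: ray_end_D.
have [y [Py dE]] := regular_ray Ox nD.
have d1 : rho0 (ray_dir Omega K phi x) = 1.
  by rewrite dE rho0_unit_dir // subr_eq0; exact: Pi_neq.
have k1 : `|1| <= 1 :> R by rewrite normr1.
have [Tc le_c cc] := ray_times_sup Ox (unit_neq0 d1) k1.
rewrite -(tauE nD) in Tc le_c cc; set c := tau _ _ _ _ in Tc le_c cc.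
have [c0 cO cUu] := Tc; have Uc := cUu c ltac:(by rewrite c0 lexx).
have Eq : ray_end Omega K phi x = x + c *: ray_dir Omega K phi x by [].
have obst : (frontier Omega `|` S) (x + c *: ray_dir Omega K phi x).
  have [Oq|fq] := closure_cases Omega_open cc; last by left.
  by right; apply: JS; split => //; exists x.
apply: (@le_trans _ _ (U (x + c *: ray_dir Omega K phi x) - L (straight x (c *: ray_dir Omega K phi x)))).
  by rewrite length_straight // rZ // d1 Uc; lra.
apply: u_f_ge => //; apply: curves_straight => s /andP[s0 s1]; rewrite scalerA.
have [->|s1'] := eqVneq s 1; first by rewrite mul1r.
have [c00|c00] := eqVneq c 0; first by rewrite c00 mulr0 scale0r addr0.
apply: subset_closure; apply: cO; rewrite mulr_ge0 //= gtr_pMl ?lt_neqAle ?s1' ?s1 //.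
by rewrite eq_sym c00.
Qed.

(** Around a ray end [q] outside [spt f] some ray leaves [q]. It has the direction
    of every ray arriving at [q]. It thus prolongs a ray of a point off [D] beyond
    its end, and it makes the direction at a point of [D] unique. *)
Lemma ray_ends_of_contact : (forall x, Omega x -> u_f Omega f K phi x = U x) ->
  J Omega K phi `&` Omega `<=` S.
Proof.
move=> UfU q [[x Ox xq] Oq]; apply: contrapT => nS.
have [e [e1 ra]] := exists_ray_after Oq nS ltac:(by rewrite UfU).
have [Dx|nD] := pselect (D Omega K phi x).
  have xq' : x = q by rewrite -xq ray_end_D.
  have [_] := Dx; apply; exists e; rewrite xq'.
  have dirs y : Pi Omega K phi q y -> unit_dir (q - y) = e.
    move=> Py; apply: (rays_are_straight Oq) => //; last exact: Pi_rises_before.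
    by rewrite rho0_unit_dir // subr_eq0; exact: Pi_neq.
  apply/seteqP; split => [_ [y Py <-]|_ ->]; first exact: dirs.
  by have [y Py] := Pi_nonempty Oq; exists y => //; exact: dirs.
have [y [Py dE]] := regular_ray Ox nD.
have d1 : rho0 (ray_dir Omega K phi x) = 1.
  by rewrite dE rho0_unit_dir // subr_eq0; exact: Pi_neq.
have k1 : `|1| <= 1 :> R by rewrite normr1.
have [Tc le_c cc] := ray_times_sup Ox (unit_neq0 d1) k1.
rewrite -(tauE nD) in Tc le_c cc; move: xq; rewrite /ray_end.
set c := tau _ _ _ _ in Tc le_c cc *; set d := ray_dir _ _ _ _ in dE d1 Tc le_c cc * => xq.
have [c0 cO cUu] := Tc; have Uc := cUu c ltac:(by rewrite c0 lexx).
have rb : rises_before q d.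
  have [c00|c00] := eqVneq c 0.
    have -> : q = x by rewrite -xq c00 scale0r addr0.
    by rewrite dE; exact: Pi_rises_before.
  have cp : 0 < c by rewrite lt_neqAle eq_sym c00.
  exists c => // s /andP[s0 s1].
  have E : q - s *: d = x + (c - s) *: d by rewrite -xq; apply/rowP => i; rewrite !mxE; ring.
  split; last by rewrite E cUu -?xq ?Uc; [ring|lra].
  have [->|s0'] := eqVneq s 0; first by rewrite scale0r subr0.
  by rewrite E; apply: cO; have : 0 < s; [by rewrite lt_neqAle eq_sym s0'|lra].
have E := rays_are_straight Oq d1 e1 rb ra; have [s1 s10 Hs] := ra.
have : c + s1 <= c; last by lra.
apply: le_c; apply: ray_times_extend => //; first exact: ltW.
by move=> s h; rewrite xq mul1r E; exact: Hs.
Qed.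

End transport_rays.

Unset Implicit Arguments.
Set Strict Implicit.
Set Printing Implicit Defensive.

Theorem theorem7p2 (R : realType) (n : nat) (hn : (1 <= n)%N)
    (Omega : set 'rV[R]_n) (f : 'rV[R]_n -> R) (K : set 'rV[R]_n)
    (phi : 'rV[R]_n -> R)
    (Omega_nonempty : Omega !=set0) (Omega_bounded : bounded_set Omega)
    (Omega_connected : connected Omega) (Omega_open : open Omega)
    (f_L1 : lebesgue_rV.-integrable Omega (fun x => (f x)%:E))
    (f_ge0 : \forall x \ae lebesgue_rV, Omega x -> 0 <= f x)
    (K_compact : compact K) (K_convex : convex_set (K : set (convex_lmodType 'rV[R]_n)))
    (K_C1 : class_C1 K) (K_int0 : interior K 0)
    (phi_continuous : {within frontier Omega, continuous phi})
    (phi_compat : forall x y gamma, frontier Omega x -> frontier Omega y ->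
      curves Omega y x gamma -> phi x - phi y <= curve_length K gamma) :
  (forall u, X_phi Omega K phi u ->
     (solution_P Omega f K phi u <->
      forall x, closure Omega x ->
        u_f Omega f K phi x <= u x <= u_phi Omega K phi x)) /\
  ((forall x, Omega x -> u_f Omega f K phi x = u_phi Omega K phi x) <->
   J Omega K phi `&` Omega `<=` spt Omega f) /\
  ((forall x, Omega x -> u_f Omega f K phi x = u_phi Omega K phi x) ->
   solution_P Omega f K phi (u_phi Omega K phi) /\
   forall v, solution_P Omega f K phi v ->
     forall x, closure Omega x -> v x = u_phi Omega K phi x).
Proof.
have UX : X_phi Omega K phi (u_phi Omega K phi) by exact: u_phi_admissible.
have part1 u : X_phi Omega K phi u -> (solution_P Omega f K phi u <->
    forall x, closure Omega x -> u_f Omega f K phi x <= u x <= u_phi Omega K phi x).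
  move=> uX; rewrite (_ : solution_P Omega f K phi u <-> _); last exact: solution_iff_contact.
  exact: barriers_characterise.
split => //; split.
  by split; [exact: ray_ends_of_contact|exact: contact_of_ray_ends].
move=> UfU; split; first by apply/solution_iff_contact.
move=> v vP x cx; have [vX _] := vP.
have [Ox|fx] := closure_cases Omega_open cx.
  by have := (part1 v vX).1 vP x cx; rewrite UfU // => h; apply/eqP; rewrite eq_le andbC.
by have [_ vphi _] := vX; rewrite (vphi _ fx) u_phi_frontier.
Qed.
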